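(* Let $\Omega\subseteq\mathbb{R}^n$ be open and $X\in C^\infty(\Omega,\mathbb{R}^n)$. Then (i) $\widetilde{\mathrm{D}}_X(\mathcal{M}(\Omega))\subseteq\mathcal{M}(\Omega)$ and $\widehat{\mathrm{D}}_X(\mathcal{M}(\Omega))\subseteq\mathcal{M}(\Omega)$, (ii) $\widetilde{\mathrm{D}}_X(\mathcal{N}(\Omega))\subseteq\mathcal{N}(\Omega)$ and $\widehat{\mathrm{D}}_X(\mathcal{N}(\Omega))\subseteq\mathcal{N}(\Omega)$.
   Context: Notation: $\mathbb{N}_0=\{0,1,2,\dots\}$, $\mathbb{R}^+=[0,\infty)$. $K\Subset L$ means that $K$ is compact and contained in the interior of $L$. $\mathcal{U}_x(\Omega)$ is the set of open neighborhoods of $x$ in $\Omega$. $C^\infty(U)$ is the space of complex-valued smooth functions on $U$, $\mathcal{D}(\Omega)$ the space of test functions with its usual topology, $\mathcal{D}_L(U)$ the space of test functions on $U$ with support in $L$. Smoothness of maps between locally convex spaces is understood in the sense of convenient calculus (Kriegl--Michor), and $\mathrm{d}^k R$ denotes the $k$-th differential. Basic space: $\mathcal{B}(\Omega)$ is the set of sheaf homomorphisms from $C^\infty(-,\mathcal{D}(\Omega))$ to $C^\infty(-)$, both regarded as sheaves on $\Omega$ with values in the category of locally convex spaces with smooth maps. That is, $R\in\mathcal{B}(\Omega)$ is a family $(R_U)_U$ of smooth maps $R_U: C^\infty(U,\mathcal{D}(\Omega))\to C^\infty(U)$ ($U\subseteq\Omega$ open) with $R_U(\vec\varphi)|_V=R_V(\vec\varphi|_V)$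 for all open $V\subseteq U$. One writes $R$ for $R_U$. Derivatives: for $g\in C^\infty(U)$, $\mathrm{D}_Xg=\sum_iX_i\,\partial_ig$ is the directional derivative. For $R\in\mathcal{B}(\Omega)$, $U\subseteq\Omega$ open and $\vec\varphi\in C^\infty(U,\mathcal{D}(\Omega))$: $(\widetilde{\mathrm{D}}_XR)(\vec\varphi)=\mathrm{D}_X(R_U(\vec\varphi))$, $(\widehat{\mathrm{D}}_XR)(\vec\varphi)=-\mathrm{d}R_U(\vec\varphi)(\mathrm{D}^{\mathrm{SK}}_X\vec\varphi)+\mathrm{D}_X(R_U(\vec\varphi))$, where $\mathrm{D}^{\mathrm{SK}}_X\vec\varphi$ is the sum of the directional derivative of $\vec\varphi$ in $x$ along $X(x)$ and the Lie derivative along $X$ of $\vec\varphi(x)$ regarded as an $n$-form, i.e. $(\mathrm{D}^{\mathrm{SK}}_X\vec\varphi)(x)(y)=\sum_iX_i(x)\,\partial_{x_i}\vec\varphi(x)(y)+\sum_iX_i(y)\,\partial_{y_i}\vec\varphi(x)(y)+(\operatorname{Div}X)(y)\,\vec\varphi(x)(y)$. Seminorms: for $U\subseteq\Omega$ open, $K,L\Subset U$, $m,c,l\in\mathbb{N}_0$, $B$ a bounded set of smooth functions on $\Omega$, and $\vec\varphi\in C^\infty(U,\mathcal{D}_L(U))$: $\|f\|_{K,m}=\sup_{x\in K,|\alpha|\le m}|\partial^\alpha f(x)|$; $\|\vec\varphi\|_{K,c;L,l}=\sup_{x\in K,|\alpha|\le c,\,y\in L,|\beta|\le l}|\partial_x^\alpha\partial_y^\beta\vec\varphi(x)(y)|$;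 $\|\vec\varphi\|_{K,c;B}=\sup_{x\in K,|\alpha|\le c,\,f\in B}|\int f(y)\,\partial_x^\alpha\vec\varphi(x)(y)\,dy|$; $\|\vec\varphi-\vec\delta\|_{K,c;B}=\sup_{x\in K,|\alpha|\le c,\,f\in B}|\int f(y)\,\partial_x^\alpha\vec\varphi(x)(y)\,dy-\partial^\alpha f(x)|$ (here $\vec\delta(x)=\delta_x$). Polynomials: $\mathcal{P}_k=\mathbb{R}^+[y_0,\dots,y_k]$ (polynomials with coefficients in $\mathbb{R}^+$); $\mathcal{I}_k=\{\lambda\in\mathbb{R}^+[y_0,\dots,y_k,z_0,\dots,z_k] : \lambda(y_0,\dots,y_k,0,\dots,0)=0\}$. $R\in\mathcal{B}(\Omega)$ is moderate ($R\in\mathcal{M}(\Omega)$) if: $(\forall x\in\Omega)(\exists U\in\mathcal{U}_x(\Omega))(\forall K,L\Subset U)(\forall m,k\in\mathbb{N}_0)(\exists c,l\in\mathbb{N}_0)(\exists\lambda\in\mathcal{P}_k)(\forall\vec\varphi_0,\dots,\vec\varphi_k\in C^\infty(U,\mathcal{D}_L(U)))$: $\|\mathrm{d}^kR(\vec\varphi_0)(\vec\varphi_1,\dots,\vec\varphi_k)\|_{K,m}\le\lambda(\|\vec\varphi_0\|_{K,c;L,l},\dots,\|\vec\varphi_k\|_{K,c;L,l})$. $R\in\mathcal{B}(\Omega)$ is negligible ($R\in\mathcal{N}(\Omega)$) if: $(\forall x\in\Omega)(\exists U\in\mathcal{U}_x(\Omega))(\forall K,L\Subset U)(\forall m,k\in\mathbb{N}_0)(\exists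 c,l\in\mathbb{N}_0)(\exists\lambda\in\mathcal{I}_k)(\exists B\subseteq C^\infty(\Omega)\text{ bounded})(\forall\vec\varphi_0,\dots,\vec\varphi_k\in C^\infty(U,\mathcal{D}_L(U)))$: $\|\mathrm{d}^kR(\vec\varphi_0)(\vec\varphi_1,\dots,\vec\varphi_k)\|_{K,m}\le\lambda(\|\vec\varphi_0\|_{K,c;L,l},\dots,\|\vec\varphi_k\|_{K,c;L,l},\|\vec\varphi_0-\vec\delta\|_{K,c;B},\|\vec\varphi_1\|_{K,c;B},\dots,\|\vec\varphi_k\|_{K,c;B})$. *)

(* Defs.v *)
From HB Require Import structures.
From mathcomp Require Import all_boot all_order all_algebra.
From mathcomp Require Import all_classical all_reals all_analysis.
From mathcomp Require Import complex.
From mathcomp Require mpoly.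
(* The notations of [mpoly] clash with those of the analysis library. *)
Import (canonicals) mpoly.

Set Implicit Arguments.
Unset Strict Implicit.
Unset Printing Implicit Defensive.

Import Order.TTheory GRing.Theory Num.Theory.
Import numFieldNormedType.Exports.

Local Open Scope classical_set_scope.
Local Open Scope ring_scope.

(* [Rcomplex R] is the field of complex numbers viewed as a vector space over
   [R]; the library equips it with the modulus as an [R]-valued norm, and we
   complete this to a normed module so that ['D_v f] and continuity apply to
   complex-valued functions of real variables. *)
Section Rcomplex_normedModType.
Variable R : realType.

Lemma Rcomplex_normrZ (l : R) (z : Rcomplex R) : `|l *: z| = `|l| * `|z|.
Proof.
case: z => a b; rewrite /Num.norm /=.
by rewrite !exprMn -mulrDr sqrtrM ?sqr_ge0// sqrtr_sqr.
Qed.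

HB.instance Definition _ :=
  PseudoMetric.copy (Rcomplex R) (pseudoMetric_normed (Rcomplex R)).
HB.instance Definition _ := isPointed.Build (Rcomplex R) 0.
HB.instance Definition _ :=
  NormedZmod_PseudoMetric_eq.Build R (Rcomplex R) erefl.
HB.instance Definition _ :=
  PseudoMetricNormedZmod_Lmodule_isNormedModule.Build R (Rcomplex R)
    Rcomplex_normrZ.

End Rcomplex_normedModType.

Section PartialDerivatives.
Variables (R : realType) (n : nat).
Implicit Types (U : set 'rV[R]_n) (a : {ffun 'I_n -> nat}).

(* For a family [D] of operators (the partial derivatives), [D^a]. *)
Definition mpow (A : Type) (D : 'I_n -> A -> A) a (f : A) : A :=
  foldr (fun i g => iter (a i) (D i) g) f (enum 'I_n).

Definition mlen a : nat := (\sum_i a i)%N.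

Definition partial (W : normedModType R) (i : 'I_n) (f : 'rV[R]_n -> W) :
  'rV[R]_n -> W := 'D_(delta_mx 0 i) f.

Definition mpartial (W : normedModType R) a (f : 'rV[R]_n -> W) :
  'rV[R]_n -> W := mpow (@partial W) a f.

(* [s] is the list of the successive directions of differentiation. *)
Definition smooth_on (W : normedModType R) U (f : 'rV[R]_n -> W) : Prop :=
  forall (s : seq 'I_n) x, U x ->
    let g := foldr (@partial W) f s in
    {for x, continuous g} /\ forall i, derivable g x (delta_mx 0 i).

End PartialDerivatives.

(* Iterated integral over [R^n], one coordinate at a time; by Fubini's theorem
   this is the Lebesgue integral for the continuous compactly supported
   functions to which it is applied. *)
Fixpoint integral_rV (R : realType) (n : nat) : ('rV[R]_n -> R) -> R :=
  match n with
  | 0 => fun f => f 0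
  | m.+1 => fun f =>
      \int[@lebesgue_measure R]_t
        integral_rV (fun y : 'rV[R]_m => f (row_mx (t%:M : 'rV[R]_1) y))
  end.

Definition integral_rVC (R : realType) (n : nat) (f : 'rV[R]_n -> Rcomplex R) :
  Rcomplex R := Complex (integral_rV (fun y => complex.Re (f y)))
                        (integral_rV (fun y => complex.Im (f y))).

(* A locally convex space, presented as a linear subspace [lcs_mem] of an
   ambient real vector space together with a set of seminorms on this subspace
   generating the topology. The values of the seminorms outside of [lcs_mem]
   are irrelevant. Complex spaces are viewed as real ones. *)
Record lcs (R : realType) := LCS {
  lcs_sort :> lmodType R;
  lcs_mem : set lcs_sort;
  lcs_seminorm : set (lcs_sort -> R) }.

Section LocallyConvexSpaces.
Variable R : realType.
Implicit Types E F : lcs R.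

Definition lcs_cvg E (T : Type) (G : set_system T) (f : T -> E) (l : E) :=
  forall q, lcs_seminorm q -> q (f t - l) @[t --> G] --> (0 : R).

Definition lcs_bounded E (B : set E) :=
  B `<=` @lcs_mem R E /\
  forall q, lcs_seminorm q -> exists C : R, forall f, B f -> q f <= C.

Definition is_lcs_derive E (T : lmodType R) (f : T -> E) (x v : T) (l : E) :=
  lcs_mem l /\
  lcs_cvg ((0 : R)^') (fun h : R => h^-1 *: (f (x + h *: v) - f x)) l.

Definition lcs_derivable E (T : lmodType R) (f : T -> E) (x v : T) :=
  exists l, is_lcs_derive f x v l.

(* The directional derivative of [f] along [v], as a limit in [E]
   (junk value 0 if it does not exist). *)
Definition lcs_derive E (T : lmodType R) (f : T -> E) (x v : T) : E :=
  xget 0 [set l | is_lcs_derive f x v l].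

Definition smooth_curve E (c : R -> E) :=
  (forall t, lcs_mem (c t)) /\
  forall k (t : R),
    @lcs_derivable E R^o (iter k (fun b t' => @lcs_derive E R^o b t' 1) c) t 1.

(* Convenient calculus: smooth maps are those preserving smooth curves. *)
Definition convenient_smooth E F (f : E -> F) :=
  (forall x, lcs_mem x -> lcs_mem (f x)) /\
  forall c : R -> E, smooth_curve c -> smooth_curve (f \o c).

(* [lcs_diffn f x [:: v1; ..; vk]] is the k-th differential of [f] at [x],
   applied to v1, .., vk. *)
Fixpoint lcs_diffn E F (f : E -> F) (x : E) (s : seq E) : F :=
  if s is v :: s' then lcs_derive (fun z : E => lcs_diffn f z s') x v else f x.

End LocallyConvexSpaces.

Section FunctionSpaces.
Variables (R : realType) (n : nat).
Local Notation Rn := 'rV[R]_n.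
Local Notation C := (Rcomplex R).
Implicit Types (U K L Omega : set Rn).

(* Functions on an open set [U] are represented by functions on [R^n] vanishing
   outside of [U]; [extend0 U f] is the restriction of [f] to [U] in this
   representation. *)
Definition extend0 (V : zmodType) U (f : Rn -> V) : Rn -> V :=
  patch (fun=> 0) U f.

Definition seminorm_K K (m : nat) (f : Rn -> C) : R :=
  sup [set r | exists x a, [/\ K x, (mlen a <= m)%N & r = `|mpartial a f x|]].

Definition Cinf U : lcs R := @LCS R (Rn -> C)
  [set f | (forall x, ~ U x -> f x = 0) /\ smooth_on U f]
  [set p | exists K m, [/\ compact K, K `<=` U & p = seminorm_K K m]].

Definition supp (f : Rn -> C) : set Rn := closure [set y | f y != 0].

(* Test functions with support in [L], with the Frechet topology; meant for
   compact [L]. *)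
Definition testL L : lcs R := @LCS R (Rn -> C)
  [set f | smooth_on setT f /\ supp f `<=` L]
  [set p | exists m, p = seminorm_K L m].

Definition test_fun Omega : set (Rn -> C) :=
  [set f | [/\ smooth_on setT f, compact (supp f) & supp f `<=` Omega]].

(* D(Omega) with its usual topology, the finest locally convex one for which
   the inclusions of the spaces D_K are continuous: its continuous seminorms
   are those whose restriction to each D_K is continuous. *)
Definition test Omega : lcs R := @LCS R (Rn -> C) (test_fun Omega)
  [set q | [/\ forall f g, test_fun Omega f -> test_fun Omega g ->
                 q (f + g) <= q f + q g,
               forall (r : R) f, test_fun Omega f -> q (r *: f) = `|r| * q f
             & forall K, compact K -> K `<=` Omega ->
                 exists (c : R) (m : nat), forall f, @lcs_mem R (testL K) f ->
                   q f <= c * seminorm_K K m f]].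

Definition lpartial (E : lcs R) (i : 'I_n) (f : Rn -> E) : Rn -> E :=
  fun x => lcs_derive f x (delta_mx 0 i).

Definition lsmooth_on (E : lcs R) U (f : Rn -> E) : Prop :=
  (forall x, U x -> lcs_mem (f x)) /\
  forall (s : seq 'I_n) x, U x ->
    let g := foldr (@lpartial E) f s in
    lcs_cvg (nbhs x) g (g x) /\ forall i, lcs_derivable g x (delta_mx 0 i).

(* The space of smooth functions from [U] to [E], with the topology of uniform
   convergence of every derivative on compact sets. *)
Definition CinfE U (E : lcs R) : lcs R := @LCS R (Rn -> E)
  [set f | (forall x, ~ U x -> f x = 0) /\ lsmooth_on U f]
  [set p | exists K m q, [/\ compact K, K `<=` U, @lcs_seminorm R E q &
     p = fun f : Rn -> E => sup [set r | exists x a,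
           [/\ K x, (mlen a <= m)%N & r = q (mpow (@lpartial E) a f x)]]]].

End FunctionSpaces.

Section BasicSpace.
Variables (R : realType) (n : nat).
Local Notation Rn := 'rV[R]_n.
Local Notation C := (Rcomplex R).
Implicit Types (U V K L Omega : set Rn).

(* Underlying data of an element of the basic space: a map R_U for every U.
   Only the values at open [U `<=` Omega] and at elements of
   C^oo(U, D(Omega)) matter. *)
Definition family := set Rn -> (Rn -> Rn -> C) -> (Rn -> C).

Definition basic_space Omega : set family := [set F |
  (forall U, open U -> U `<=` Omega ->
     @convenient_smooth R (CinfE U (test Omega)) (Cinf U) (F U)) /\
  (forall U V, open U -> open V -> V `<=` U -> U `<=` Omega ->
     forall phi, @lcs_mem R (CinfE U (test Omega)) phi ->
       extend0 V (F U phi) = F V (extend0 V phi))].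

Definition diffn Omega (F : family) U (phi : Rn -> Rn -> C)
    (s : seq (Rn -> Rn -> C)) : Rn -> C :=
  @lcs_diffn R (CinfE U (test Omega)) (Cinf U) (F U) phi s.

Definition dir_derive (X : Rn -> Rn) (g : Rn -> C) : Rn -> C :=
  fun x => \sum_i X x 0 i *: partial i g x.

Definition divergence (X : Rn -> Rn) (y : Rn) : R :=
  \sum_i partial i (fun z => X z 0 i : R) y.

(* The partial derivatives in [x] of a D(Omega)-valued function are computed
   pointwise in [y], and so they are in the seminorms below. Values of [X]
   outside of Omega do not matter, as [phi x] vanishes near such points. *)
Definition DSK U (X : Rn -> Rn) (phi : Rn -> Rn -> C) : Rn -> Rn -> C :=
  extend0 U (fun x y =>
    dir_derive X (phi^~ y) x + dir_derive X (phi x) y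
    + divergence X y *: phi x y).

Definition Dtilde (X : Rn -> Rn) (F : family) : family :=
  fun U phi => extend0 U (dir_derive X (F U phi)).

Definition Dhat Omega (X : Rn -> Rn) (F : family) : family :=
  fun U phi => - diffn Omega F U phi [:: DSK U X phi]
               + extend0 U (dir_derive X (F U phi)).

Definition cptin K L := compact K /\ K `<=` L°.

Definition seminorm_KL K c L l (phi : Rn -> Rn -> C) : R :=
  sup [set r | exists x a y b,
    [/\ K x, (mlen a <= c)%N, L y, (mlen b <= l)%N &
        r = `|mpartial a (fun x' => mpartial b (phi x') y) x|]].

Definition pairing (f : Rn -> C) (a : {ffun 'I_n -> nat})
    (phi : Rn -> Rn -> C) (x : Rn) : C :=
  integral_rVC (fun y => f y * mpartial a (phi^~ y) x).

Definition seminorm_KB K c (B : set (Rn -> C)) (phi : Rn -> Rn -> C) : R :=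
  sup [set r | exists x a f,
    [/\ K x, (mlen a <= c)%N, B f & r = `|pairing f a phi x|]].

Definition dist_delta_KB K c (B : set (Rn -> C)) (phi : Rn -> Rn -> C) : R :=
  sup [set r | exists x a f, [/\ K x, (mlen a <= c)%N, B f &
    r = `|pairing f a phi x - mpartial a f x|]].

End BasicSpace.

Section Polynomials.
Variable R : realType.

Definition nonneg_mpoly (m : nat) (p : mpoly.mpoly m R) : Prop :=
  forall e, 0 <= mpoly.mcoeff e p.

Definition polyP (k : nat) : set (mpoly.mpoly k.+1 R) := @nonneg_mpoly k.+1.

(* The first k+1 variables are y_0, .., y_k and the last k+1 are
   z_0, .., z_k. *)
Definition polyI (k : nat) : set (mpoly.mpoly (k.+1 + k.+1) R) :=
  [set p | nonneg_mpoly p /\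
     mpoly.comp_mpoly [tuple match fintype.split i with
                             | inl j => mpoly.mpolyX R (mpoly.mnm1 j)
                             | inr _ => 0
                             end : mpoly.mpoly k.+1 R | i < k.+1 + k.+1] p = 0].

End Polynomials.

Section ModerateNegligible.
Variables (R : realType) (n : nat).
Local Notation Rn := 'rV[R]_n.
Local Notation C := (Rcomplex R).
Variable Omega : set Rn.

Definition diffn_at (F : family R n) (U : set Rn) (k : nat)
    (phi : 'I_k.+1 -> Rn -> Rn -> C) : Rn -> C :=
  diffn Omega F U (phi ord0) [seq phi (lift ord0 i) | i <- enum 'I_k].

Definition moderate_family : set (family R n) := [set F | basic_space Omega F /\
  forall x, Omega x -> exists U, [/\ open U, U `<=` Omega, U x &
  forall K L, cptin K U -> cptin L U -> forall m k : nat,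
  exists (c l : nat) (p : mpoly.mpoly k.+1 R), polyP p /\
  forall phi : 'I_k.+1 -> Rn -> Rn -> C,
    (forall i, @lcs_mem R (CinfE U (testL L)) (phi i)) ->
    seminorm_K K m (diffn_at F U phi)
      <= mpoly.meval (fun i => seminorm_KL K c L l (phi i)) p]].

Definition negligible_family : set (family R n) := [set F | basic_space Omega F /\
  forall x, Omega x -> exists U, [/\ open U, U `<=` Omega, U x &
  forall K L, cptin K U -> cptin L U -> forall m k : nat,
  exists (c l : nat) (p : mpoly.mpoly (k.+1 + k.+1) R) (B : set (Rn -> C)),
  [/\ polyI p, @lcs_bounded R (Cinf Omega) B &
  forall phi : 'I_k.+1 -> Rn -> Rn -> C,
    (forall i, @lcs_mem R (CinfE U (testL L)) (phi i)) ->
    seminorm_K K m (diffn_at F U phi)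
      <= mpoly.meval (fun i => match fintype.split i with
                               | inl j => seminorm_KL K c L l (phi j)
                               | inr j => if j == ord0
                                          then dist_delta_KB K c B (phi j)
                                          else seminorm_KB K c B (phi j)
                               end) p]]].

End ModerateNegligible.

(* Main.v *)
Require Import Defs.
From mathcomp Require Import all_boot all_order all_algebra.
From mathcomp Require Import all_classical all_reals all_analysis.
From mathcomp Require Import ring lra.
From mathcomp Require Import complex.
From mathcomp Require mpoly.
Import (canonicals) mpoly.

(** Write T for the operator DSK. Both derivatives involve the derivation along X
    of smooth functions, which is linear and continuous on the spaces of smooth
    functions and costs one derivative; this settles Dtilde. In Dhat there is
    moreover the differential of R at phi in the direction T phi. The operator T
    is linear and preserves smooth curves, so that the chain and product rules give
      d^k(Dhat R)(phi_0)(phi_1, .., phi_k) = - d^(k+1)R(phi_0)(phi_1, .., phi_k, T phi_0)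
        - \sum_j d^k R(phi_0)(.., T phi_j, ..) + D_X(d^k R(phi_0)(phi_1, .., phi_k)),
    see [lcs_diffn_along] and [diffn_Dhat]. The estimates of R thus apply, with
    arguments T phi_j among others, and it remains to bound the seminorms of T phi
    by those of phi.

    As T is a differential operator of order one in x and in y, the seminorms of
    its derivatives lose one derivative in each, see [seminorm_KL_DSK]. For the
    pairings with a bounded set B, integration by parts [pair_lie] moves the Lie
    derivative in y onto the functions f of B:
      <f, T phi(x)> = D_X <f, phi(x)> - <D_X f, phi(x)>.
    So B is to be enlarged by the derivatives along X of its elements. If phi is
    replaced by delta, the right-hand side is D_X f - D_X f = 0; hence the pairings
    of T phi_0 are bounded by the distance from phi_0 to delta, see
    [seminorm_KB_DSK]. In the polynomials, these bounds amount to substituting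
    multiples of y-variables for y-variables and of z-variables for z-variables,
    which preserves the ideal of the definition of negligibility, see
    [polyI_rescale]. The two cases share the argument through [estimate_class].

    All this presupposes a differential calculus for maps of which only the
    smoothness along smooth curves is known: the existence of their differentials,
    the linearity of these in the direction [differentialD], and their smoothness
    [differential_curve]. It rests on one theorem on maps h of the plane into a
    locally convex space that are smooth along smooth curves: the partial
    derivative of h in the first variable is smooth along the second axis, see
    [plane_smooth_deriv]. First, the iterated directional derivatives of h are
    bounded on bounded sets; for otherwise a smooth curve could be led through a
    sequence of bad points [ray_derivative_bounded]. Consequently h has Taylor
    expansions with uniform remainders along all lines. Combining those along the
    lines of directions (i, 1), one obtains expansions of the partial derivative to
    all orders, and a function with such expansions is smooth, by the converse of
    Taylor's theorem [taylor_expandable_curve]. *)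

Set Implicit Arguments.
Unset Strict Implicit.
Unset Printing Implicit Defensive.

Import Order.TTheory GRing.Theory Num.Theory.
Import numFieldNormedType.Exports.

Local Open Scope classical_set_scope.
Local Open Scope ring_scope.

(** * Linear combinations, seminorms and derivatives in locally convex spaces *)

(** Linear combinations as syntax trees over numbered atoms: two of them are
    equal as soon as their coefficients at each atom agree, which reduces an
    identity in a module to identities in its ring of scalars. *)
Inductive lexp (R : Type) : Type :=
  | LA of nat | L0 | LD of lexp R & lexp R | LN of lexp R | LZ of R & lexp R.
Arguments LA {R}.
Arguments L0 {R}.

Section LinearCombinations.
Variables (R : pzRingType) (V : lmodType R).

Fixpoint lexp_eval (v : seq V) (e : lexp R) : V :=
  match e with
  | LA i => nth 0 v i
  | L0 => 0
  | LD a b => lexp_eval v a + lexp_eval v b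
  | LN a => - lexp_eval v a
  | LZ r a => r *: lexp_eval v a
  end.

Fixpoint lexp_coef (e : lexp R) (i : nat) : R :=
  match e with
  | LA j => if eqn i j then 1 else 0
  | L0 => 0
  | LD a b => lexp_coef a i + lexp_coef b i
  | LN a => - lexp_coef a i
  | LZ r a => r * lexp_coef a i
  end.

Fixpoint lexp_same (e1 e2 : lexp R) (n : nat) : Prop :=
  if n is n'.+1 then lexp_coef e1 n' = lexp_coef e2 n' /\ lexp_same e1 e2 n'
  else True.

Lemma lexp_evalE v e :
  lexp_eval v e = \sum_(i < size v) lexp_coef e i *: nth 0 v i.
Proof.
elim: e => [j||a IHa b IHb|a IHa|r a IHa] /=.
- have [jv|vj] := ltnP j (size v).
    rewrite (bigD1 (Ordinal jv))//= eqnE eqxx scale1r big1 ?addr0// => i ij.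
    case: eqP => [E|_]; last by rewrite scale0r.
    by move/eqP: ij; case; exact: val_inj.
  rewrite nth_default// big1// => i _; rewrite eqnE; case: eqP => [E|_].
    by move: (ltn_ord i); rewrite E ltnNge vj.
  by rewrite scale0r.
- by rewrite big1// => i _; rewrite scale0r.
- by rewrite IHa IHb -big_split/=; apply: eq_bigr => i _; rewrite scalerDl.
- by rewrite IHa -sumrN; apply: eq_bigr => i _; rewrite scaleNr.
- by rewrite IHa scaler_sumr; apply: eq_bigr => i _; rewrite scalerA.
Qed.

Lemma lexp_sameP v e1 e2 : lexp_same e1 e2 (size v) ->
  lexp_eval v e1 = lexp_eval v e2.
Proof.
move=> H; rewrite !lexp_evalE.
have K n : lexp_same e1 e2 n -> forall i, (i < n)%N -> lexp_coef e1 i = lexp_coef e2 i.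
  elim: n => // n IH /= [h /IH{}IH] i; rewrite ltnS leq_eqVlt => /orP[/eqP->//|].
  exact: IH.
by apply: eq_bigr => i _; rewrite (K _ H).
Qed.

End LinearCombinations.

Ltac lexp_mem x l :=
  lazymatch l with
  | nil => constr:(false)
  | x :: _ => constr:(true)
  | _ :: ?l' => lexp_mem x l'
  end.
Ltac lexp_index x l :=
  lazymatch l with
  | x :: _ => constr:(0%N)
  | _ :: ?l' => let n := lexp_index x l' in constr:(S n)
  end.
Ltac lexp_atoms t l :=
  lazymatch t with
  | GRing.add ?a ?b => let l1 := lexp_atoms a l in lexp_atoms b l1
  | GRing.opp ?a => lexp_atoms a l
  | GRing.scale _ ?a => lexp_atoms a l
  | GRing.zero => l
  | ?a => lazymatch lexp_mem a l with true => l | false => constr:(a :: l) end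
  end.
Ltac lexp_reify R t l :=
  lazymatch t with
  | GRing.add ?a ?b => let x := lexp_reify R a l in let y := lexp_reify R b l in
      constr:(@LD R x y)
  | GRing.opp ?a => let x := lexp_reify R a l in constr:(@LN R x)
  | GRing.scale ?r ?a => let x := lexp_reify R a l in constr:(@LZ R r x)
  | GRing.zero => constr:(@L0 R)
  | ?a => let n := lexp_index a l in constr:(@LA R n)
  end.
(* [lmodule R] proves an equality in a left module over the commutative ring
   [R]; the coefficients are compared by [ring]. *)
Ltac lmodule_with tac R :=
  lazymatch goal with
  | |- @eq ?T ?a ?b =>
    let l0 := constr:(@nil T) in
    let l1 := lexp_atoms a l0 in
    let l2 := lexp_atoms b l1 in
    let x := lexp_reify R a l2 in
    let y := lexp_reify R b l2 in
    refine (@lexp_sameP _ _ l2 x y _);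
    cbv [lexp_same lexp_coef size eqn]; repeat split; tac
  end.
Ltac lmodule R := lmodule_with ltac:(ring) R.

(** The seminorm axioms, on the subspace where the seminorms are meaningful,
    and the Hausdorff property, without which derivatives are not unique. *)
Record separated_lcs (R : realType) (E : lcs R) : Prop := SeparatedLcs {
  lmem0 : @lcs_mem R E 0;
  lmemP : forall (a : R) (x y : E),
    lcs_mem x -> lcs_mem y -> lcs_mem (a *: x + y);
  lsnD : forall (q : E -> R) (x y : E), lcs_seminorm q ->
    lcs_mem x -> lcs_mem y -> q (x + y) <= q x + q y;
  lsnZ : forall (q : E -> R) (a : R) (x : E), lcs_seminorm q ->
    lcs_mem x -> q (a *: x) = `|a| * q x;
  lsep : forall x : E, lcs_mem x ->
    (forall q, lcs_seminorm q -> q x = 0) -> x = 0 }.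

Section Seminorms.
Variables (R : realType) (E : lcs R) (sE : separated_lcs E).
Implicit Types (q : E -> R) (x y : E).

Lemma lmemD x y : lcs_mem x -> lcs_mem y -> lcs_mem (x + y).
Proof. by move=> mx my; rewrite -[x]scale1r; exact: lmemP. Qed.

Lemma lmemZ (a : R) x : lcs_mem x -> lcs_mem (a *: x).
Proof. by move=> mx; rewrite -[_ *: _]addr0; apply: lmemP => //; exact: lmem0. Qed.

Lemma lmemN x : lcs_mem x -> lcs_mem (- x).
Proof. by move=> mx; rewrite -scaleN1r; exact: lmemZ. Qed.

Lemma lmemB x y : lcs_mem x -> lcs_mem y -> lcs_mem (x - y).
Proof. by move=> mx my; apply: lmemD => //; exact: lmemN. Qed.

Lemma lmem_sum (I : Type) (r : seq I) (P : pred I) (F : I -> E) :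
  (forall i, P i -> lcs_mem (F i)) -> lcs_mem (\sum_(i <- r | P i) F i).
Proof.
by move=> mF; elim/big_ind : _ => //; [exact: lmem0|exact: lmemD].
Qed.

Lemma lsn0 q : lcs_seminorm q -> q 0 = 0.
Proof. by move=> sq; rewrite -(scale0r 0) lsnZ// ?normr0 ?mul0r//; exact: lmem0. Qed.

Lemma lsnN q x : lcs_seminorm q -> lcs_mem x -> q (- x) = q x.
Proof. by move=> sq mx; rewrite -scaleN1r lsnZ// normrN1 mul1r. Qed.

Lemma lsnB q x y : lcs_seminorm q -> lcs_mem x -> lcs_mem y ->
  q (x - y) <= q x + q y.
Proof.
by move=> sq mx my; rewrite -(lsnN sq my); apply: lsnD => //; exact: lmemN.
Qed.

Lemma lsn_distC q x y : lcs_seminorm q -> lcs_mem x -> lcs_mem y ->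
  q (x - y) = q (y - x).
Proof. by move=> sq mx my; rewrite -opprB lsnN//; exact: lmemB. Qed.

Lemma lsn_ge0 q x : lcs_seminorm q -> lcs_mem x -> 0 <= q x.
Proof.
move=> sq mx; have := lsnB sq mx mx; rewrite subrr (lsn0 sq).
by rewrite -mulr2n pmulrn_lge0.
Qed.

Lemma lsn_dist q x y z : lcs_seminorm q ->
  lcs_mem x -> lcs_mem y -> lcs_mem z -> q (x - z) <= q (x - y) + q (y - z).
Proof.
move=> sq mx my mz; rewrite -[x - z](subrKA y).
by apply: lsnD => //; exact: lmemB.
Qed.

Lemma lsn_sum q (I : Type) (r : seq I) (P : pred I) (F : I -> E) :
  lcs_seminorm q -> (forall i, P i -> lcs_mem (F i)) ->
  q (\sum_(i <- r | P i) F i) <= \sum_(i <- r | P i) q (F i).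
Proof.
move=> sq mF.
suff : lcs_mem (\sum_(i <- r | P i) F i) /\
  q (\sum_(i <- r | P i) F i) <= \sum_(i <- r | P i) q (F i) by case.
elim/big_ind2 : _.
- by split; [exact: lmem0 | rewrite lsn0].
- move=> x1 a x2 b [m1 h1] [m2 h2]; split; first exact: lmemD.
  by apply: (le_trans (lsnD sE sq m1 m2)); exact: lerD.
- by move=> i Pi; split; [exact: mF|].
Qed.

Lemma lsn_sum_le q (I : Type) (r : seq I) (P : pred I) (F : I -> E) (M : R) :
  lcs_seminorm q -> (forall i, P i -> lcs_mem (F i)) ->
  \sum_(i <- r | P i) q (F i) <= M -> q (\sum_(i <- r | P i) F i) <= M.
Proof. by move=> sq mF; exact/le_trans/lsn_sum. Qed.

Lemma lsn_eq0 x : lcs_mem x ->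
  (forall q, lcs_seminorm q -> forall e, 0 < e -> q x <= e) -> x = 0.
Proof.
move=> mx h; apply: lsep => // q sq; apply/eqP; rewrite eq_le lsn_ge0// andbT.
by apply/ler_addgt0Pr => e e0; rewrite add0r; exact: h.
Qed.

End Seminorms.

Section HasDeriv.
Variables (R : realType).
Implicit Types (E F : lcs R).

(** The derivative in the form f(x + hv) = f(x) + h l + o(h), which unlike the
    difference quotient makes sense at h = 0. The seminorms say nothing outside
    of the space, hence the requirement on the values of f near x. *)
Definition has_deriv E (T : lmodType R) (f : T -> E) (x v : T) (l : E) :=
  [/\ lcs_mem l, \forall h \near (0 : R), lcs_mem (f (x + h *: v)) &
   forall q, lcs_seminorm q -> forall e : R, 0 < e ->
     \forall h \near (0 : R), q (f (x + h *: v) - f x - h *: l) <= e * `|h|].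

Section Single.
Variables (E : lcs R) (sE : separated_lcs E) (T : lmodType R).
Implicit Types (f g : T -> E) (x v : T) (l : E).

Lemma has_deriv_mem f x v l : has_deriv f x v l -> lcs_mem (f x).
Proof. by case=> _ /nbhs_singleton + _; rewrite scale0r addr0. Qed.

Lemma has_derivP f x v l : (\forall h \near (0 : R), lcs_mem (f (x + h *: v))) ->
  is_lcs_derive f x v l <-> has_deriv f x v l.
Proof.
move=> mf.
have mfx : lcs_mem (f x).
  by move: (mf) => /nbhs_singleton; rewrite scale0r addr0.
split=> [[ml fl]|[ml _ fl]].
  split=> // q sq e e0; have /cvgrPdist_le := fl q sq => /(_ e e0).
  rewrite near_withinE; apply: filter_app2 mf; near=> h => mfh.
  have [->|h0 /(_ isT)] := eqVneq h 0.
    by move=> _; rewrite !scale0r addr0 subrr sub0r oppr0 (lsn0 sE sq) normr0 mulr0.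
  have -> : f (x + h *: v) - f x - h *: l =
     h *: (h^-1 *: (f (x + h *: v) - f x) - l).
    by rewrite scalerBr scalerA divff// scale1r.
  rewrite sub0r normrN => qe.
  have m1 : lcs_mem (h^-1 *: (f (x + h *: v) - f x) - l).
    by apply: (lmemB sE) => //; apply: (lmemZ sE); exact: (lmemB sE).
  rewrite (lsnZ sE)// mulrC ler_wpM2r//.
  by rewrite (le_trans (ler_norm _)).
split=> // q sq; apply/cvgrPdist_le => e e0.
rewrite near_withinE; apply: filter_app2 (fl q sq e e0) mf; near=> h => qe mfh h0.
have m1 : lcs_mem (h^-1 *: (f (x + h *: v) - f x) - l).
  by apply: (lmemB sE) => //; apply: (lmemZ sE); exact: (lmemB sE).
have E1 : f (x + h *: v) - f x - h *: l =
    h *: (h^-1 *: (f (x + h *: v) - f x) - l).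
  by rewrite scalerBr scalerA divff// scale1r.
move: qe; rewrite E1 (lsnZ sE)// mulrC ler_pM2r ?normr_gt0// => qe.
by rewrite sub0r normrN ger0_norm//; exact: (lsn_ge0 sE).
Unshelve. all: by end_near. Qed.

Lemma is_lcs_derive_near f g x v l :
  (\forall h \near (0 : R), f (x + h *: v) = g (x + h *: v)) ->
  is_lcs_derive f x v l -> is_lcs_derive g x v l.
Proof.
move=> fg [ml fl]; split=> // q sq; apply: cvg_trans (fl q sq).
apply: near_eq_cvg; rewrite near_withinE; near=> h => h0.
have -> : f (x + h *: v) = g (x + h *: v) by near: h.
by have := nbhs_singleton fg; rewrite scale0r addr0 => ->.
Unshelve. all: by end_near. Qed.

Lemma lcs_derive_near f g x v :
  (\forall h \near (0 : R), f (x + h *: v) = g (x + h *: v)) ->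
  lcs_derive f x v = lcs_derive g x v.
Proof.
move=> fg; congr xget; apply/seteqP; split=> l /=; apply: is_lcs_derive_near => //.
by apply: filterS fg => h ->.
Qed.

Lemma has_deriv_near f g x v l :
  (\forall h \near (0 : R), f (x + h *: v) = g (x + h *: v)) ->
  has_deriv f x v l -> has_deriv g x v l.
Proof.
move=> fg [ml mf fl].
have gx : f x = g x by have := nbhs_singleton fg; rewrite scale0r addr0.
split=> //; first by apply: filter_app2 fg mf; near=> h => ->.
move=> q sq e e0; apply: filter_app2 fg (fl q sq e e0); near=> h => ->.
by rewrite gx.
Unshelve. all: by end_near. Qed.

Lemma has_deriv_uniq f x v l l' : has_deriv f x v l -> has_deriv f x v l' -> l = l'.
Proof.
move=> [ml mf fl] [ml' _ fl']; apply/eqP; rewrite -subr_eq0; apply/eqP.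
apply: (lsn_eq0 sE); first exact: (lmemB sE).
move=> q sq e e0.
have mfx : lcs_mem (f x).
  by move: (mf) => /nbhs_singleton; rewrite scale0r addr0.
have e2 : 0 < e / 2 by rewrite divr_gt0.
have : \forall h \near (0:R)^', q (l - l') <= e.
  rewrite near_withinE; apply: filter_app2 (fl _ sq _ e2) (fl' _ sq _ e2).
  apply: filter_app mf; near=> h => mfh q1 q2 h0.
  rewrite -(@ler_pM2l _ `|h|) ?normr_gt0// -(lsnZ sE _ sq) ?scalerBr; last exact: (lmemB sE).
  set a := f _ in mfh q1 q2.
  have -> : h *: l - h *: l' = (a - f x - h *: l') - (a - f x - h *: l).
    by rewrite [X in _ = X]addrC opprB subrKA.
  apply: le_trans (lsnB sE sq _ _) _; try
    by apply: (lmemB sE); [exact: (lmemB sE)|exact: (lmemZ sE)].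
  by lra.
by move=> /filter_ex[].
Unshelve. all: by end_near. Qed.

Lemma has_deriv_derive f x v l : has_deriv f x v l -> lcs_derive f x v = l.
Proof.
move=> fl; have [_ mf _] := fl; apply: xget_subset1; first exact/has_derivP.
by move=> l1 l2 /= /(has_derivP _ mf) h1 /(has_derivP _ mf); exact: has_deriv_uniq.
Qed.

Lemma has_deriv_cst (a : E) x v : lcs_mem a -> has_deriv (fun=> a) x v 0.
Proof.
move=> ma; split; [exact: (lmem0 sE)| |].
  by near=> h.
move=> q sq e e0; near=> h.
by rewrite scaler0 !subr0 subrr (lsn0 sE)// mulr_ge0// ltW.
Unshelve. all: by end_near.
Qed.

Lemma has_derivD f g x v l m : has_deriv f x v l -> has_deriv g x v m ->
  has_deriv (fun z => f z + g z) x v (l + m).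
Proof.
move=> fl gm; have mfx := has_deriv_mem fl; have mgx := has_deriv_mem gm.
move: fl gm => [ml mf fl] [mm mg gm]; split; first exact: (lmemD sE).
  by apply: filter_app2 mf mg; near=> h; exact: (lmemD sE).
move=> q sq e e0; have e2 : 0 < e / 2 by rewrite divr_gt0.
apply: filter_app2 (fl _ sq _ e2) (gm _ sq _ e2).
apply: filter_app2 mf mg; near=> h => mfh mgh h1 h2.
rewrite scalerDr; set a := f _ in mfh h1 *; set b := g _ in mgh h2 *.
have -> : a + b - (f x + g x) - (h *: l + h *: m) =
  (a - f x - h *: l) + (b - g x - h *: m).
  by lmodule R.
apply: le_trans (lsnD sE sq _ _) _; try
  by apply: (lmemB sE); [exact: (lmemB sE)|exact: (lmemZ sE)].
by lra.
Unshelve. all: by end_near. Qed.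

Lemma has_deriv_cvg f x v l : has_deriv f x v l -> forall q, lcs_seminorm q ->
  forall e, 0 < e -> \forall h \near (0 : R), q (f (x + h *: v) - f x) <= e.
Proof.
move=> fl q sq e e0; have mfx := has_deriv_mem fl; move: fl => [ml mf fl].
pose d := e / (1 + q l).
have ql := lsn_ge0 sE sq ml.
have d0 : 0 < d by rewrite divr_gt0// ltr_wpDr.
apply: filter_app2 mf (fl q sq _ ltr01); near=> h => mfh h1.
have hd : `|h| <= d by near: h; exact: (@nbhs0_le R R^o).
rewrite -(subrK (h *: l) (_ - f x)).
apply: le_trans (lsnD sE sq _ _) _; last (rewrite (lsnZ sE)//).
- by apply: (lmemB sE); [exact: (lmemB sE)|exact: (lmemZ sE)].
- exact: (lmemZ sE).
- rewrite mul1r in h1; apply: le_trans (lerD h1 (lexx _)) _.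
  rewrite -[X in X + _]mulr1 -mulrDr; apply: (@le_trans _ _ (d * (1 + q l))).
    by rewrite ler_wpM2r// addr_ge0.
  by rewrite /d divfK// gt_eqF// ltr_wpDr.
Unshelve. all: by end_near. Qed.

End Single.

(** For linear maps between locally convex spaces, continuity amounts to
    domination of the seminorms. One dominating seminorm is required instead of
    finitely many: all the operators below satisfy this stronger form. *)
Record continuous_linear E F (L : E -> F) : Prop := ContinuousLinear {
  clin_mem : forall x, lcs_mem x -> lcs_mem (L x);
  clinP : forall (a : R) x y, lcs_mem x -> lcs_mem y ->
    L (a *: x + y) = a *: L x + L y;
  clin_bound : forall q, lcs_seminorm q -> exists p (c : R),
    [/\ lcs_seminorm p, 0 <= c & forall x, lcs_mem x -> q (L x) <= c * p x] }.

Section ContinuousLinearTheory.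
Variables (E F : lcs R) (sE : separated_lcs E) (sF : separated_lcs F) (L : E -> F).
Hypothesis cL : continuous_linear L.

Lemma clin0 : L 0 = 0.
Proof.
have := clinP cL 1 (lmem0 sE) (lmem0 sE).
by rewrite !scale1r addr0 => /eqP; rewrite -subr_eq subrr => /eqP <-.
Qed.

Lemma clinD x y : lcs_mem x -> lcs_mem y -> L (x + y) = L x + L y.
Proof. by move=> mx my; rewrite -[x in LHS]scale1r (clinP cL)// scale1r. Qed.

Lemma clinZ a x : lcs_mem x -> L (a *: x) = a *: L x.
Proof.
move=> mx; rewrite -[a *: x]addr0 (clinP cL)//; last exact: lmem0.
by rewrite clin0 addr0.
Qed.

Lemma clinB x y : lcs_mem x -> lcs_mem y -> L (x - y) = L x - L y.
Proof.
move=> mx my; rewrite clinD//; last exact: (lmemN sE).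
by rewrite -scaleN1r clinZ// scaleN1r.
Qed.

(** A seminorm q of L(u) is at most c p(u), so that the remainder o(h) of f for p
    gives one of L o f for q. *)
Lemma has_deriv_clin (T : lmodType R) (f : T -> E) x v l :
  has_deriv f x v l -> has_deriv (L \o f) x v (L l).
Proof.
move=> fl; have mfx := has_deriv_mem fl; move: fl => [ml mf fl].
split; first exact: (clin_mem cL).
  by apply: filterS mf => h; exact: (clin_mem cL).
move=> q sq e e0; have [p [c [sp c0 pc]]] := clin_bound cL sq.
have d0 : 0 < e / (1 + c) by rewrite divr_gt0// ltr_wpDr.
apply: filter_app2 mf (fl p sp _ d0); near=> h => mfh h1 /=.
have mh := lmemZ sE h ml.
have m1 := lmemB sE mfh mfx.
rewrite -clinB// -clinZ// -clinB//.
apply: le_trans (pc _ _) _; first exact: (lmemB sE).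
apply: le_trans (ler_wpM2l c0 h1) _.
have c1 : 0 < 1 + c by rewrite ltr_wpDr.
have -> : c * (e / (1 + c) * `|h|) = (c / (1 + c)) * (e * `|h|).
  by field; rewrite gt_eqF.
apply: ler_piMl; first by rewrite mulr_ge0// ltW.
by rewrite ler_pdivrMr// mul1r lerDr.
Unshelve. all: by end_near. Qed.

End ContinuousLinearTheory.

Lemma scale_continuous_linear E (sE : separated_lcs E) (a : R) :
  continuous_linear (fun x : E => a *: x).
Proof.
split=> [x|b x y mx my|q sq]; first exact: (lmemZ sE).
  by lmodule R.
by exists q, `|a|; split=> // x mx; rewrite (lsnZ sE).
Qed.

(** Functions with values in a normed space, in particular real and complex
    ones, are thus special cases of the vector-valued functions. *)
Definition lcs_norm (W : normedModType R) : lcs R :=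
  @LCS R W setT [set q | q = Num.norm].

Lemma separated_lcs_norm (W : normedModType R) : separated_lcs (lcs_norm W).
Proof.
split=> //=.
- by move=> q x y -> _ _; exact: ler_normD.
- by move=> q a x -> _; exact: normrZ.
- by move=> x _ /(_ _ erefl)/normr0_eq0.
Qed.

Section Product.
Variables (E : lcs R) (sE : separated_lcs E).
Local Notation S := (lcs_norm R^o).
Let sS := separated_lcs_norm R^o.

Lemma has_deriv_scale (T : lmodType R) (r : T -> S) (f : T -> E) x v (a : S) l :
  has_deriv r x v a -> has_deriv f x v l ->
  has_deriv (fun z => (r z : R) *: f z) x v ((a : R) *: f x + (r x : R) *: l).
Proof.
move=> ra fl; have mfx := has_deriv_mem fl.
have rc := has_deriv_cvg sS ra (q := Num.norm) erefl.
have fc := has_deriv_cvg sE fl.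
move: ra fl => [_ _ ra] [ml mf fl].
split; first by apply: (lmemD sE); exact: (lmemZ sE).
  by apply: filterS mf => h; exact: (lmemZ sE).
move=> q sq e e0; have ql := lsn_ge0 sE sq ml; have qf := lsn_ge0 sE sq mfx.
(* r f - r0 f0 - h (a f0 + r0 l)
   = (r - r0 - h a) f0 + (r - r0) (f - f0 - h l) + h (r - r0) l + r0 (f - f0 - h l) *)
pose K := q (f x) + 1 + q l + `|r x : R|.
have K0 : 0 < K by rewrite /K; have := normr_ge0 (r x : R); lra.
pose d := Num.min (1:R) (e / K).
have d0 : 0 < d by rewrite lt_min ltr01 divr_gt0.
have d1 : d <= 1 by rewrite ge_min lexx.
have dK : d * K <= e.
  rewrite -(@ler_pdivlMr _ K)//. by rewrite /d ge_min lexx orbT.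
apply: filter_app2 (ra _ erefl _ d0) (fl q sq _ d0).
apply: filter_app2 mf (rc d d0); near=> h => mfh h2 h1 h3.
set rh : R := r _ in h1 h2 *; set fh := f _ in mfh h3 *.
move: h1 h2; set r0 : R := r x; rewrite -/(rh - r0).
have -> : h *: a = h * (a : R) by [].
rewrite -/(rh - r0 - h * (a : R)) => h1 h2.
have m1 : lcs_mem (fh - f x - h *: l).
  by apply: (lmemB sE); [exact: (lmemB sE)|exact: (lmemZ sE)].
have -> : rh *: fh - r0 *: f x - h *: ((a : R) *: f x + r0 *: l) =
  ((rh - r0 - h * (a : R)) *: f x + rh *: (fh - f x - h *: l))
   + (h * (rh - r0)) *: l.
  by lmodule R.
have m2 : lcs_mem ((rh - r0 - h * (a : R)) *: f x) by exact: (lmemZ sE).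
have m3 : lcs_mem (rh *: (fh - f x - h *: l)) by exact: (lmemZ sE).
have m4 : lcs_mem ((h * (rh - r0)) *: l) by exact: (lmemZ sE).
apply: le_trans (lsnD sE sq (lmemD sE m2 m3) m4) _.
apply: le_trans (lerD (lsnD sE sq m2 m3) (lexx _)) _.
rewrite !(lsnZ sE _ sq)// normrM.
apply: (@le_trans _ _ (d * K * `|h|)); last by rewrite ler_wpM2r.
have rhb : `|rh| <= 1 + `|r0|.
  rewrite -[rh](subrK r0) (le_trans (ler_normD _ _))// lerD//.
  exact: le_trans h2 d1.
have -> : d * K * `|h| = d * `|h| * q (f x) + (1 + `|r0|) * (d * `|h|)
   + `|h| * d * q l.
  by rewrite /K; ring.
apply: lerD; first apply: lerD.
- by rewrite ler_wpM2r.
- apply: ler_pM => //; exact: (lsn_ge0 sE).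
- by rewrite ler_wpM2r// ler_wpM2l.
Unshelve. all: by end_near. Qed.

Lemma has_deriv_comp (T : lmodType R) (r : T -> S) (c : R^o -> E) x v (a : S) l :
  has_deriv r x v a -> has_deriv c (r x) 1 l ->
  has_deriv (c \o r) x v ((a : R) *: l).
Proof.
move=> ra cl; have mcx := has_deriv_mem cl.
have rc := has_deriv_cvg sS ra (q := Num.norm) erefl.
move: ra cl => [_ _ ra] [ml mc cl].
have shift (P : R -> Prop) : (\forall h \near (0 : R), P h) ->
    \forall h \near (0 : R), P ((r (x + h *: v) : R) - (r x : R)).
  move=> [/= d d0 dP]; have d2 : 0 < d / 2 by rewrite divr_gt0.
  apply: filterS (rc _ d2) => h hd; apply: dP => /=.
  rewrite sub0r normrN; apply: le_lt_trans hd _.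
  by rewrite ltr_pdivrMr// ltr_pMr// ltr1n.
have rE (h : R) : (r x : R^o) + (((r (x + h *: v) : R) - (r x : R)) : R) *: (1 : R^o) = r (x + h *: v).
  by rewrite /GRing.scale/= mulr1 addrC subrK.
split; first exact: (lmemZ sE).
  by apply: filterS (shift _ mc) => h; rewrite rE.
move=> q sq e e0; have ql := lsn_ge0 sE sq ml.
pose K := 1 + `|a : R| + q l.
have K0 : 0 < K by rewrite /K; have := normr_ge0 (a : R); lra.
pose d := Num.min (1:R) (e / K).
have d0 : 0 < d by rewrite lt_min ltr01 divr_gt0.
have d1 : d <= 1 by rewrite ge_min lexx.
have dK : d * K <= e.
  rewrite -(@ler_pdivlMr _ K)//. by rewrite /d ge_min lexx orbT.
apply: filter_app2 (shift _ mc) (shift _ (cl q sq _ d0)).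
apply: filterS (ra _ erefl _ d0) => h.
rewrite rE /=; set rh : R := r (x + _); set r0 : R := r x.
have -> : rh - r0 - h *: a = rh - r0 - h * (a : R) by [].
move=> h1 mch h2.
have -> : c rh - c r0 - h *: ((a : R) *: l) =
   (c rh - c r0 - (rh - r0) *: l) + (rh - r0 - h * (a : R)) *: l.
  by lmodule R.
have m1 : lcs_mem (c rh - c r0 - (rh - r0) *: l).
  by apply: (lmemB sE); [exact: (lmemB sE)|exact: (lmemZ sE)].
apply: le_trans (lsnD sE sq m1 (lmemZ sE _ ml)) _.
rewrite (lsnZ sE)//; apply: le_trans (lerD h2 (ler_wpM2r ql h1)) _.
apply: (@le_trans _ _ (d * K * `|h|)); last by rewrite ler_wpM2r.
have rhb : `|rh - r0| <= (1 + `|a : R|) * `|h|.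
  rewrite -[rh - r0](subrK (h * (a : R))) (le_trans (ler_normD _ _))//.
  rewrite mulrDl mul1r normrM [`|h| * _]mulrC lerD//.
  by apply: (le_trans h1); rewrite ler_piMl.
have -> : d * K * `|h| = d * ((1 + `|a : R|) * `|h|) + d * `|h| * q l.
  by rewrite /K; ring.
by rewrite lerD2r ler_wpM2l// ltW.
Qed.

End Product.

End HasDeriv.

(** * Differentiability classes and smooth curves *)

Section Continuity.
Variables (R : realType) (T : topologicalType).
Implicit Types E F : lcs R.

Definition lcs_continuous E (f : T -> E) (x : T) :=
  forall q, lcs_seminorm q -> forall e : R, 0 < e ->
    \forall t \near x, q (f t - f x) <= e.

Variables (E : lcs R) (sE : separated_lcs E).

Lemma lcs_continuousP (f : T -> E) x : (\forall t \near x, lcs_mem (f t)) ->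
  lcs_cvg (nbhs x) f (f x) <-> lcs_continuous f x.
Proof.
move=> mf; have mfx := nbhs_singleton mf; split=> fc q sq.
  move=> e e0; have /cvgrPdist_le := fc q sq => /(_ e e0).
  apply: filterS => t; rewrite sub0r normrN; exact: le_trans (ler_norm _).
apply/cvgrPdist_le => e e0; apply: filter_app2 (fc q sq e e0) mf.
near=> t => qe mt; rewrite sub0r normrN ger0_norm//.
by apply: (lsn_ge0 sE) => //; exact: (lmemB sE).
Unshelve. all: by end_near. Qed.

Lemma lcs_continuous_near (f g : T -> E) x : (\forall t \near x, f t = g t) ->
  lcs_continuous f x -> lcs_continuous g x.
Proof.
move=> fg fc q sq e e0; have fgx := nbhs_singleton fg.
by apply: filter_app2 fg (fc q sq e e0); near=> t => ->; rewrite fgx.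
Unshelve. all: by end_near. Qed.

Lemma lcs_continuous_cst (a : E) x : lcs_mem a -> lcs_continuous (fun=> a) x.
Proof.
move=> ma q sq e e0; near=> t; rewrite subrr (lsn0 sE)//; exact: ltW.
Unshelve. all: by end_near. Qed.

Lemma lcs_continuousD (f g : T -> E) x :
  (\forall t \near x, lcs_mem (f t)) -> (\forall t \near x, lcs_mem (g t)) ->
  lcs_continuous f x -> lcs_continuous g x ->
  lcs_continuous (fun t => f t + g t) x.
Proof.
move=> mf mg fc gc q sq e e0; have e2 : 0 < e / 2 by rewrite divr_gt0.
have mfx := nbhs_singleton mf; have mgx := nbhs_singleton mg.
apply: filter_app2 (fc q sq _ e2) (gc q sq _ e2).
apply: filter_app2 mf mg; near=> t => mft mgt h1 h2.
rewrite opprD addrACA; apply: le_trans (lsnD sE sq _ _) _; try exact: (lmemB sE).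
by lra.
Unshelve. all: by end_near. Qed.

Lemma lcs_continuous_scale (r : T -> lcs_norm R^o) (f : T -> E) x :
  (\forall t \near x, lcs_mem (f t)) ->
  lcs_continuous r x -> lcs_continuous f x ->
  lcs_continuous (fun t => (r t : R) *: f t) x.
Proof.
move=> mf rc fc q sq e e0; have mfx := nbhs_singleton mf.
have qf := lsn_ge0 sE sq mfx.
pose K := q (f x) + 1 + `|r x : R|.
have K0 : 0 < K by rewrite /K; have := normr_ge0 (r x : R); lra.
pose d := Num.min (1:R) (e / K).
have d0 : 0 < d by rewrite lt_min ltr01 divr_gt0.
have d1 : d <= 1 by rewrite ge_min lexx.
have dK : d * K <= e.
  rewrite -(@ler_pdivlMr _ K)//. by rewrite /d ge_min lexx orbT.
apply: filter_app2 mf (fc q sq _ d0).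
apply: filterS (rc _ erefl _ d0) => t.
set rt : R := r t; set r0 : R := r x => h1 mft h2.
have {}h1 : `|rt - r0| <= d by [].
have -> : rt *: f t - r0 *: f x = (rt - r0) *: f x + rt *: (f t - f x).
  by lmodule R.
have m1 := lmemB sE mft mfx.
apply: le_trans (lsnD sE sq (lmemZ sE _ mfx) (lmemZ sE _ m1)) _.
rewrite !(lsnZ sE _ sq)//; apply: le_trans dK.
have rhb : `|rt| <= 1 + `|r0|.
  rewrite -[rt](subrK r0) (le_trans (ler_normD _ _))// lerD//.
  exact: le_trans h1 d1.
have -> : d * K = d * q (f x) + (1 + `|r0|) * d by rewrite /K; ring.
apply: lerD; first by rewrite ler_wpM2r.
by apply: ler_pM => //; exact: (lsn_ge0 sE).
Qed.

Lemma lcs_continuous_clin F (L : E -> F) (f : T -> E) x :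
  continuous_linear L ->
  (\forall t \near x, lcs_mem (f t)) ->
  lcs_continuous f x -> lcs_continuous (L \o f) x.
Proof.
move=> cL mf fc q sq e e0; have mfx := nbhs_singleton mf.
have [p [c [sp c0 pc]]] := clin_bound cL sq.
have c1 : 0 < 1 + c by rewrite ltr_wpDr.
have d0 : 0 < e / (1 + c) by rewrite divr_gt0.
apply: filter_app2 mf (fc p sp _ d0); near=> t => mft h1 /=.
rewrite -(clinB sE cL)//; apply: le_trans (pc _ (lmemB sE mft mfx)) _.
apply: le_trans (ler_wpM2l c0 h1) _.
have -> : c * (e / (1 + c)) = (c / (1 + c)) * e.
  by field; rewrite gt_eqF.
apply: ler_piMl; first exact: ltW.
by rewrite ler_pdivrMr// mul1r lerDr.
Unshelve. all: by end_near. Qed.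

End Continuity.

Section DifferentiabilityClasses.
Variables (R : realType) (T : normedModType R) (I : Type) (dir : I -> T).
Implicit Types (E F : lcs R) (U V : set T).

Lemma near_line U x (v : T) : open U -> U x ->
  \forall h \near (0 : R), U (x + h *: v).
Proof.
move=> oU Ux.
have cf : {for (0:R), continuous (fun h : R => x + h *: v)}.
  apply: cvgD; [exact: cvg_cst|apply: cvgZl; exact: cvg_id].
by apply: cf; rewrite scale0r addr0; exact: open_nbhs_nbhs.
Qed.

(** One notion for two uses: with a single direction on the line, for curves,
    and with the canonical basis, for functions of several variables. The
    derivatives are required to exist along the given directions only, and
    continuity is part of each level as it does not follow from them. *)
Fixpoint Ck E U (k : nat) (f : T -> E) : Prop :=
  (forall x, U x -> lcs_mem (f x) /\ lcs_continuous f x) /\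
  (if k is k'.+1 then forall i, exists g,
     (forall x, U x -> has_deriv f x (dir i) (g x)) /\ Ck U k' g
   else True).

Definition Cinfty E U (f : T -> E) := forall k, Ck U k f.

Definition lderive E (i : I) (f : T -> E) : T -> E :=
  fun x => lcs_derive f x (dir i).

Lemma Ck_mem E U k (f : T -> E) x : Ck U k f -> U x -> lcs_mem (f x).
Proof. by case: k => [|k] [+ _] Ux => /(_ _ Ux)[]. Qed.

Lemma Ck_cont E U k (f : T -> E) x : Ck U k f -> U x -> lcs_continuous f x.
Proof. by case: k => [|k] [+ _] Ux => /(_ _ Ux)[]. Qed.

Lemma CkS E U k (f : T -> E) : Ck U k.+1 f -> Ck U k f.
Proof.
elim: k f => [|k IH] f [mf df]; first by split.
split=> // i; have [g [fg /IH gk]] := df i; by exists g.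
Qed.

Lemma Ck_subset E U V k (f : T -> E) : V `<=` U -> Ck U k f -> Ck V k f.
Proof.
move=> VU; elim: k f => [|k IH] f [mf df].
  by split=> // x /VU/mf.
split=> [x /VU/mf//|i]; have [g [fg /IH gk]] := df i.
by exists g; split=> // x /VU/fg.
Qed.

(** Smoothness by coinduction: a class of functions each of which has derivatives
    in the class consists of smooth functions. *)
Lemma Ck_coind E U (P : (T -> E) -> Prop) :
  (forall f, P f -> (forall x, U x -> lcs_mem (f x) /\ lcs_continuous f x) /\
     forall i, exists g, (forall x, U x -> has_deriv f x (dir i) (g x)) /\ P g) ->
  forall f, P f -> Cinfty U f.
Proof.
move=> HP f Pf k; elim: k f Pf => [|k IH] f /HP[mf df]; split=> // i.
by have [g [fg /IH gk]] := df i; exists g.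
Qed.

Section Open.
Variables (E : lcs R) (sE : separated_lcs E) (U : set T) (oU : open U).
Implicit Types (f g : T -> E).

Lemma near_mem f x : (forall x, U x -> lcs_mem (f x)) -> U x ->
  \forall t \near x, lcs_mem (f t).
Proof.
by move=> mf Ux; apply: filterS mf _; exact: open_nbhs_nbhs.
Qed.

Lemma near_line_mem f x v : (forall x, U x -> lcs_mem (f x)) -> U x ->
  \forall h \near (0:R), lcs_mem (f (x + h *: v)).
Proof. by move=> mf Ux; apply: filterS (near_line v oU Ux) => h /mf. Qed.

Lemma has_deriv_eq_on f g x v l : (forall x, U x -> f x = g x) -> U x ->
  has_deriv f x v l -> has_deriv g x v l.
Proof.
move=> fg Ux; apply: has_deriv_near.
by apply: filterS (near_line v oU Ux) => h /fg.
Qed.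

Lemma Ck_eq_on k f g : (forall x, U x -> f x = g x) -> Ck U k f -> Ck U k g.
Proof.
move=> fg; have H : forall x, U x -> lcs_mem (f x) /\ lcs_continuous f x ->
    lcs_mem (g x) /\ lcs_continuous g x.
  move=> x Ux [mf cf]; split; first by rewrite -fg.
  apply: lcs_continuous_near cf.
  by apply: filterS fg _; exact: open_nbhs_nbhs.
case: k => [|k] [mf df].
  by split=> // x Ux; exact: H (mf _ Ux).
split=> [x Ux|i]; first exact: H (mf _ Ux).
have [d [fd dk]] := df i; exists d; split=> // x Ux.
exact: has_deriv_eq_on (fd _ Ux).
Qed.

Lemma Cinfty_eq_on f g : (forall x, U x -> f x = g x) -> Cinfty U f -> Cinfty U g.
Proof. by move=> fg fi k; exact: Ck_eq_on (fi k). Qed.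

Lemma Ck_deriv k f i : Ck U k.+1 f ->
  (forall x, U x -> has_deriv f x (dir i) (lderive i f x)) /\ Ck U k (lderive i f).
Proof.
move=> [_ /(_ i)[g [fg gk]]].
have E1 x : U x -> lderive i f x = g x.
  by move=> Ux; apply: (has_deriv_derive sE); exact: fg.
split=> [x Ux|]; first by rewrite E1//; exact: fg.
by apply: Ck_eq_on gk => x /E1.
Qed.

Lemma Cinfty_deriv f i : Cinfty U f ->
  (forall x, U x -> has_deriv f x (dir i) (lderive i f x)) /\
  Cinfty U (lderive i f).
Proof.
move=> fi; split=> [|k]; first by have [] := Ck_deriv i (fi 1%N).
by have [] := Ck_deriv i (fi k.+1).
Qed.

Lemma Cinfty_derivs f (s : seq I) : Cinfty U f -> Cinfty U (foldr (@lderive E) f s).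
Proof. by move=> fi; elim: s => //= i s /(Cinfty_deriv i)[]. Qed.

Lemma lderive_eq_on f g i x : (forall x, U x -> f x = g x) -> U x ->
  lderive i f x = lderive i g x.
Proof.
move=> fg Ux; apply: lcs_derive_near.
by apply: filterS (near_line (dir i) oU Ux) => h Uh; exact: fg.
Qed.

Lemma lderives_eq_on f g (s : seq I) x : (forall x, U x -> f x = g x) -> U x ->
  foldr (@lderive E) f s x = foldr (@lderive E) g s x.
Proof.
move=> fg; elim: s x => [|i s IH] x Ux /=; first exact: fg.
exact: lderive_eq_on.
Qed.

Lemma Ck_cst k (a : E) : lcs_mem a -> Ck U k (fun=> a).
Proof.
move=> ma; have H b : lcs_mem b -> forall x, U x ->
    lcs_mem ((fun=> b) x : E) /\ lcs_continuous (fun=> b : E) x.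
  by move=> mb x _; split=> //; exact: lcs_continuous_cst.
elim: k a ma => [|k IH] a ma; first by split=> //; exact: H.
split=> [|i]; first exact: H.
exists (fun=> 0); split=> [x _|]; first exact: has_deriv_cst.
by apply: IH; exact: (lmem0 sE).
Qed.

Lemma CkD k f g : Ck U k f -> Ck U k g -> Ck U k (fun x => f x + g x).
Proof.
have H f' g' : (forall x, U x -> lcs_mem (f' x) /\ lcs_continuous f' x) ->
    (forall x, U x -> lcs_mem (g' x) /\ lcs_continuous g' x) ->
    forall x, U x -> lcs_mem (f' x + g' x) /\
      lcs_continuous (fun x => f' x + g' x) x.
  move=> mf mg x Ux; split; first by apply: (lmemD sE); [case: (mf _ Ux)|case: (mg _ Ux)].
  apply: (lcs_continuousD sE); [apply: near_mem Ux|apply: near_mem Ux| |].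
  - by move=> y /mf[].
  - by move=> y /mg[].
  - by case: (mf _ Ux).
  - by case: (mg _ Ux).
elim: k f g => [|k IH] f g [mf df] [mg dg]; split=> //; do ?exact: H.
move=> i; have [f1 [ff1 f1k]] := df i; have [g1 [gg1 g1k]] := dg i.
exists (fun x => f1 x + g1 x); split=> [x Ux|]; last exact: IH.
by apply: (has_derivD sE); [exact: ff1|exact: gg1].
Qed.

Lemma Ck_scale k (r : T -> lcs_norm R^o) f : Ck U k r -> Ck U k f ->
  Ck U k (fun x => (r x : R) *: f x).
Proof.
have H (r' : T -> lcs_norm R^o) f' :
    (forall x, U x -> lcs_mem (r' x) /\ lcs_continuous r' x) ->
    (forall x, U x -> lcs_mem (f' x) /\ lcs_continuous f' x) ->
    forall x, U x -> lcs_mem ((r' x : R) *: f' x) /\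
      lcs_continuous (fun x => (r' x : R) *: f' x) x.
  move=> mr mf x Ux; split; first by apply: (lmemZ sE); case: (mf _ Ux).
  apply: (lcs_continuous_scale sE); [apply: near_mem Ux| |].
  - by move=> y /mf[].
  - by case: (mr _ Ux).
  - by case: (mf _ Ux).
elim: k r f => [|k IH] r f rk fk.
  by move: rk fk => [mr dr] [mf df]; split=> //; exact: H.
have rk' := CkS rk; have fk' := CkS fk.
move: rk fk => [mr dr] [mf df]; split=> [|i]; first exact: H.
have [r1 [rr1 r1k]] := dr i; have [f1 [ff1 f1k]] := df i.
exists (fun x => (r1 x : R) *: f x + (r x : R) *: f1 x); split=> [x Ux|].
  by apply: (has_deriv_scale sE); [exact: rr1|exact: ff1].
by apply: CkD; exact: IH.
Qed.

Lemma Ck_clin F (sF : separated_lcs F) (L : E -> F) k f : continuous_linear L ->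
  Ck U k f -> Ck U k (L \o f).
Proof.
move=> cL; have H f' :
    (forall x, U x -> lcs_mem (f' x) /\ lcs_continuous f' x) ->
    forall x, U x -> lcs_mem ((L \o f') x) /\ lcs_continuous (L \o f') x.
  move=> mf x Ux; split; first by apply: (clin_mem cL); case: (mf _ Ux).
  apply: (lcs_continuous_clin sE cL); [apply: near_mem Ux|].
  - by move=> y /mf[].
  - by case: (mf _ Ux).
elim: k f => [|k IH] f [mf df]; split=> //; do ?exact: H.
move=> i; have [f1 [ff1 f1k]] := df i.
exists (L \o f1); split=> [x Ux|]; last exact: IH.
by apply: (has_deriv_clin sE cL); exact: ff1.
Qed.

Lemma Cinfty_cst (a : E) : lcs_mem a -> Cinfty U (fun=> a).
Proof. by move=> ma k; exact: Ck_cst. Qed.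

Lemma CinftyD f g : Cinfty U f -> Cinfty U g -> Cinfty U (fun x => f x + g x).
Proof. by move=> fi gi k; exact: CkD. Qed.

Lemma Cinfty_scale (r : T -> lcs_norm R^o) f : Cinfty U r -> Cinfty U f ->
  Cinfty U (fun x => (r x : R) *: f x).
Proof. by move=> fi gi k; exact: Ck_scale. Qed.

Lemma Cinfty_clin F (sF : separated_lcs F) (L : E -> F) f : continuous_linear L ->
  Cinfty U f -> Cinfty U (L \o f).
Proof. by move=> cL fi k; exact: Ck_clin. Qed.

Lemma CinftyZ (a : R) f : Cinfty U f -> Cinfty U (fun x => a *: f x).
Proof. exact: (Cinfty_clin sE (scale_continuous_linear sE a)). Qed.

Lemma Cinfty_sum (J : Type) (r : seq J) (P : pred J) (f : J -> T -> E) :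
  (forall j, P j -> Cinfty U (f j)) ->
  Cinfty U (fun x => \sum_(j <- r | P j) f j x).
Proof.
move=> fi; elim: r => [|j r IH].
  apply: Cinfty_eq_on (Cinfty_cst (lmem0 sE)) => x _; by rewrite big_nil.
case Pj : (P j); last by apply: Cinfty_eq_on IH => x _; rewrite big_cons Pj.
by apply: Cinfty_eq_on (CinftyD (fi _ Pj) IH) => x _; rewrite big_cons Pj.
Qed.

Lemma lderive_clin F (sF : separated_lcs F) (L : E -> F) f (s : seq I) x :
  continuous_linear L -> Cinfty U f -> U x ->
  foldr (@lderive F) (L \o f) s x = L (foldr (@lderive E) f s x).
Proof.
move=> cL fi; elim: s x => //= i s IH x Ux.
apply: (has_deriv_derive sF).
apply: (@has_deriv_near _ _ _ (L \o foldr (@lderive E) f s)).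
  by apply: filterS (near_line (dir i) oU Ux) => h /IH ->.
apply: (has_deriv_clin sE cL).
by have [+ _] := Cinfty_deriv i (Cinfty_derivs s fi); exact.
Qed.

End Open.
End DifferentiabilityClasses.

Section SmoothCurves.
Variables (R : realType) (E : lcs R) (sE : separated_lcs E).

Definition dir1 (_ : unit) : R^o := 1.
Definition curve (c : R^o -> E) : Prop := Cinfty dir1 setT c.
Definition cderive (c : R^o -> E) : R^o -> E := fun t => lcs_derive c t 1.

Lemma curve_mem c t : curve c -> lcs_mem (c t).
Proof. by move=> /(_ 0%N) h; exact: Ck_mem h _. Qed.

Lemma curve_deriv c : curve c ->
  (forall t, has_deriv c t (1 : R^o) (cderive c t)) /\ curve (cderive c).
Proof.
move=> ci; have [h1 h2] := Cinfty_deriv sE openT tt ci.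
by split=> // t; exact: h1.
Qed.

Lemma has_deriv_continuous (c : R^o -> E) t l : has_deriv c t (1 : R^o) l ->
  lcs_continuous c t.
Proof.
move=> cl q sq e e0; have := has_deriv_cvg sE cl sq e0.
move=> [d /= d0 dP]; exists d => //= s /= ds.
have := dP (s - t); rewrite /= sub0r normrN distrC => /(_ ds).
have -> // : t + (s - t) *: (1 : R^o) = s by rewrite /GRing.scale/= mulr1 addrC subrK.
Qed.

Lemma curve_coind (P : (R^o -> E) -> Prop) :
  (forall c, P c -> (forall t, lcs_mem (c t)) /\
     exists d, (forall t, has_deriv c t (1 : R^o) (d t)) /\ P d) ->
  forall c, P c -> curve c.
Proof.
move=> HP; apply: Ck_coind => c /HP[mc [d [cd Pd]]]; split.
  by move=> t _; split=> //; exact: has_deriv_continuous (cd t).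
by move=> i; exists d; split.
Qed.

(** Derivatives of smooth curves are again smooth curves, so that the class of
    smooth curves in the sense of existing iterated derivatives qualifies for
    coinduction. *)
Lemma smooth_curveP c : smooth_curve c <-> curve c.
Proof.
split=> [[mc dc]|ci].
  apply: (@curve_coind (fun c => smooth_curve c)) => // b [mb db]; split=> //.
  have D t : has_deriv b t (1 : R^o) (cderive b t).
    have [l bl] := db 0%N t; have mfb : \forall h \near (0:R), lcs_mem (b (t + h *: (1:R^o))).
      by near=> h.
    have := bl => /(has_derivP sE _ mfb) hl.
    by rewrite /cderive (has_deriv_derive sE hl).
  exists (cderive b); split=> //; split; first by move=> t; have [] := D t.
  by move=> k t; rewrite -iterSr; exact: db.
split=> [t|k]; first exact: curve_mem.
elim: k c ci => [|k IH] c ci t; last first.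
  by rewrite iterSr; apply: IH; have [] := curve_deriv ci.
have [/(_ t) h _] := curve_deriv ci; exists (cderive c t).
by apply/(has_derivP sE) => //; near=> h0; exact: curve_mem.
Unshelve. all: by end_near. Qed.

Lemma lcs_continuous_comp (r : R^o -> lcs_norm R^o) (c : R^o -> E) t :
  lcs_continuous r t -> lcs_continuous c (r t) -> lcs_continuous (c \o r) t.
Proof.
move=> cr cc q sq e e0; have [d /= d0 dP] := cc q sq e e0.
have d2 : 0 < d / 2 by rewrite divr_gt0.
apply: filterS (cr _ erefl _ d2) => s hs /=; apply: dP => /=.
rewrite distrC; apply: le_lt_trans hs _.
by rewrite ltr_pdivrMr// ltr_pMr// ltr1n.
Qed.

Lemma Ck_comp k (r : R^o -> lcs_norm R^o) (c : R^o -> E) :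
  Ck dir1 setT k r -> Ck dir1 setT k c -> Ck dir1 setT k (c \o r).
Proof.
have H k' (r' : R^o -> lcs_norm R^o) (c' : R^o -> E) : Ck dir1 setT k' r' -> Ck dir1 setT k' c' ->
    forall t : R^o, setT t -> lcs_mem (c' (r' t)) /\ lcs_continuous (c' \o r') t.
  move=> rk ck t _; split; first exact: (Ck_mem ck).
  by apply: lcs_continuous_comp; [exact: (Ck_cont rk)|exact: (Ck_cont ck)].
elim: k r c => [|k IH] r c rk ck; first by split=> //; exact: H rk ck.
have rk' := CkS rk; have ck' := CkS ck.
split=> [|i]; first exact: H rk' ck'.
have [r1 [rr1 r1k]] := rk.2 i; have [c1 [cc1 c1k]] := ck.2 tt.
exists (fun t => (r1 t : R) *: (c1 \o r) t); split=> [t _|].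
  by apply: (has_deriv_comp sE); [exact: rr1|exact: cc1].
by apply: (Ck_scale sE openT) => //; exact: IH.
Qed.

Lemma curve_comp (r : R^o -> lcs_norm R^o) (c : R^o -> E) :
  Cinfty dir1 setT r -> curve c -> curve (c \o r).
Proof. by move=> ri ci k; exact: Ck_comp. Qed.

End SmoothCurves.

(** * Mean value inequality and Taylor's formula for curves *)

Lemma addrBK (V : zmodType) (x y : V) : x + (y - x) = y.
Proof. by rewrite addrC subrK. Qed.

Lemma has_deriv_normP (R : realType) (T W : normedModType R) (f : T -> W)
  (x v : T) (l : W) :
  @has_deriv R (lcs_norm W) T f x v l <-> is_derive x v f l.
Proof.
have sW := separated_lcs_norm W.
have mf : \forall h \near (0:R), @lcs_mem R (lcs_norm W) (f (x + h *: v)).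
  by near=> h.
have E : (fun h : R => h^-1 *: (f (x + h *: v) - f x)) =
   (fun h : R => h^-1 *: ((f \o shift x) (h *: v) - f x)).
  by apply/funext => h /=; rewrite [h *: v + x]addrC.
split=> [/(has_derivP sW _ mf)[_ /(_ _ erefl) cl]|fl].
  have cl' : (fun h : R => h^-1 *: ((f \o shift x) (h *: v) - f x)) @ 0^' --> l.
    rewrite -E; apply/cvgrPdist_le => e e0.
    move/cvgrPdist_le : cl => /(_ e e0); apply: filterS => h.
    by rewrite sub0r normrN normr_id distrC.
  by apply: DeriveDef; [apply/cvg_ex; exists l|exact/cvg_lim].
apply/(has_derivP sW _ mf); split=> // q ->.
have [dx <-] := fl; apply/cvgrPdist_le => e e0.
have {}dx : (fun h : R => h^-1 *: ((f \o shift x) (h *: v) - f x)) @ 0^' --> 'D_v f x.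
  exact: dx.
rewrite -E in dx.
move/cvgrPdist_le : dx => /(_ e e0); apply: filterS => h.
by rewrite sub0r normrN normr_id distrC.
Unshelve. all: by end_near. Qed.

Section RealCurves.
Variable R : realType.
Local Notation S := (lcs_norm R^o).
Let sS := separated_lcs_norm R^o.

Lemma has_deriv_affine (a b : R) (t : R^o) :
  @has_deriv R S R^o (fun s : R^o => a + b * s) t (1 : R^o) b.
Proof.
split=> //; first by near=> h.
move=> q -> e e0; near=> h.
have -> : a + b * (t + h *: (1 : R^o)) - (a + b * t) - h *: (b : R^o) = 0.
  by rewrite /GRing.scale/=; ring.
by rewrite normr0 mulr_ge0// ltW.
Unshelve. all: by end_near. Qed.

Lemma has_deriv_taylor_monomial (a : R) (m : nat) (t : R^o) :
  @has_deriv R S R^o (fun s => (s - a) ^+ m.+1 / (m.+1)`!%:R) t (1 : R^o)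
    ((t - a) ^+ m / m`!%:R).
Proof.
have D1 (s : R^o) : @has_deriv R S R^o (fun s : R^o => s - a) s (1 : R^o) 1.
  have := has_deriv_affine (- a) 1 s; apply: has_deriv_near.
  by near=> h; rewrite mul1r [LHS]addrC.
have DX : @has_deriv R S R^o (fun s => (s - a) ^+ m.+1) t (1 : R^o)
    (m.+1%:R * (t - a) ^+ m).
  elim: m => [|m IH].
    rewrite expr0 mulr1; have := D1 t; apply: has_deriv_near.
    by near=> h; rewrite expr1.
  have := has_deriv_scale sS (D1 t) IH.
  have -> : (1 : R) *: ((t - a) ^+ m.+1 : S) +
    (t - a : R) *: (m.+1%:R * (t - a) ^+ m : S) = m.+2%:R * (t - a) ^+ m.+1.
    by rewrite /GRing.scale/= -[m.+2]addn1 natrD exprS; ring.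
  by apply: has_deriv_near; near=> h; rewrite [in RHS]exprS.
have := has_deriv_scale sS DX (@has_deriv_cst R S sS R^o (m.+1)`!%:R^-1 t (1 : R^o) I).
rewrite scaler0 addr0.
have -> : (m.+1%:R * (t - a) ^+ m : R) *: ((m.+1)`!%:R^-1 : S) =
  (t - a) ^+ m / m`!%:R.
  rewrite /GRing.scale/= factS natrM.
  by field; rewrite [1 + _]addrC natr1 !pnatr_eq0 -lt0n fact_gt0.
by [].
Unshelve. all: by end_near. Qed.

End RealCurves.

Section MeanValue.
Variables (R : realType) (E : lcs R) (sE : separated_lcs E).
Variables (q : E -> R) (sq : lcs_seminorm q).

(** With slack e > 0 the bound q(c t - c a) <= (M + e) (t - a) propagates locally
    by differentiability; the supremum of the t for which it holds is therefore
    b. Then e tends to 0. *)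
Lemma mean_value_le (c d : R^o -> E) (M a b : R) : a <= b ->
  (forall t : R, a <= t <= b -> has_deriv c t (1 : R^o) (d t)) ->
  (forall t : R, a <= t <= b -> q (d t) <= M) ->
  q (c b - c a) <= M * (b - a).
Proof.
move=> ab cd dM; have mc t : a <= t <= b -> lcs_mem (c t).
  by move=> /cd/has_deriv_mem.
suff H e : 0 < e -> q (c b - c a) <= (M + e) * (b - a).
  apply/ler_addgt0Pr => e e0; have := H (e / (1 + (b - a))).
  have ba : 0 < 1 + (b - a) by rewrite ltr_wpDr// subr_ge0.
  rewrite divr_gt0// => /(_ isT) /le_trans; apply; rewrite mulrDl lerD2l.
  rewrite -mulrA ler_piMr ?ltW// mulrC ltr_pdivrMr// mul1r.
  by rewrite ltrDr.
move=> e0.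
have loc t : a <= t <= b -> \forall h \near (0:R), a <= t + h <= b ->
    q (c (t + h) - c t) <= (M + e) * `|h|.
  move=> tab; have [mdt _ /(_ q sq e e0) h] := cd t tab.
  apply: filterS h => h + htab.
  have -> : (t : R^o) + h *: (1 : R^o) = t + h by rewrite /GRing.scale/= mulr1.
  move=> h1; rewrite -(subrK (h *: d t) (c (t + h) - c t)).
  have m1 : lcs_mem (h *: d t) by exact: (lmemZ sE).
  have m2 : lcs_mem (c (t + h) - c t - h *: d t).
    by apply: (lmemB sE) => //; apply: (lmemB sE); exact: mc.
  apply: le_trans (lsnD sE sq m2 m1) _.
  rewrite mulrDl addrC lerD// (lsnZ sE _ sq)// mulrC ler_wpM2r//.
  exact: dM.
pose S := [set t | a <= t <= b /\ q (c t - c a) <= (M + e) * (t - a)].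
have Sa : S a.
  by split; rewrite ?lexx ?ab// !subrr mulr0 (lsn0 sE).
have hS : has_sup S.
  by split; [exists a|exists b => t [/andP[]]].
have sup_le : sup S <= b by apply: ge_sup; [exists a|move=> t [/andP[]]].
have sup_ge : a <= sup S by apply: sup_upper_bound.
have sab : a <= sup S <= b by rewrite sup_ge.
have S_ext (s t : R) : S s -> a <= t <= b -> s <= t ->
    q (c t - c s) <= (M + e) * (t - s) -> S t.
  move=> [sab' Ss] tab st h; split=> //.
  apply: le_trans (lsn_dist sE sq (mc _ tab) (mc _ sab') _) _.
    by apply: mc; rewrite lexx.
  by have -> : (M + e) * (t - a) = (M + e) * (t - s) + (M + e) * (s - a);
    [ring|exact: lerD].
have Ssup : S (sup S).
  have [d1 /= d0 dP] := loc _ sab.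
  have [s Ss ss] := sup_adherent d0 hS.
  have sle : s <= sup S by apply: sup_upper_bound.
  have [sab' _] := Ss.
  apply: (S_ext _ _ Ss sab sle _).
  have := dP (s - sup S); rewrite /= sub0r normrN addrBK.
  rewrite distrC ger0_norm ?subr_ge0// (lsn_distC sE sq); last 2 first.
  - exact: mc.
  - exact: mc.
  by apply => //; rewrite ltrBlDr -ltrBlDl.
have [<-|sb] := eqVneq (sup S) b; first by case: Ssup.
have {}sb : sup S < b by rewrite lt_neqAle sb.
have [d1 /= d0 dP] := loc _ sab.
pose h := Num.min (d1 / 2) (b - sup S).
have h0 : 0 < h by rewrite lt_min divr_gt0// subr_gt0.
have hd : h < d1.
  by rewrite /h gt_min ltr_pdivrMr// ltr_pMr// ltr1n.
have hb : sup S + h <= b by rewrite -lerBrDl /h ge_min lexx orbT.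
have hab : a <= sup S + h <= b.
  by rewrite hb andbT (le_trans sup_ge)// lerDl ltW.
have Sh : S (sup S + h).
  apply: (S_ext _ _ Ssup hab); first by rewrite lerDl ltW.
  have := dP h; rewrite /= sub0r normrN (gtr0_norm h0) => /(_ hd hab).
  by rewrite [sup S + h - _]addrC addKr.
have : sup S + h <= sup S by apply: sup_upper_bound.
by rewrite gerDl leNgt h0.
Qed.

Lemma mean_value (c d : R^o -> E) (M a b : R) :
  (forall t : R, has_deriv c t (1 : R^o) (d t)) ->
  (forall t : R, `|t - a| <= `|b - a| -> q (d t) <= M) ->
  q (c b - c a) <= M * `|b - a|.
Proof.
move=> cd dM; have [ab|ba] := leP a b.
  rewrite ger0_norm ?subr_ge0//; apply: (@mean_value_le c d) => // t /andP[at_ tb].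
  apply: dM; rewrite !ger0_norm ?subr_ge0//; lra.
rewrite (lsn_distC sE sq (has_deriv_mem (cd b)) (has_deriv_mem (cd a))).
rewrite distrC ger0_norm ?subr_ge0 ?(ltW ba)//.
apply: (@mean_value_le c d) => //; first exact: ltW.
move=> t /andP[bt ta]; apply: dM.
by rewrite distrC [X in _ <= X]distrC !ger0_norm ?subr_ge0 ?(ltW ba)//; lra.
Qed.

(** By induction on the order: the derivative of the remainder is the remainder
    of order one less of the derivative, and the mean value inequality integrates
    its bound. *)
Lemma taylor_le (p : nat) (c : R^o -> E) (M a h : R) : curve c ->
  (forall t : R, `|t - a| <= `|h| -> q (iter p (@cderive R E) c t) <= M) ->
  q (c (a + h) - \sum_(j < p) (h ^+ j / j`!%:R) *: iter j (@cderive R E) c a)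
    <= M * `|h| ^+ p.
Proof.
elim: p c h => [|p IH] c h ci cM.
  rewrite big_ord0 subr0 expr0 mulr1; apply: cM.
  by rewrite addrAC subrr add0r.
have [cd c1] := curve_deriv sE ci.
pose r (t : R^o) := c t - \sum_(j < p.+1) ((t - a) ^+ j / j`!%:R) *:
  iter j (@cderive R E) c a.
pose r1 (t : R^o) := cderive c t - \sum_(j < p) ((t - a) ^+ j / j`!%:R) *:
  iter j (@cderive R E) (cderive c) a.
have mD j t : lcs_mem (iter j (@cderive R E) c t).
  apply: (@curve_mem R E).
  by elim: j => //= j /(curve_deriv sE)[].
have rd t : has_deriv r t (1 : R^o) (r1 t).
  have -> : r1 t = cderive c t + (-1) *: \sum_(j < p) ((t - a) ^+ j / j`!%:R) *:
    iter j (@cderive R E) (cderive c) a by rewrite scaleN1r.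
  have -> : r = fun t => c t + (-1) *: \sum_(j < p.+1) ((t - a) ^+ j / j`!%:R) *:
    iter j (@cderive R E) c a by apply/funext => s; rewrite scaleN1r.
  apply: (has_derivD sE) => //.
  have sS := separated_lcs_norm R^o.
  have H : has_deriv (fun t : R^o => \sum_(j < p.+1) ((t - a) ^+ j / j`!%:R) *:
    iter j (@cderive R E) c a) t (1 : R^o)
    (\sum_(j < p) ((t - a) ^+ j / j`!%:R) *: iter j (@cderive R E) (cderive c) a).
    under eq_fun do rewrite big_ord_recl/=.
    rewrite -[X in has_deriv _ _ _ X]add0r; apply: (has_derivD sE).
      have -> : (fun x : R^o => ((x - a) ^+ 0 / 0`!%:R) *: c a) = fun=> c a.
        by apply/funext => s; rewrite expr0 fact0 divr1 scale1r.
      by apply: (has_deriv_cst sE); exact: curve_mem.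
    elim: (p) => [|m IHm].
      under eq_fun do rewrite big_ord0.
      by rewrite big_ord0; apply: (has_deriv_cst sE); exact: (lmem0 sE).
    under eq_fun do rewrite big_ord_recr/=.
    rewrite big_ord_recr/=; apply: (has_derivD sE) => //.
    rewrite /bump/= add1n -iterSr.
    have -> : ((t - a) ^+ m / m`!%:R) *: iter m.+1 (cderive (E:=E)) c a =
      ((t - a) ^+ m / m`!%:R : R) *: iter m.+1 (cderive (E:=E)) c a +
      (((t - a) ^+ m.+1 / (m.+1)`!%:R) : R) *: 0.
      by rewrite scaler0 addr0.
    apply: (@has_deriv_scale _ _ sE _ (fun s : R^o => (s - a) ^+ m.+1 / (m.+1)`!%:R)).
      exact: has_deriv_taylor_monomial.
    by apply: (has_deriv_cst sE); exact: (mD m.+1).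
  have := has_deriv_scale sE (@has_deriv_cst R _ sS R^o (-1) t (1 : R^o) I) H.
  by rewrite scale0r add0r; exact.
have r0 : r a = 0.
  rewrite /r big_ord_recl/= subrr expr0 fact0 divr1 scale1r big1 ?addr0 ?subrr//.
  by move=> i _; rewrite /bump/= exprS mul0r mul0r scale0r.
have := @mean_value r r1 (M * `|h| ^+ p) a (a + h) rd.
rewrite r0 subr0 /r [a + h - a]addrC addKr exprSr mulrA; apply=> t ht.
have := IH (cderive c) (t - a) c1; rewrite addrBK => /(_ _)/le_trans; apply.
  by move=> s hs; rewrite -iterSr; apply: cM; exact: le_trans ht.
rewrite ler_wpM2l//.
  apply: le_trans (cM a _); last by rewrite subrr normr0.
  exact: (lsn_ge0 sE sq).
by rewrite lerXn2r ?nnegrE.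
Qed.

End MeanValue.

(** * Converse of Taylor's theorem *)

Section ConverseTaylor.
Variables (R : realType).

(** The Vandermonde matrix of the nodes 0, .., N is invertible: some functional
    u |-> \sum_i w_i u(i) takes the derivative at 0 of every polynomial of degree
    at most N. *)
Lemma differentiation_weights (N : nat) : exists w : nat -> R,
  forall j, (j < N.+1)%N -> \sum_(i < N.+1) w i * i%:R ^+ j = (j == 1%N)%:R.
Proof.
pose a : 'rV[R]_N.+1 := \row_i (i : nat)%:R.
pose V := Vandermonde N.+1 a.
have Vu : V \in unitmx.
  rewrite unitmxE det_Vandermonde unitfE prodf_seq_neq0; apply/allP => i _ /=.
  rewrite prodf_seq_neq0; apply/allP => j _ /=; apply/implyP => ij.
  by rewrite !mxE subr_eq0 eqr_nat gtn_eqF.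
pose u : 'cV[R]_N.+1 := invmx V *m (\col_j ((j : nat) == 1%N)%:R).
have Vw : V *m u = \col_j ((j : nat) == 1%N)%:R by rewrite mulKVmx.
exists (fun i => u (inord i) 0) => j jN.
have /matrixP/(_ (Ordinal jN) 0) := Vw; rewrite !mxE => <-.
by apply: eq_bigr => i _; rewrite !mxE inord_val mulrC.
Qed.

Variables (F : lcs R) (sF : separated_lcs F).

(** Compares two polynomial approximations of the same values u(i): one, \sum_j
    i^j x(j), is a polynomial in i, so that the weights extract x(1) from it; the
    other, \sum_j y(i, j), is arbitrary up to its constant term, which the weights
    kill. The two results differ by at most the sum of the errors, up to the
    size of the weights. *)
Lemma weights_le (q : F -> R) (N : nat) (w : nat -> R) (u x : nat -> F)
    (y : nat -> nat -> F) (e1 e2 : R) :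
  lcs_seminorm q -> (0 < N)%N ->
  (forall j, (j < N.+1)%N -> \sum_(i < N.+1) w i * i%:R ^+ j = (j == 1%N)%:R) ->
  (forall i, lcs_mem (u i)) -> (forall j, lcs_mem (x j)) ->
  (forall i j, lcs_mem (y i j)) -> (forall i, y i 0%N = y 0%N 0%N) ->
  (forall i, (i < N.+1)%N ->
     q (u i - \sum_(j < N.+1) (i%:R ^+ j) *: x j) <= e1) ->
  (forall i, (i < N.+1)%N -> q (u i - \sum_(j < N.+1) y i j) <= e2) ->
  q (x 1%N - \sum_(j < N) \sum_(i < N.+1) w i *: y i j.+1)
    <= (\sum_(i < N.+1) `|w i|) * (e1 + e2).
Proof.
move=> sq N0 wP mu mx my y0 h1 h2.
have E1 : x 1%N = \sum_(i < N.+1) w i *: \sum_(j < N.+1) (i%:R ^+ j) *: x j.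
  under eq_bigr do rewrite scaler_sumr.
  rewrite exchange_big/=.
  under eq_bigr => j _.
    under eq_bigr do rewrite scalerA.
    rewrite -scaler_suml wP//.
    over.
  rewrite (bigD1 (Ordinal (N0 : (1 < N.+1)%N)))//= scale1r big1 ?addr0// => j.
  by rewrite -val_eqE/= => /negPf ->; rewrite scale0r.
have E2 : \sum_(i < N.+1) w i *: \sum_(j < N.+1) y i j =
    \sum_(j < N) \sum_(i < N.+1) w i *: y i j.+1.
  under eq_bigr do rewrite scaler_sumr big_ord_recl/= y0.
  rewrite big_split/= -scaler_suml.
  have -> : \sum_(i < N.+1) w i = 0.
    rewrite -[RHS](wP 0%N isT); apply: eq_bigr => i _.
    by rewrite expr0 mulr1.
  by rewrite scale0r add0r exchange_big.
rewrite E1 -E2 -sumrB.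
have -> : \sum_(i < N.+1) (w i *: (\sum_(j < N.+1) (i%:R ^+ j) *: x j) -
     w i *: (\sum_(j < N.+1) y i j)) =
  \sum_(i < N.+1) w i *: ((u i - \sum_(j < N.+1) y i j) -
     (u i - \sum_(j < N.+1) (i%:R ^+ j) *: x j)).
  by apply: eq_bigr => i _; lmodule R.
have m1 i : lcs_mem (u i - \sum_(j < N.+1) y i j).
  by apply: (lmemB sF) => //; exact: (lmem_sum sF).
have m2 i : lcs_mem (u i - \sum_(j < N.+1) (i%:R ^+ j) *: x j).
  by apply: (lmemB sF) => //; apply: (lmem_sum sF) => j _; exact: (lmemZ sF).
apply: (lsn_sum_le sF sq).
  by move=> i _; apply: (lmemZ sF); exact: (lmemB sF).
rewrite mulr_suml; apply: ler_sum => i _.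
rewrite (lsnZ sF _ sq); last exact: (lmemB sF).
rewrite ler_wpM2l// [e1 + e2]addrC; apply: le_trans (lsnB sF sq (m1 i) (m2 i)) _.
by apply: lerD; [exact: h2|exact: h1].
Qed.

(** Taylor expansions of all orders with remainders that are uniform for t in
    bounded sets. The coefficients are arbitrary, in particular not supposed to
    depend on t in any regular way, and nothing is said at h = 0. *)
Definition taylor_expandable (g : R^o -> F) := (forall t, lcs_mem (g t)) /\
  forall p : nat, exists b : nat -> R^o -> F, (forall j t, lcs_mem (b j t)) /\
  forall q, lcs_seminorm q -> forall A : R, exists C d : R, [/\ 0 < d, 0 <= C &
  forall t h : R, `|t| <= A -> 0 < `|h| -> `|h| <= d ->
    q (g (t + h) - \sum_(j < p.+1) (h ^+ j) *: b j t) <= C * `|h| ^+ p.+1].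

Definition taylor_expansion (g : R^o -> F) (p : nat) (b : nat -> R^o -> F) :=
  (forall j t, lcs_mem (b j t)) /\
  forall q, lcs_seminorm q -> forall A : R, exists C d : R, [/\ 0 < d, 0 <= C &
  forall t h : R, `|t| <= A -> `|h| <= d ->
    q (g (t + h) - \sum_(j < p.+1) (h ^+ j) *: b j t) <= C * `|h| ^+ p.+1].

(** The expansion of order 0 gives that g(t + h) and g(t) are both close to the
    coefficient at t - h, as t + h and t are at distance 2h and h from t - h. *)
Lemma taylor_expandable_lipschitz g q (t : R) : taylor_expandable g ->
  lcs_seminorm q -> exists C d : R, [/\ 0 < d, 0 <= C &
  forall h : R, 0 < `|h| -> `|h| <= d -> q (g (t + h) - g t) <= C * `|h|].
Proof.
move=> [mg /(_ 0%N)[b [mb gb]]] sq.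
have [C [d [d0 C0 H]]] := gb q sq (`|t| + 1).
have dm : 0 < Num.min 1 (d / 2) by rewrite lt_min ltr01 divr_gt0.
exists (3 * C), (Num.min 1 (d / 2)); split=> //; first by rewrite mulr_ge0.
move=> h h0; rewrite le_min => /andP[h1 hd].
have th : `|t - h| <= `|t| + 1 by rewrite (le_trans (ler_normB _ _))// lerD2l.
have n2 : `|2 * h| = 2 * `|h| by rewrite normrM ger0_norm.
have := H (t - h) (2 * h) th; rewrite n2 mulr_gt0// -ler_pdivlMl// mulrC hd.
move=> /(_ isT isT); rewrite big_ord1 expr0 scale1r expr1.
have := H (t - h) h th h0; rewrite big_ord1 expr0 scale1r expr1 subrK.
have -> : t - h + 2 * h = t + h by ring.
have h' : `|h| <= d by apply: le_trans hd _; rewrite ler_pdivrMr// ler_peMr ?ler1n// ltW.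
move=> /(_ h') H1 H2.
apply: le_trans (lsn_dist sF sq (mg _) (mb 0%N (t - h)) (mg _)) _.
rewrite (lsn_distC sF sq (mb _ _) (mg _)); lra.
Qed.

(** As g is continuous, the constant coefficient is its value, and the expansion
    extends to h = 0. *)
Lemma taylor_expandableP g p : taylor_expandable g ->
  exists b, (forall t, b 0%N t = g t) /\ taylor_expansion g p b.
Proof.
move=> gT; have [mg /(_ p)[b [mb gb]]] := gT.
have b0 t : b 0%N t = g t.
  apply/eqP; rewrite -subr_eq0; apply/eqP; apply: (lsn_eq0 sF).
    exact: (lmemB sF).
  move=> q sq e e0.
  have [C1 [d1 [d10 C10 H1]]] := taylor_expandable_lipschitz t gT sq.
  have [C2 [d2 [d20 C20 H2]]] := gb q sq `|t|.
  pose S := \sum_(j < p) q (b j.+1 t); pose K := C1 + C2 + S + 1.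
  have S0 : 0 <= S by apply: sumr_ge0 => j _; exact: (lsn_ge0 sF).
  have K0 : 0 < K by rewrite /K; lra.
  pose h := Num.min (Num.min 1 (e / K)) (Num.min d1 d2).
  have h0 : 0 < h by rewrite !lt_min ltr01 d10 d20 divr_gt0.
  have [h1 he hd1 hd2] : [/\ h <= 1, h <= e / K, h <= d1 & h <= d2].
    by rewrite /h !ge_min !lexx ?orbT.
  have nh : `|h| = h by rewrite gtr0_norm.
  have := H1 h; rewrite nh => /(_ h0 hd1) {}H1.
  have := H2 t h (lexx _); rewrite nh => /(_ h0 hd2) {}H2.
  have ms : lcs_mem (\sum_(j < p.+1) h ^+ j *: b j t).
    by apply: (lmem_sum sF) => j _; exact: (lmemZ sF).
  have ms' : lcs_mem (\sum_(j < p) h ^+ j.+1 *: b j.+1 t).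
    by apply: (lmem_sum sF) => j _; exact: (lmemZ sF).
  have -> : b 0%N t - g t = (g (t + h) - g t) -
     ((g (t + h) - \sum_(j < p.+1) h ^+ j *: b j t) +
      \sum_(j < p) h ^+ j.+1 *: b j.+1 t).
    have -> : \sum_(j < p.+1) h ^+ j *: b j t =
        b 0%N t + \sum_(j < p) h ^+ j.+1 *: b j.+1 t.
      by rewrite big_ord_recl/= expr0 scale1r.
    by lmodule R.
  have m1 := lmemB sF (mg (t + h)) (mg t).
  have m2 := lmemB sF (mg (t + h)) ms.
  apply: le_trans (lsnB sF sq m1 (lmemD sF m2 ms')) _.
  apply: le_trans (lerD H1 (lsnD sF sq m2 ms')) _.
  have Sb : q (\sum_(j < p) h ^+ j.+1 *: b j.+1 t) <= h * S.
    apply: (lsn_sum_le sF sq).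
      by move=> j _; exact: (lmemZ sF).
    rewrite /S mulr_sumr; apply: ler_sum => j _; rewrite (lsnZ sF _ sq)//.
    rewrite ler_wpM2r//; first exact: (lsn_ge0 sF).
    by rewrite normrX nh exprS ler_piMr ?(ltW h0)// exprn_ile1// ltW.
  have H2' : C2 * h ^+ p.+1 <= C2 * h.
    by rewrite ler_wpM2l// exprS ler_piMr ?(ltW h0)// exprn_ile1// ltW.
  have : h * K <= e by rewrite -ler_pdivlMr.
  by rewrite /K; lra.
exists b; split=> //; split=> // q sq A.
have [C [d [d0 C0 H]]] := gb q sq A.
exists C, d; split=> // t h tA hd.
have [->|h0] := eqVneq h 0; last by apply: H => //; rewrite normr_gt0.
rewrite addr0 big_ord_recl expr0 scale1r b0 big1 ?addr0 ?subrr ?(lsn0 sF)//.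
  by rewrite mulr_ge0.
by move=> j _; rewrite /bump/= exprS mul0r scale0r.
Qed.

Lemma taylor_expansion_deriv g b p : (forall t, lcs_mem (g t)) ->
  (forall t, b 0%N t = g t) ->
  taylor_expansion g p.+1 b -> forall t, has_deriv g t (1 : R^o) (b 1%N t).
Proof.
move=> mg b0 [mb gb] t; split=> //; first by near=> h.
move=> q sq e e0; have [C [d [d0 C0 H]]] := gb q sq `|t|.
pose S := \sum_(j < p) q (b j.+2 t); pose K := C + S + 1.
have S0 : 0 <= S by apply: sumr_ge0 => j _; exact: (lsn_ge0 sF).
have K0 : 0 < K by rewrite /K; lra.
near=> h.
have -> : (t : R^o) + h *: (1 : R^o) = t + h by rewrite /GRing.scale/= mulr1.
have h1 : `|h| <= 1 by near: h; exact: (@nbhs0_le R R^o).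
have hd : `|h| <= d by near: h; exact: (@nbhs0_le R R^o).
have he : `|h| <= e / K by near: h; apply: (@nbhs0_le R R^o); rewrite divr_gt0.
have ms : lcs_mem (\sum_(j < p.+2) h ^+ j *: b j t).
  by apply: (lmem_sum sF) => j _; exact: (lmemZ sF).
have ms' : lcs_mem (\sum_(j < p) h ^+ j.+2 *: b j.+2 t).
  by apply: (lmem_sum sF) => j _; exact: (lmemZ sF).
have -> : g (t + h) - g t - h *: b 1%N t =
  (g (t + h) - \sum_(j < p.+2) h ^+ j *: b j t) +
    \sum_(j < p) h ^+ j.+2 *: b j.+2 t.
  have -> : \sum_(j < p.+2) h ^+ j *: b j t =
      b 0%N t + h *: b 1%N t + \sum_(j < p) h ^+ j.+2 *: b j.+2 t.
    by rewrite 2!big_ord_recl/= expr0 expr1 scale1r addrA.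
  by rewrite -(b0 t); lmodule R.
apply: le_trans (lsnD sF sq (lmemB sF (mg _) ms) ms') _.
have Sb : q (\sum_(j < p) h ^+ j.+2 *: b j.+2 t) <= `|h| * `|h| * S.
  apply: (lsn_sum_le sF sq).
    by move=> j _; exact: (lmemZ sF).
  rewrite /S mulr_sumr; apply: ler_sum => j _; rewrite (lsnZ sF _ sq)//.
  rewrite ler_wpM2r//; first exact: (lsn_ge0 sF).
  by rewrite normrX !exprS mulrA ler_piMr// ?mulr_ge0// exprn_ile1.
have H2 : q (g (t + h) - \sum_(j < p.+2) h ^+ j *: b j t) <= `|h| * `|h| * C.
  apply: le_trans (H t h (lexx _) hd) _; rewrite mulrC ler_wpM2r//.
  by rewrite !exprS mulrA ler_piMr// ?mulr_ge0// exprn_ile1.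
apply: le_trans (lerD H2 Sb) _.
have hK : `|h| * K <= e by rewrite -ler_pdivlMr.
rewrite -mulrDr -mulrA mulrC ler_wpM2r//; apply: le_trans hK.
by rewrite ler_wpM2l// /K; lra.
Unshelve. all: by end_near. Qed.

(** The derivative is the linear coefficient b_1. To expand it at t + h, write the
    values g(t + h + i h) in two ways: by the expansion at t + h with increments
    i h, and by the expansion at t with increments (1 + i) h. The weights of
    numerical differentiation extract h b_1(t + h) from the first, and from the
    second a polynomial in h with coefficients depending on t. *)
Lemma taylor_expandable_deriv g : taylor_expandable g ->
  exists d, (forall t, has_deriv g t (1 : R^o) (d t)) /\ taylor_expandable d.
Proof.
move=> gT; have [mg _] := gT; exists (cderive g).
have D t : has_deriv g t (1 : R^o) (cderive g t).
  have [b [b0 gb]] := taylor_expandableP 1 gT.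
  have h := taylor_expansion_deriv mg b0 gb t.
  by rewrite /cderive (has_deriv_derive sF h).
split=> //; split=> [t|p]; first by have [] := D t.
have [b [b0 gb]] := taylor_expandableP p.+1 gT.
have bD t : b 1%N t = cderive g t.
  by rewrite /cderive (has_deriv_derive sF (taylor_expansion_deriv mg b0 gb t)).
have [w wP] := differentiation_weights p.+1.
pose kap j := \sum_(i < p.+2) w i * (1 + i%:R) ^+ j.
exists (fun j t => kap j.+1 *: b j.+1 t); have [mb gb'] := gb.
split=> [j t|q sq A]; first exact: (lmemZ sF).
have [C [d [d0 C0 H]]] := gb' q sq (A + 1).
pose W := \sum_(i < p.+2) `|w i|; have W0 : 0 <= W by apply: sumr_ge0.
pose N : R := 1 + p.+1%:R.
have N0 : 0 < N by rewrite /N ltr_wpDr.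
have N1 : 1 <= N by rewrite /N lerDl.
have iN (i : nat) : (i < p.+2)%N -> 1 + i%:R <= N.
  by rewrite ltnS => ip; rewrite /N lerD2l ler_nat.
exists (W * (C * N ^+ p.+2 + C * N ^+ p.+2)), (Num.min 1 (d / N)).
split=> //; [by rewrite lt_min ltr01 divr_gt0| | ].
  by rewrite mulr_ge0// addr_ge0// mulr_ge0// exprn_ge0// ltW.
move=> t h tA h0; rewrite le_min => /andP[h1]; rewrite ler_pdivlMr// => hd.
have th : `|t + h| <= A + 1 by rewrite (le_trans (ler_normD _ _))// lerD.
have tA1 : `|t| <= A + 1 by rewrite (le_trans tA)// lerDl.
have ih (i : nat) : (i < p.+2)%N -> `|i%:R * h| <= d /\ `|(1 + i%:R) * h| <= d.
  move=> /iN ip; rewrite !normrM [`|i%:R|]ger0_norm// [`|1 + _|]ger0_norm ?addr_ge0//.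
  split; apply: le_trans hd; rewrite mulrC ler_wpM2l//.
  by apply: le_trans ip; rewrite lerDr.
have bnd (c : R) : 0 <= c -> c <= N ->
    C * `|c * h| ^+ p.+2 <= C * N ^+ p.+2 * `|h| ^+ p.+2.
  move=> c0 cN; rewrite -mulrA ler_wpM2l// -exprMn lerXn2r ?nnegrE ?mulr_ge0 ?(ltW N0)//.
  by rewrite normrM ger0_norm// ler_wpM2r.
have := @weights_le q p.+1 w (fun i => g (t + h + i%:R * h))
  (fun j => h ^+ j *: b j (t + h)) (fun i j => ((1 + i%:R) * h) ^+ j *: b j t)
  (C * N ^+ p.+2 * `|h| ^+ p.+2) (C * N ^+ p.+2 * `|h| ^+ p.+2) sq isT wP.
have -> : h ^+ 1 *: b 1%N (t + h) - \sum_(j < p.+1) \sum_(i < p.+2)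
    w i *: ((((1 + i%:R) * h) ^+ j.+1) *: b j.+1 t) =
  h *: (cderive g (t + h) - \sum_(j < p.+1) h ^+ j *: (kap j.+1 *: b j.+1 t)).
  rewrite expr1 bD scalerBr scaler_sumr; congr (_ - _); apply: eq_bigr => j _.
  rewrite /kap scaler_suml !scaler_sumr; apply: eq_bigr => i _.
  by rewrite !scalerA exprMn [h ^+ j.+1]exprS; congr (_ *: _); ring.
rewrite (lsnZ sF _ sq); last first.
  apply: (lmemB sF); first by have [] := D (t + h).
  by apply: (lmem_sum sF) => j _; do 2 apply: (lmemZ sF).
have -> : (\sum_(i < p.+2) `|w i|) * (C * N ^+ p.+2 * `|h| ^+ p.+2 +
     C * N ^+ p.+2 * `|h| ^+ p.+2) =
   `|h| * (W * (C * N ^+ p.+2 + C * N ^+ p.+2) * `|h| ^+ p.+1).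
  by rewrite -/W [`|h| ^+ p.+2]exprS; ring.
rewrite ler_pM2l//; apply.
- by move=> i.
- by move=> j; exact: (lmemZ sF).
- by move=> i j; exact: (lmemZ sF).
- by move=> i; rewrite !expr0.
- move=> i ip; have [id1 _] := ih i ip.
  under eq_bigr do rewrite scalerA -exprMn.
  apply: le_trans (H (t + h) _ th id1) _; apply: bnd => //.
  by apply: le_trans (iN i ip); rewrite lerDr.
- move=> i ip; have [_ id2] := ih i ip.
  have -> : t + h + i%:R * h = t + (1 + i%:R) * h by ring.
  apply: le_trans (H t _ tA1 id2) _; apply: bnd => //.
  exact: iN.
Qed.

(** Converse of Taylor's theorem, by coinduction: expandable functions are
    differentiable with expandable derivatives. *)
Lemma taylor_expandable_curve g : taylor_expandable g -> curve g.
Proof.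
apply: (curve_coind sF (P := taylor_expandable)) => c cT.
by split; [case: cT|exact: taylor_expandable_deriv].
Qed.

End ConverseTaylor.

(** * Flat functions and a plateau function *)

Lemma compact_locally_bounded (R : realType) (T : topologicalType) (K : set T)
  (phi : T -> R) : compact K ->
  (forall x, K x -> exists M, \forall t \near x, phi t <= M) ->
  exists M, forall x, K x -> phi x <= M.
Proof.
move=> /compact_near_coveringP cK locb.
have := cK R (pinfty_nbhs R) (fun M x => phi x <= M) _.
case=> [x Kx|M [_ /(_ (M + 1))]].
  have [M hM] := locb x Kx.
  exists ([set t | phi t <= M], [set M' | M < M']); last first.
    by move=> [t M'] [/= h1 h2]; exact: le_trans h1 (ltW h2).
  by split=> //=; exists M; split=> //; exact: num_real.
by rewrite ltrDl => /(_ ltr01) h; exists (M + 1) => x /h.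
Qed.

Section Bump.
Variable R : realType.
Local Notation S := (lcs_norm R^o).
Let sS := separated_lcs_norm R^o.

Lemma curve_affine (a b : R) : @curve R S (fun t => a + b * t).
Proof.
apply: (curve_coind sS (P := fun c : R^o -> S => exists a b : R, c = fun t => a + b * t)).
  move=> c [a' [b' ->]]; split=> //; exists (fun=> b'); split.
    by move=> t; exact: has_deriv_affine.
  by exists b', 0; apply/funext => t; rewrite mul0r addr0.
by exists a, b.
Qed.

Lemma curve_cst (E : lcs R) (sE : separated_lcs E) (a : E) : lcs_mem a ->
  curve (fun=> a).
Proof. by move=> ma; exact: (Cinfty_cst _ sE). Qed.

Lemma curveD (E : lcs R) (sE : separated_lcs E) (c d : R^o -> E) :
  curve c -> curve d -> curve (fun t => c t + d t).
Proof. exact: (CinftyD sE openT). Qed.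

Lemma curve_scale (E : lcs R) (sE : separated_lcs E) (r : R^o -> S) (c : R^o -> E) :
  curve r -> curve c -> curve (fun t => (r t : R) *: c t).
Proof. exact: (Cinfty_scale sE openT). Qed.

Lemma curveM (r s : R^o -> S) : curve r -> curve s ->
  @curve R S (fun t => (r t : R) * (s t : R)).
Proof. exact: (curve_scale sS). Qed.

(** y^i / i! is a term of the exponential series. *)
Lemma horner_le_expR (p : {poly R}) : exists C, 0 <= C /\
  forall y, 0 <= y -> `|p.[y]| <= C * expR y.
Proof.
exists (\sum_(i < size p) `|p`_i| * i`!%:R); split.
  by apply: sumr_ge0 => i _; rewrite mulr_ge0.
move=> y y0; rewrite horner_coef mulr_suml (le_trans (ler_norm_sum _ _ _))//.
apply: ler_sum => i _; rewrite normrM -mulrA ler_wpM2l// normrX ger0_norm//.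
case: i => -[|i] /= _.
  by rewrite expr0 fact0 mul1r; apply: le_trans (expR_ge1Dx _); rewrite lerDl.
rewrite mulrC -ler_pdivrMr ?ltr0n ?fact_gt0//.
by apply: le_trans (expR_ge1Dxn i y0); rewrite lerDr.
Qed.

(** The functions P(1/x) exp(-1/x), extended by zero to the left half line. Their
    derivatives are of the same form, whence their smoothness. *)
Definition flat (p : {poly R}) (x : R^o) : S :=
  if 0 < (x : R) then p.[(x : R)^-1] * expR (- (x : R)^-1) else 0.

Lemma near_pos (x : R) : 0 < x -> \forall h \near (0 : R), 0 < x + h.
Proof.
move=> x0; near=> h; have hx : `|h| < x by near: h; exact: (@nbhs0_lt R R^o).
by move: hx; rewrite ltr_norml => /andP[]; rewrite -subr_gt0 opprK addrC.
Unshelve. all: by end_near. Qed.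

Lemma is_derive_flat (p : {poly R}) (x : R) : x != 0 ->
  is_derive x 1 (fun y : R => p.[y^-1] * expR (- y^-1))
    (('X ^+ 2 * (p - p^`())).[x^-1] * expR (- x^-1)).
Proof.
move=> xn0.
have DV : is_derive x 1 (fun y : R => y^-1) (- x ^- 2).
  have h := @is_deriveV R id x 1 1 xn0 (is_derive_id _ _).
  by apply: is_derive_eq h _; rewrite /GRing.scale/= mulr1.
have Dp : is_derive x^-1 1 (horner p) (p^`().[x^-1]).
  by rewrite derivE; apply: DeriveDef; [exact: derivable_horner|rewrite derive1E].
have D1 : is_derive x 1 (fun y : R => p.[y^-1]) (p^`().[x^-1] * (- x ^- 2)).
  exact: (@is_derive1_comp R (horner p) (fun y => y^-1) x).
have DN : is_derive x 1 (fun y : R => - y^-1) (x ^- 2).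
  by have h := is_deriveN DV; apply: is_derive_eq h _; rewrite opprK.
have D2 : is_derive x 1 (fun y : R => expR (- y^-1)) (expR (- x^-1) * x ^- 2).
  exact: (@is_derive1_comp R expR (fun y => - y^-1) x).
have h := is_deriveM D1 D2; apply: is_derive_eq h _.
rewrite !hornerE /GRing.scale/= -exprVn; ring.
Qed.

(** At 0, the difference quotient P(1/h)/h exp(-1/h) is at most a multiple of h,
    since exp(1/h) dominates the polynomial P(1/h)/h^2. *)
Lemma flat_deriv p (x : R^o) :
  has_deriv (flat p) x (1 : R^o) (flat ('X ^+ 2 * (p - p^`())) x).
Proof.
have hx (h : R) : (x : R^o) + h *: (1 : R^o) = (x : R) + h.
  by rewrite /GRing.scale/= mulr1.
have [x0|x0|x0] := ltrgtP (x : R) 0.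
- rewrite [X in has_deriv _ _ _ X]/flat ltNge (ltW x0)/=.
  have := @has_deriv_cst R S sS R^o 0 x (1 : R^o) I; apply: has_deriv_near.
  have nx : 0 < - (x : R) by rewrite oppr_gt0.
  have [d /= d0 dP] := near_pos nx; exists d => //= h hd.
  rewrite hx /flat; case: ifP => // xh.
  have {}hd : `|h| < d by move: hd; rewrite /= sub0r normrN.
  have := dP (- h); rewrite /= sub0r opprK => /(_ hd).
  by rewrite -opprD oppr_gt0 ltNge (ltW xh).
- have /has_deriv_normP : is_derive (x : R^o) (1 : R^o)
      (fun y : R => p.[y^-1] * expR (- y^-1) : R^o)
      ((('X ^+ 2 * (p - p^`())).[(x:R)^-1] * expR (- (x:R)^-1)) : R^o).
    by apply: is_derive_flat; rewrite gt_eqF.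
  rewrite /flat x0; apply: has_deriv_near.
  by apply: filterS (near_pos x0) => h; rewrite hx => ->.
- rewrite [X in has_deriv _ _ _ X]/flat x0 ltxx.
  have [C [C0 pC]] := horner_le_expR ('X ^+ 2 * p).
  split=> //; first by near=> h.
  move=> q -> e e0; near=> h.
  have -> : 0 + h *: (1 : R^o) = h by rewrite add0r /GRing.scale/= mulr1.
  rewrite scaler0 subr0.
  rewrite [flat p 0]/flat ltxx subr0 /flat; case: ifPn => h0; last by rewrite normr0 mulr_ge0// ltW.
  rewrite normrM [X in _ * X]ger0_norm ?expR_ge0// [`|h|]gtr0_norm//.
  have := pC h^-1; rewrite invr_ge0 (ltW h0) => /(_ isT).
  rewrite !hornerE. rewrite normrM normrX [`|h^-1|]gtr0_norm ?invr_gt0// => H.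
  have hC : h <= e / (C + 1).
    apply: le_trans (ler_norm _) _; near: h; apply: (@nbhs0_le R R^o).
    by rewrite divr_gt0// ltr_wpDl.
  have {}H : `|p.[h^-1]| * expR (- h^-1) <= C * h ^+ 2.
    rewrite expRN ler_pdivrMr ?expR_gt0// mulrAC -ler_pdivrMr ?exprn_gt0//.
    by rewrite mulrC -exprVn.
  apply: le_trans H _; rewrite expr2 mulrA ler_wpM2r ?(ltW h0)//.
  apply: (@le_trans _ _ ((C + 1) * h)); first by rewrite ler_wpM2r ?(ltW h0)// lerDl.
  by rewrite mulrC -ler_pdivlMr// ltr_wpDl.
Unshelve. all: by end_near. Qed.

Lemma flat_curve p : curve (flat p).
Proof.
apply: (curve_coind sS (P := fun c => exists p, c = flat p)); last by exists p.
move=> c [r ->]; split=> //; exists (flat ('X ^+ 2 * (r - r^`()))).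
by split; [move=> t; exact: flat_deriv|exists ('X ^+ 2 * (r - r^`()))].
Qed.

(** The composite lam(1/e - lam(r)) of lam(x) = exp(-1/x) is constant for r <= 0,
    where lam vanishes, and 0 for r >= 1, where lam(r) >= 1/e. It is normalized
    to be 1 in the first case, and r = (16 s)^2 - 1 makes it even. *)
Lemma plateau : exists chi : R^o -> S, [/\ curve chi,
  forall s : R, `|s| <= 16^-1 -> chi s = 1 &
  forall s : R, 8^-1 < `|s| -> chi s = 0].
Proof.
pose lam : R^o -> S := flat 1.
have lam0 (x : R) : x <= 0 -> lam x = 0 by rewrite /lam /flat leNgt => /negPf ->.
have lam1 (x : R) : 0 < x -> lam x = expR (- x^-1).
  by rewrite /lam /flat => ->; rewrite hornerE mul1r.
pose a : R := expR (-1).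
have a0 : 0 < a by exact: expR_gt0.
pose r (s : R^o) : S := ((16 * s) * (16 * s) - 1 : R).
pose u (s : R^o) : S := a + -1 * (lam (r s) : R).
have cr : curve r.
  have c16 : @curve R S (fun s => 16 * (s : R)).
    have := curve_affine 0 16; apply: Cinfty_eq_on; [exact: openT|].
    by move=> s _; rewrite add0r.
  have := curveD sS (curveM c16 c16) (curve_cst sS (a := (-1 : R)) I).
  by apply: Cinfty_eq_on; [exact: openT|].
have cu : curve u.
  apply: (curve_comp sS (r := lam \o r) (c := fun t => a + -1 * (t : R))).
    by apply: (curve_comp sS) => //; exact: flat_curve.
  exact: curve_affine.
have b0 : 0 < (lam a : R) by rewrite lam1// expR_gt0.
exists (fun s => (lam a : R)^-1 * (lam (u s) : R)); split.
- apply: (curveM (r := fun=> (lam a : R)^-1)); first exact: (curve_cst sS).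
  by apply: (curve_comp sS) => //; exact: flat_curve.
- move=> s hs; have -> : u s = a; last by rewrite mulVf// gt_eqF.
  rewrite /u lam0 ?mulr0 ?addr0// /r subr_le0 -expr2 -real_normK ?num_real//.
  rewrite exprn_ile1// normrM ger0_norm//.
  by rewrite -ler_pdivlMl// mulr1.
- move=> s hs; rewrite (lam0 (u s)) ?mulr0// /u mulN1r subr_le0.
  have r1 : 1 <= (r s : R).
    rewrite /r -expr2 -real_normK ?num_real// normrM ger0_norm//.
    have h2 : 2 < 16 * `|s|.
      by rewrite -ltr_pdivrMl//; apply: le_lt_trans hs; rewrite lter_pdivrMl//; lra.
    by rewrite expr2; nra.
  have rp : 0 < (r s : R) by apply: lt_le_trans r1.
  by rewrite lam1// /a ler_expR lerN2 invf_le1.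
Qed.

End Bump.

(** * Gluing along a sequence of dyadic intervals *)

Section Gluing.
Variable R : realType.
Local Notation S := (lcs_norm R^o).
Let sS := separated_lcs_norm R^o.

Definition rapidly_decreasing (a : nat -> R) :=
  forall k : nat, exists C, forall n, 2 ^+ (k * n) * `|a n| <= C.

Definition bump_supported (chi : R^o -> S) :=
  curve chi /\ forall s : R, 8^-1 < `|s| -> chi s = 0.

(** The sum over n of a_n chi(2^n t - 1). These terms live on disjoint dyadic
    intervals around 2^-n, so that at most one of them is nonzero at t; choosing
    it avoids infinite sums. *)
Definition glue_index (t : R) : nat :=
  xget 0%N [set n : nat | `|2 ^+ n * t - 1| <= 8^-1].
Definition glue (a : nat -> R) (chi : R^o -> S) (t : R^o) : S :=
  a (glue_index t) * chi (2 ^+ glue_index t * t - 1).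

(** A term of index m is nonzero only if 7/8 <= 2^m t <= 9/8, and in this case
    2^n t is at most 9/16 or at least 7/4 for all other n. *)
Lemma glueE (n : nat) (t : R) a chi : bump_supported chi ->
  3 / 5 < 2 ^+ n * t -> (n = 0%N \/ 2 ^+ n * t < 7 / 5) ->
  glue a chi t = a n * chi (2 ^+ n * t - 1).
Proof.
move=> [_ chi0] t1 t2.
have E0 (m : R) : 8^-1 < `|m| -> (chi m : R) = 0 := chi0 m.
have uniq (m : nat) : `|2 ^+ m * t - 1| <= 8^-1 -> m = n.
  rewrite ler_norml => /andP[m1 m2].
  have {}m1 : 7 / 8 <= 2 ^+ m * t by move: m1; generalize (2 ^+ m * t) => y; lra.
  have {}m2 : 2 ^+ m * t <= 9 / 8 by move: m2; generalize (2 ^+ m * t) => y; lra.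
  have [mn|nm|//] := ltngtP m n.
  - case: t2 => [n0|t2]; first by rewrite n0 in mn.
    have : 2 ^+ (n - m) * (2 ^+ m * t) < 7 / 5.
      by rewrite mulrA -exprD subnK// ltnW.
    have mn' : (0 < n - m)%N by rewrite subn_gt0.
    have h2 : (2 : R) <= 2 ^+ (n - m) by rewrite -{1}[2]expr1 ler_weXn2l// ler1n.
    move: h2; set X := (2 : R) ^+ (n - m); move: X => X h2.
    have : 2 * (7 / 8) <= X * (2 ^+ m * t) by apply: ler_pM.
    by generalize (X * (2 ^+ m * t)) => y; intros; exfalso; lra.
  - have : 2 ^+ (m - n) * (2 ^+ n * t) <= 9 / 8.
      by rewrite mulrA -exprD subnK ?(ltnW nm).
    have nm' : (0 < m - n)%N by rewrite subn_gt0.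
    have h2 : (2 : R) <= 2 ^+ (m - n) by rewrite -{1}[2]expr1 ler_weXn2l// ler1n.
    move: h2; set X := (2 : R) ^+ (m - n); move: X => X h2.
    have : 2 * (3 / 5) <= X * (2 ^+ n * t).
      by apply: ler_pM => //; exact: ltW.
    by generalize (X * (2 ^+ n * t)) => y; intros; exfalso; lra.
rewrite /glue /glue_index.
case: xgetP => [m _ /= /uniq ->//|/= none].
have none' m : 8^-1 < `|2 ^+ m * t - 1| by rewrite ltNge; apply/negP/none.
by rewrite !E0 ?mulr0.
Qed.

Lemma glue_le0 (t : R) a chi : bump_supported chi -> t <= 0 -> glue a chi t = 0.
Proof.
move=> [_ chi0] t0; rewrite /glue.
have -> : (chi (2 ^+ glue_index t * t - 1) : R) = 0; last by rewrite mulr0.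
apply: chi0; have : 2 ^+ glue_index t * t <= 0 by rewrite mulr_ge0_le0.
move=> h; rewrite ltr0_norm; lra.
Qed.

(** The least n with 2^n t >= 2/3. For large t this is n = 0, which needs no upper
    bound as there are no terms to the right of the one of index 0. *)
Lemma glue_index_exists (t : R) : 0 < t -> exists n : nat,
  2 / 3 <= 2 ^+ n * t /\ (n = 0%N \/ 2 ^+ n * t < 4 / 3).
Proof.
move=> t0; have ex : exists n : nat, 2 / 3 <= 2 ^+ n * t.
  have [n] : exists n : nat, t^-1 < n%:R.
    by exists (Num.trunc t^-1).+1; exact: Num.Theory.truncnS_gt.
  move=> nt; exists n; apply: (@le_trans _ _ 1); first by lra.
  rewrite -ler_pdivrMr// mul1r (le_trans (ltW nt))//.
  by rewrite -natrX ler_nat ltnW// ltn_expl.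
case: (ex_minnP ex) => n hn nmin; exists n; split=> //.
case: n hn nmin => [|n] hn nmin; [by left|right].
rewrite exprS -mulrA; have : 2 ^+ n * t < 2 / 3; last by lra.
by rewrite ltNge; apply/negP => /nmin; rewrite ltnn.
Qed.

(** The index may be fixed in advance for all sequences and all bumps, in
    particular for a glued function and for its derivative. *)
Lemma glue_near (t : R) : 0 < t -> exists n : nat, \forall h \near (0 : R),
  forall a chi, bump_supported chi ->
    glue a chi (t + h) = a n * chi (2 ^+ n * (t + h) - 1).
Proof.
move=> t0; have [n [t1 t2]] := glue_index_exists t0; exists n; near=> h => a chi bchi.
have hn : `|2 ^+ n * h| <= 16^-1.
  rewrite normrM mulrC -ler_pdivlMr ?normr_gt0 ?expf_neq0//.
  near: h; apply: (@nbhs0_le R R^o).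
  by rewrite divr_gt0 ?normr_gt0 ?expf_neq0.
move: hn; rewrite ler_norml => /andP[h1 h2].
apply: glueE => //; rewrite mulrDr; first by lra.
by case: t2 => t2; [left|right; lra].
Unshelve. all: by end_near. Qed.

Lemma bump_bounded chi : bump_supported chi ->
  exists B, forall s : R, `|chi s : R| <= B.
Proof.
move=> [cc chi0].
have [s Ks|B HB] := @compact_locally_bounded R R^o `[- 8^-1, 8^-1]
    (fun s : R^o => `|chi s : R|) (@segment_compact R _ _).
  exists (`|chi s : R| + 1).
  have := has_deriv_continuous sS ((curve_deriv sS cc).1 s) (q := Num.norm) erefl ltr01.
  apply: filterS => u h; rewrite -lerBlDl; apply: le_trans h.
  exact: lerB_dist.
exists (Num.max B 0) => s; have [s8|s8] := leP `|s| 8^-1.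
  by rewrite le_max HB//= in_itv/= -ler_norml.
by rewrite (chi0 s s8) normr0 le_max lexx orbT.
Qed.

Lemma bump_deriv chi : bump_supported chi -> bump_supported (cderive chi).
Proof.
move=> [cc chi0]; split; first by case: (curve_deriv sS cc).
move=> s s8; rewrite /cderive.
rewrite (@lcs_derive_near R S R^o chi (fun=> 0) s 1); last first.
  have d0 : 0 < `|s| - 8^-1 by rewrite subr_gt0.
  near=> h; apply: chi0; rewrite /GRing.scale/= mulr1.
  have hd : `|h| < `|s| - 8^-1 by near: h; exact: (@nbhs0_lt R R^o).
  have := lerB_dist s (- h); rewrite opprK normrN; lra.
exact: (has_deriv_derive sS (@has_deriv_cst R S sS R^o 0 s (1 : R^o) I)).
Unshelve. all: by end_near. Qed.

Lemma rapidly_decreasing_exp2 a : rapidly_decreasing a ->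
  rapidly_decreasing (fun n => 2 ^+ n * a n).
Proof.
move=> ra k; have [C HC] := ra k.+1; exists C => n.
by rewrite normrM ger0_norm ?exprn_ge0// mulrA -exprD addnC -mulSn.
Qed.

(** Differentiation multiplies the n-th term by 2^n, which the rapid decrease of
    the sequence absorbs. At 0, where the terms accumulate, 2^n is of the order
    of 1/t on the n-th interval, so that the rapid decrease makes the function
    O(t^2). *)
Lemma glue_deriv a chi (t : R^o) : rapidly_decreasing a -> bump_supported chi ->
  has_deriv (glue a chi) t (1 : R^o) (glue (fun n => 2 ^+ n * a n) (cderive chi) t).
Proof.
move=> ra bchi; have bchi' := bump_deriv bchi.
have hx (h : R) : (t : R^o) + h *: (1 : R^o) = (t : R) + h.
  by rewrite /GRing.scale/= mulr1.
have [t0|t0|t0] := ltrgtP (t : R) 0.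
- rewrite (glue_le0 _ bchi') ?ltW//.
  have := @has_deriv_cst R S sS R^o 0 t (1 : R^o) I; apply: has_deriv_near.
  have nt : 0 < - (t : R) by rewrite oppr_gt0.
  near=> h; rewrite hx glue_le0//.
  have : `|h| < - (t : R) by near: h; exact: (@nbhs0_lt R R^o).
  rewrite ltr_norml => /andP[_]; lra.
- have [n nP] := glue_near t0.
  have := nbhs_singleton nP => /(_ (fun n => 2 ^+ n * a n) _ bchi').
  rewrite addr0 => ->.
  have cc := (curve_deriv sS bchi.1).1 (-1 + 2 ^+ n * t).
  have D1 := has_deriv_comp sS (has_deriv_affine (-1) (2 ^+ n) t) cc.
  have D2 := has_deriv_scale sS (@has_deriv_cst R S sS R^o (a n) t (1 : R^o) I) D1.
  have -> : (2 ^+ n * a n * (cderive chi (2 ^+ n * t - 1) : R) : S) =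
    (0 : R) *: (chi \o (fun s : R^o => -1 + 2 ^+ n * s)) t +
     (a n : R) *: ((2 ^+ n : R) *: cderive chi (-1 + 2 ^+ n * t)).
    by rewrite scale0r add0r /GRing.scale/= [-1 + _]addrC mulrA [a n * _]mulrC.
  move: D2; apply: has_deriv_near; apply: filterS nP => h nP.
  by rewrite hx nP//= /GRing.scale/= [-1 + _]addrC.
- rewrite (glue_le0 _ bchi') ?t0//.
  have [B HB] := bump_bounded bchi; have [C HC] := ra 2.
  have B0 : 0 <= B by apply: le_trans (HB 0).
  have C0 : 0 <= C by apply: le_trans (HC 0%N); rewrite mulr_ge0// exprn_ge0.
  have K0 : 0 <= 9 / 4 * C * B by rewrite !mulr_ge0// invr_ge0.
  split=> //; first by near=> h.
  move=> q -> e e0; near=> h.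
  rewrite scaler0 subr0 [glue a chi 0](glue_le0 _ bchi) ?lexx// subr0.
  have -> : 0 + h *: (1 : R^o) = h by rewrite add0r /GRing.scale/= mulr1.
  have [h0|h0] := leP h 0.
    by rewrite (glue_le0 _ bchi)// normr0 mulr_ge0// ltW.
  have [n [h1 h2]] := glue_index_exists h0.
  rewrite (@glueE n)//; [|lra|by case: h2 => ?; [left|right; lra]].
  have an : `|a n| <= (9 / 4 * C) * h ^+ 2.
    have HCn := HC n.
    have p0 : 0 < (2 : R) ^+ n by rewrite exprn_gt0.
    have : (2 / 3) ^+ 2 * `|a n| <= (2 ^+ n * h) ^+ 2 * `|a n|.
      by rewrite ler_wpM2r// lerXn2r// ?nnegrE ?mulr_ge0// ?ltW.
    rewrite [(2 ^+ n * h) ^+ 2]exprMn -exprM [(n * 2)%N]mulnC [X in _ <= X]mulrAC => H.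
    have {}H : (2 / 3) ^+ 2 * `|a n| <= C * h ^+ 2.
      by apply: le_trans H _; rewrite ler_wpM2r// exprn_ge0// ltW.
    lra.
  rewrite normrM.
  have hK : h <= e / (9 / 4 * C * B + 1).
    apply: le_trans (ler_norm _) _; near: h; apply: (@nbhs0_le R R^o).
    by rewrite divr_gt0// ltr_wpDl.
  rewrite (gtr0_norm h0).
  apply: (@le_trans _ _ (((9 / 4 * C) * h ^+ 2) * B)).
    by apply: ler_pM => //; exact: HB.
  have -> : 9 / 4 * C * h ^+ 2 * B = (9 / 4 * C * B * h) * h by ring.
  apply: ler_wpM2r; first exact: ltW.
  apply: (@le_trans _ _ ((9 / 4 * C * B + 1) * h)).
    by rewrite ler_wpM2r ?(ltW h0)// lerDl.
  by rewrite mulrC -ler_pdivlMr// ltr_wpDl.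
Unshelve. all: by end_near. Qed.

Lemma glue_curve a chi : rapidly_decreasing a -> bump_supported chi ->
  curve (glue a chi).
Proof.
move=> ra bchi.
apply: (curve_coind sS (P := fun c => exists a chi,
  [/\ rapidly_decreasing a, bump_supported chi & c = glue a chi])).
  move=> c [b [psi [rb bpsi ->]]]; split=> //.
  exists (glue (fun n => 2 ^+ n * b n) (cderive psi)); split.
    by move=> t; exact: glue_deriv.
  exists (fun n => 2 ^+ n * b n), (cderive psi); split=> //.
    exact: rapidly_decreasing_exp2.
  exact: bump_deriv.
by exists a, chi.
Qed.

(** One bump, with plateau, carries the constant terms, and its product with the
    variable the slopes. *)
Lemma gluing_lines (a b : nat -> R) : rapidly_decreasing a -> rapidly_decreasing b ->
  exists u : R^o -> S, curve u /\ forall (n : nat) (t : R),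
    `|2 ^+ n * t - 1| <= 16^-1 -> u t = a n + b n * (2 ^+ n * t - 1).
Proof.
move=> ra rb; have [chi [cchi chi1 chi0]] := plateau R.
have bchi : bump_supported chi by [].
have cid : @curve R S (fun s => s).
  by have := curve_affine (0:R) 1; apply: (Cinfty_eq_on openT) => s _; rewrite add0r mul1r.
have bzeta : bump_supported (fun s => s * chi s : R).
  by split=> [|s /chi0 ->]; [exact: curveM|rewrite mulr0].
exists (fun t => glue a chi t + glue b (fun s => s * chi s : R) t); split.
  by apply: (curveD sS); exact: glue_curve.
move=> n t; rewrite ler_norml => /andP[t1 t2].
rewrite !(@glueE n)//; try lra; try (right; lra).
by rewrite chi1 ?mulr1// ler_norml t1.
Qed.

(** The exponent k n - n^2 is at most k^2. *)
Lemma rapidly_decreasing_le (a : nat -> R) :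
  (forall n, `|a n| <= (2 ^+ (n * n))^-1) -> rapidly_decreasing a.
Proof.
move=> ha k; exists (2 ^+ (k * k)) => n.
apply: (@le_trans _ _ (2 ^+ (k * n) * (2 ^+ (n * n))^-1)).
  by rewrite ler_wpM2l// exprn_ge0.
rewrite ler_pdivrMr ?exprn_gt0// -exprD ler_weXn2l ?ler1n//.
have [kn|nk] := leqP k n.
  by rewrite (leq_trans _ (leq_addl _ _))// leq_mul2r kn orbT.
by rewrite (leq_trans _ (leq_addr _ _))// leq_mul2l ltnW// orbT.
Qed.

End Gluing.

(** * Maps of the plane that are smooth along smooth curves *)

Section IteratedDerivatives.
Variables (R : realType) (E : lcs R) (sE : separated_lcs E).

Lemma curve_derivs (c : R^o -> E) p : curve c -> curve (iter p (@cderive R E) c).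
Proof. by move=> cc; elim: p => //= p /(curve_deriv sE)[]. Qed.

Lemma iter_cderive_eq_on (U : set R^o) (c d : R^o -> E) p t : open U -> U t ->
  (forall s, U s -> c s = d s) ->
  iter p (@cderive R E) c t = iter p (@cderive R E) d t.
Proof.
move=> oU Ut cd; elim: p t Ut => [|p IH] t Ut /=; first exact: cd.
apply: lcs_derive_near.
by apply: filterS (near_line (1 : R^o) oU Ut) => h Uh; exact: IH.
Qed.

Lemma iter_cderive_affine (c : R^o -> E) (a b : R) p : curve c ->
  iter p (@cderive R E) (fun t : R^o => c (a + b * t)) =
  fun t : R^o => b ^+ p *: iter p (@cderive R E) c (a + b * t).
Proof.
move=> cc; elim: p => [|p IH]; first by apply/funext => t; rewrite expr0 scale1r.
rewrite iterS IH; apply/funext => t; rewrite {1}/cderive.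
have D := (curve_deriv sE (curve_derivs p cc)).1 (a + b * t).
have D1 := has_deriv_comp sE (has_deriv_affine a b t) D.
have D2 := has_deriv_scale sE (@has_deriv_cst R _ (separated_lcs_norm R^o) R^o (b ^+ p) t (1 : R^o) I) D1.
by rewrite (has_deriv_derive sE D2) scale0r add0r scalerA exprSr.
Qed.

End IteratedDerivatives.

Section PlaneSmooth.
Variables (R : realType) (F : lcs R) (sF : separated_lcs F).
Local Notation S := (lcs_norm R^o).
Let sS := separated_lcs_norm R^o.

Definition plane_smooth (h : R -> R -> F) := forall s t : R^o -> S,
  curve s -> curve t -> curve (fun r : R^o => h (s r) (t r)).

Definition ray (h : R -> R -> F) (a b x y : R) : R^o -> F :=
  fun s => h (x + s * a) (y + s * b).

Lemma ray_curve h a b x y : plane_smooth h -> curve (ray h a b x y).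
Proof.
have C (u v : R) : @curve R S (fun s => u + (s : R) * v).
  have := curve_affine u v; apply: (Cinfty_eq_on openT).
  by move=> s _; rewrite mulrC.
by move=> hs; exact: (hs _ _ (C x a) (C y b)).
Qed.

(** The derivatives along a line at parameter s are those at 0 along the line
    restarted from there. *)
Lemma iter_cderive_ray h a b x y p (s : R) : plane_smooth h ->
  iter p (@cderive R F) (ray h a b x y) s =
  iter p (@cderive R F) (ray h a b (x + s * a) (y + s * b)) 0.
Proof.
move=> hs; have -> : ray h a b (x + s * a) (y + s * b) =
    fun t : R^o => ray h a b x y (s + 1 * t).
  by apply/funext => t; rewrite /ray mul1r !mulrDl !addrA.
rewrite (iter_cderive_affine sF); last exact: ray_curve.
by rewrite expr1n scale1r mulr0 addr0.
Qed.

(** Boman's argument. Otherwise there are points z_n within 2^(-n^2) of some z at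
    which the p-th derivative in the direction (a, b) exceeds n 2^(p n^2). Gluing
    lines gives a smooth curve that near 2^-n runs through z_n in that direction
    at speed 2^n 2^(-n^2). The p-th derivative at 2^-n of h along this curve is at
    least n, although it is continuous at 0. *)
Lemma ray_derivative_bounded h a b p q (A : R) : plane_smooth h ->
  lcs_seminorm q -> exists M, forall x y : R, `|x| <= A -> `|y| <= A ->
    q (iter p (@cderive R F) (ray h a b x y) 0) <= M.
Proof.
move=> hs sq; pose phi (z : R * R) := q (iter p (@cderive R F) (ray h a b z.1 z.2) 0).
have mD x y t : lcs_mem (iter p (@cderive R F) (ray h a b x y) t).
  by apply: curve_mem; apply: (curve_derivs sF); exact: ray_curve.
have [|z _|M HM] := @compact_locally_bounded R (R * R)%type
    (`[- A, A]%classic `*` `[- A, A]%classic) phi; last 1 first.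
- exists M => x y; rewrite !ler_norml => xA yA.
  by apply: (HM (x, y)); split; rewrite /= in_itv.
- by apply: compact_setX; exact: segment_compact.
apply: contrapT => unb.
have bad (n : nat) : exists z' : R * R,
    [/\ `|z'.1 - z.1| <= (2 ^+ (n * n))^-1, `|z'.2 - z.2| <= (2 ^+ (n * n))^-1 &
        n%:R * (2 ^+ (n * n)) ^+ p < phi z'].
  apply: contrapT => none; apply: unb; exists (n%:R * (2 ^+ (n * n)) ^+ p).
  have d0 : 0 < (2 ^+ (n * n))^-1 :> R by rewrite invr_gt0 exprn_gt0.
  exists (ball z.1 (2 ^+ (n * n))^-1, ball z.2 (2 ^+ (n * n))^-1).
    by split; exact: nbhsx_ballx.
  move=> [x y] [/= bx by_]; rewrite leNgt; apply/negP => lt; apply: none.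
  by exists (x, y); split=> //=; rewrite distrC ltW.
have [f fP] := choice bad.
pose e n : R := (2 ^+ (n * n))^-1.
have e0 n : 0 < e n by rewrite invr_gt0 exprn_gt0.
have re (c : R) : rapidly_decreasing (fun n => e n * c).
  have r : rapidly_decreasing e.
    by apply: rapidly_decreasing_le => n; rewrite gtr0_norm.
  move=> k; have [C HC] := r k; exists (C * `|c|) => n.
  by rewrite normrM mulrA ler_wpM2r.
have r1 : rapidly_decreasing (fun n => (f n).1 - z.1).
  by apply: rapidly_decreasing_le => n; case: (fP n).
have r2 : rapidly_decreasing (fun n => (f n).2 - z.2).
  by apply: rapidly_decreasing_le => n; case: (fP n).
have [s [cs sP]] := gluing_lines r1 (re a).
have [t [ct tP]] := gluing_lines r2 (re b).
have cs' := curveD sS (curve_cst sS (a := (z.1 : S)) I) cs.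
have ct' := curveD sS (curve_cst sS (a := (z.2 : S)) I) ct.
pose k := fun r : R^o => h (z.1 + (s r : R)) (z.2 + (t r : R)).
have ck : curve k by exact: (hs _ _ cs' ct').
have kD (n : nat) : iter p (@cderive R F) k (2 ^+ n)^-1 =
    (e n * 2 ^+ n) ^+ p *: iter p (@cderive R F) (ray h a b (f n).1 (f n).2) 0.
  have p0 : (0 : R) < 2 ^+ n by rewrite exprn_gt0.
  pose U : set R^o := [set r : R^o | `|2 ^+ n * (r : R) - 1| < 16^-1].
  have oU : open U.
    have : continuous (fun r : R => `|2 ^+ n * r - 1|).
      move=> r; apply: cvg_norm; apply: cvgB; last exact: cvg_cst.
      by apply: cvgMr; exact: cvg_id.
    by move=> cf; exact: (open_comp (fun r _ => cf r) (@open_lt R 16^-1)).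
  have Un : U (2 ^+ n)^-1.
    by rewrite /U/= divff ?gt_eqF// subrr normr0 invr_gt0.
  have := @iter_cderive_eq_on R F U k
    (fun r : R^o => ray h a b (f n).1 (f n).2 (- e n + (e n * 2 ^+ n) * r)) p _ oU Un.
  move=> ->; last first.
    move=> r /ltW Ur; rewrite /k (sP n)// (tP n)// /ray.
    by congr (h _ _); ring.
  rewrite (iter_cderive_affine sF); last exact: ray_curve.
  by rewrite -mulrA mulfV ?gt_eqF// mulr1 addNr.
have cont := has_deriv_continuous sF
  ((curve_deriv sF (curve_derivs sF p ck)).1 0) sq ltr01.
have [d /= d0 dP] := cont.
pose M := q (iter p (@cderive R F) k 0) + 1.
have [n [nM nd]] : exists n : nat, M <= n%:R /\ (2 ^+ n)^-1 < d.
  exists (maxn (Num.trunc M).+1 (Num.trunc d^-1).+1); split.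
    apply: le_trans (ltW (Num.Theory.truncnS_gt M)) _.
    by rewrite ler_nat leq_maxl.
  rewrite invf_plt ?posrE ?exprn_gt0//.
  apply: lt_le_trans (Num.Theory.truncnS_gt _) _.
  rewrite -natrX ler_nat; apply: (leq_trans (leq_maxr (Num.trunc M).+1 _)).
  exact/ltnW/ltn_expl.
have := dP (2 ^+ n)^-1; rewrite /= sub0r normrN gtr0_norm ?invr_gt0 ?exprn_gt0//.
move=> /(_ nd) H.
have : q (iter p (@cderive R F) k (2 ^+ n)^-1) <= M.
  have mk r : lcs_mem (iter p (@cderive R F) k r).
    by apply: curve_mem; exact: (curve_derivs sF).
  rewrite -[iter p _ k _ in X in X <= _](subrK (iter p (@cderive R F) k 0)).
  apply: le_trans (lsnD sF sq (lmemB sF (mk _) (mk _)) (mk _)) _.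
  by rewrite /M addrC lerD2l.
rewrite kD (lsnZ sF _ sq)// ger0_norm; last first.
  by rewrite exprn_ge0// mulr_ge0 ?(ltW (e0 _))// exprn_ge0.
have [_ _ fn] := fP n.
apply/negP; rewrite -ltNge; apply: le_lt_trans nM _.
apply: (@le_lt_trans _ _ ((e n * 2 ^+ n) ^+ p * (n%:R * (2 ^+ (n * n)) ^+ p))).
  rewrite mulrCA -exprMn mulrAC mulVf ?gt_eqF ?exprn_gt0// mul1r ler_peMr//.
  by rewrite !exprn_ege1// ler1n.
by rewrite ltr_pM2l// exprn_gt0// mulr_gt0// exprn_gt0.
Qed.

(** Taylor's formula on lines, with uniform remainders thanks to the local
    boundedness of the directional derivatives. *)
Lemma ray_taylor h a b q (p : nat) (A : R) : plane_smooth h -> lcs_seminorm q ->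
  exists M, 0 <= M /\ forall x y s : R, `|x| <= A -> `|y| <= A -> `|s| <= A ->
    q (h (x + s * a) (y + s * b) - \sum_(j < p) (s ^+ j / j`!%:R) *:
        iter j (@cderive R F) (ray h a b x y) 0) <= M * `|s| ^+ p.
Proof.
move=> hs sq.
have [M HM] := ray_derivative_bounded a b p (A + A * `|a| + A * `|b|) hs sq.
have mD x y t : lcs_mem (iter p (@cderive R F) (ray h a b x y) t).
  by apply: curve_mem; apply: (curve_derivs sF); exact: ray_curve.
exists (Num.max M 0); split; first by rewrite le_max lexx orbT.
move=> x y s xA yA sA.
have A0 : 0 <= A by apply: le_trans xA.
have := taylor_le sF sq (p := p) (M := Num.max M 0) (a := 0) (h := s)
  (ray_curve a b x y hs).
rewrite add0r; apply => u; rewrite subr0 => us.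
rewrite iter_cderive_ray// le_max HM//.
- apply: le_trans (ler_normD _ _) _; rewrite normrM -addrA lerD//.
  rewrite ler_wpDr ?mulr_ge0//; apply: ler_pM => //; exact: le_trans sA.
- apply: le_trans (ler_normD _ _) _; rewrite normrM lerD//.
    by apply: le_trans yA _; rewrite lerDl mulr_ge0.
  by apply: ler_pM => //; exact: le_trans sA.
Qed.

(** By the converse of Taylor's theorem, it suffices to expand the derivative in
    the first variable at (0, t + s) in powers of s. The weights of numerical
    differentiation recover it from the values h(i s, t + s), for i = 0, .., p + 1.
    Along the line of direction (i, 1) through (0, t), these values have Taylor
    expansions in s, which combine to the expansion sought. *)
Lemma plane_smooth_deriv h : plane_smooth h ->
  curve (fun t : R^o => cderive (ray h 1 0 0 t) 0).
Proof.
move=> hs; apply: (taylor_expandable_curve sF).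
have mD a b x y j t : lcs_mem (iter j (@cderive R F) (ray h a b x y) t).
  by apply: curve_mem; apply: (curve_derivs sF); exact: ray_curve.
split=> [t|p]; first exact: (mD 1 0 0 t 1%N 0).
have [w wP] := differentiation_weights R p.+1.
pose b j (t : R^o) := \sum_(i < p.+2) w i *: ((j.+1)`!%:R^-1 *:
  iter j.+1 (@cderive R F) (ray h i%:R 1 0 t) 0).
have mb j t : lcs_mem (b j t).
  by apply: (lmem_sum sF) => i _; do 2 apply: (lmemZ sF); exact: mD.
exists b; split=> // q sq A.
pose A' := A + 1 + p.+1%:R.
have [M' [M'0 HM']] := ray_taylor 1 0 p.+2 A' hs sq.
have /(_ p.+2)[M [M0 HM]] : forall m, exists M, 0 <= M /\ forall i : nat, (i < m)%N ->
    forall t s : R, `|t| <= A' -> `|s| <= A' ->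
    q (h (s * i%:R) (t + s) - \sum_(j < p.+2) (s ^+ j / j`!%:R) *:
        iter j (@cderive R F) (ray h i%:R 1 0 t) 0) <= M * `|s| ^+ p.+2.
  elim=> [|m [M [M0 HM]]]; first by exists 0; split.
  have [Mm [Mm0 HMm]] := ray_taylor m%:R 1 p.+2 A' hs sq.
  exists (M + Mm); split=> [|i]; first exact: addr_ge0.
  rewrite ltnS leq_eqVlt => /orP[/eqP ->|im] t s tA sA.
    have := HMm 0 t s; rewrite add0r mulr1 normr0 => /(_ _ tA sA) => H.
    apply: le_trans (H (le_trans (normr_ge0 _) tA)) _.
    by rewrite ler_wpM2r ?exprn_ge0// lerDr.
  by apply: le_trans (HM i im t s tA sA) _; rewrite ler_wpM2r ?exprn_ge0// lerDl.
pose W := \sum_(i < p.+2) `|w i|; have W0 : 0 <= W by apply: sumr_ge0.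
pose N : R := p.+1%:R.
exists (W * (M' * N ^+ p.+2 + M)), 1; split=> //.
  by rewrite mulr_ge0// addr_ge0// mulr_ge0// exprn_ge0.
move=> t s tA s0 s1.
have A0 : 0 <= A by apply: le_trans tA.
have tA' : `|t| <= A' by apply: le_trans tA _; rewrite /A' -addrA lerDl addr_ge0.
have tsA' : `|t + s| <= A'.
  apply: le_trans (ler_normD _ _) _; rewrite /A' -[X in X <= _]addr0.
  by rewrite lerD// lerD.
have sA' : `|s| <= A'.
  apply: le_trans s1 _; rewrite /A' -addrA addrC -addrA lerDl.
  by rewrite addr_ge0.
have := @weights_le R F sF q p.+1 w (fun i => h (s * i%:R) (t + s))
  (fun j => (s ^+ j / j`!%:R) *: iter j (@cderive R F) (ray h 1 0 0 (t + s)) 0)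
  (fun i j => (s ^+ j / j`!%:R) *: iter j (@cderive R F) (ray h i%:R 1 0 t) 0)
  (M' * N ^+ p.+2 * `|s| ^+ p.+2) (M * `|s| ^+ p.+2) sq isT wP.
have -> : (s ^+ 1 / 1`!%:R) *: iter 1 (@cderive R F) (ray h 1 0 0 (t + s)) 0 -
  \sum_(j < p.+1) \sum_(i < p.+2) w i *: ((s ^+ j.+1 / (j.+1)`!%:R) *:
    iter j.+1 (@cderive R F) (ray h i%:R 1 0 t) 0) =
  s *: (cderive (ray h 1 0 0 (t + s)) 0 - \sum_(j < p.+1) s ^+ j *: b j t).
  rewrite (_ : (1`!)%:R = 1 :> R)// expr1 divr1 scalerBr scaler_sumr; congr (_ - _).
  apply: eq_bigr => j _; rewrite /b !scaler_sumr; apply: eq_bigr => i _.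
  by rewrite !scalerA; congr (_ *: _); rewrite exprS; ring.
rewrite (lsnZ sF _ sq); last first.
  apply: (lmemB sF); first exact: (mD 1 0 0 (t + s) 1%N 0).
  by apply: (lmem_sum sF) => j _; exact: (lmemZ sF).
have -> : (\sum_(i < p.+2) `|w i|) * (M' * N ^+ p.+2 * `|s| ^+ p.+2 +
     M * `|s| ^+ p.+2) =
   `|s| * (W * (M' * N ^+ p.+2 + M) * `|s| ^+ p.+1).
  by rewrite -/W [`|s| ^+ p.+2]exprS; ring.
rewrite ler_pM2l//; apply.
- by move=> i; have := mD 0 0 (s * i%:R) (t + s) 0%N 0; rewrite /= /ray !mul0r !addr0.
- by move=> j; exact: (lmemZ sF).
- by move=> i j; exact: (lmemZ sF).
- by move=> i; rewrite /= /ray !mul0r !addr0.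
- move=> i ip; have iN : (i%:R : R) <= N by rewrite ler_nat -ltnS.
  have isA : `|s * i%:R| <= A'.
    rewrite normrM [`|i%:R|]ger0_norm//; apply: (@le_trans _ _ (1 * N)).
      exact: ler_pM.
    by rewrite mul1r /A' lerDr addr_ge0.
  have := HM' 0 (t + s) (s * i%:R); rewrite normr0 => /(_ _ tsA' isA).
  rewrite mulr1 mulr0 add0r addr0 => H.
  have -> : \sum_(j < p.+2) i%:R ^+ j *: ((s ^+ j / j`!%:R) *:
      iter j (@cderive R F) (ray h 1 0 0 (t + s)) 0) =
    \sum_(j < p.+2) ((s * i%:R) ^+ j / j`!%:R) *:
      iter j (@cderive R F) (ray h 1 0 0 (t + s)) 0.
    apply: eq_bigr => j _; rewrite scalerA; congr (_ *: _).
    by rewrite exprMn; ring.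
  apply: le_trans (H (le_trans (normr_ge0 _) tA')) _.
  rewrite -mulrA ler_wpM2l// -exprMn lerXn2r ?nnegrE ?mulr_ge0//.
  by rewrite normrM mulrC [`|i%:R|]ger0_norm// ler_wpM2r.
- by move=> i ip; exact: HM.
Qed.

End PlaneSmooth.

(** * Differentials of conveniently smooth maps *)

Section ConvenientCalculus.
Variables (R : realType) (E F : lcs R).
Variables (sE : separated_lcs E) (sF : separated_lcs F).
Implicit Types (f g : E -> F) (z v w : E) (s : seq E).
Local Notation S := (lcs_norm R^o).

Lemma convenient_smoothP f : convenient_smooth f <->
  (forall z, lcs_mem z -> lcs_mem (f z)) /\
  forall c : R^o -> E, curve c -> curve (f \o c).
Proof.
by split=> -[mf cf]; split=> // c; [move/(smooth_curveP sE)/cf/(smooth_curveP sF)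
  |move/(smooth_curveP sE)/cf/(smooth_curveP sF)].
Qed.

Lemma has_deriv_line (T : lmodType R) (k : T -> F) (x v : T) l :
  has_deriv (fun h : R^o => k (x + (h : R) *: v)) 0 (1 : R^o) l <-> has_deriv k x v l.
Proof.
have E1 (h : R) : ((0 : R^o) + h *: (1 : R^o) : R) = h.
  by rewrite add0r /GRing.scale/= mulr1.
have E0 : x + ((0 : R^o) : R) *: v = x by rewrite (scale0r v) addr0.
split=> -[ml mk kl]; split=> //.
- by apply: filterS mk => h; rewrite /= E1.
- by move=> q sq e e0; apply: filterS (kl q sq e e0) => h; rewrite /= E1 E0.
- by apply: filterS mk => h; rewrite /= E1.
- by move=> q sq e e0; apply: filterS (kl q sq e e0) => h; rewrite /= E1 E0.
Qed.

Lemma lcs_derive_line (T : lmodType R) (k : T -> F) (x v : T) :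
  lcs_derive k x v = cderive (fun h : R^o => k (x + (h : R) *: v)) 0.
Proof.
rewrite /cderive /lcs_derive /is_lcs_derive; congr xget.
have -> : (fun h : R => h^-1 *: (k (x + h *: v) - k x)) =
    (fun h : R => h^-1 *: (k (x + ((0 : R^o) + h *: (1 : R^o) : R) *: v) -
       k (x + (0 : R) *: v))).
  apply/funext => h.
  have -> : ((0 : R^o) + h *: (1 : R^o) : R) = h by rewrite add0r /GRing.scale/= mulr1.
  by have -> : x + (0 : R) *: v = x by rewrite scale0r addr0.
by [].
Qed.

Section Single.
Variables (f : E -> F) (sf : convenient_smooth f).

Lemma smooth_comp_plane (c v w : R^o -> E) : curve c -> curve v -> curve w ->
  plane_smooth (fun a b : R => f (c b + a *: v b)).
Proof.
move=> cc cv cw s t cs ct; have [_ cf] := (convenient_smoothP f).1 sf.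
apply: (cf (fun r => c (t r) + (s r : R) *: v (t r))).
apply: (curveD sE); first exact: (curve_comp sE).
by apply: (curve_scale sE) => //; exact: (curve_comp sE).
Qed.

(** For fixed curves c and v, the map (a, b) |-> f(c(b) + a v(b)) is smooth along
    smooth curves of the plane, and the differential is its derivative in a
    at a = 0. *)
Lemma differential_curve (c v : R^o -> E) : curve c -> curve v ->
  curve (fun t => lcs_derive f (c t) (v t)).
Proof.
move=> cc cv; have := plane_smooth_deriv sF (smooth_comp_plane cc cv cv).
congr curve; apply/funext => t; rewrite lcs_derive_line /ray.
by congr cderive; apply/funext => h; rewrite mulr0 !addr0 mulr1 add0r.
Qed.

Lemma smooth_has_deriv z v : lcs_mem z -> lcs_mem v ->
  has_deriv f z v (lcs_derive f z v).
Proof.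
move=> mz mv; apply/has_deriv_line; rewrite lcs_derive_line.
have cl : curve (fun h : R^o => f (z + (h : R) *: v)).
  have := smooth_comp_plane (curve_cst sE mz) (curve_cst sE mv) (curve_cst sE mv).
  move=> /(_ (fun h => h) (fun=> 0)); apply.
    have := curve_affine (0 : R) 1; apply: (Cinfty_eq_on openT).
    by move=> h _; rewrite add0r mul1r.
  exact: (curve_cst (separated_lcs_norm R^o)).
exact: (curve_deriv sF cl).1.
Qed.

Lemma differential_mem z v : lcs_mem z -> lcs_mem v -> lcs_mem (lcs_derive f z v).
Proof. by move=> mz mv; case: (smooth_has_deriv mz mv). Qed.

Lemma differential_smooth v : lcs_mem v ->
  convenient_smooth (fun z => lcs_derive f z v).
Proof.
move=> mv; apply/convenient_smoothP; split=> [z mz|c cc].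
  exact: differential_mem.
by apply: (differential_curve cc); exact: (curve_cst sE).
Qed.

Lemma differentialZ z v (a : R) : lcs_mem z -> lcs_mem v ->
  lcs_derive f z (a *: v) = a *: lcs_derive f z v.
Proof.
move=> mz mv; have sS := separated_lcs_norm R^o.
apply: (has_deriv_derive sF); apply/has_deriv_line.
have D : has_deriv (fun h : R^o => f (z + (h : R) *: v)) (0 + a * 0) (1 : R^o)
    (lcs_derive f z v).
  by rewrite mulr0 addr0; apply/has_deriv_line; exact: smooth_has_deriv.
have := has_deriv_comp sF (has_deriv_affine 0 a 0) D.
apply: has_deriv_near; near=> h => /=.
have -> : (0 : R^o) + h *: (1 : R^o) = h by rewrite add0r /GRing.scale/= mulr1.
by rewrite add0r scalerA mulrC.
Unshelve. all: by end_near. Qed.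

(** As h tends to 0, f(z + hv + hw) - f(z + hv) = h df(z + hv)(w) + O(h^2), and
    df(z + hv)(w) tends to df(z)(w) as the differential is smooth along the curve
    z + hv. *)
Lemma differentialD z v w : lcs_mem z -> lcs_mem v -> lcs_mem w ->
  lcs_derive f z (v + w) = lcs_derive f z v + lcs_derive f z w.
Proof.
move=> mz mv mw; have sS := separated_lcs_norm R^o.
have cid : @curve R S (fun h => h).
  by have := curve_affine (0:R) 1; apply: (Cinfty_eq_on openT) => h _; rewrite add0r mul1r.
apply: (has_deriv_derive sF).
have mzv (a b : R) : lcs_mem (z + a *: v + b *: w).
  by apply: (lmemD sE); [apply: (lmemD sE)|]; rewrite //; exact: (lmemZ sE).
have mf x : lcs_mem x -> lcs_mem (f x) by case: sf => + _; exact.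
have mdv := differential_mem mz mv; have mdw := differential_mem mz mw.
split; first exact: (lmemD sF).
  by near=> h; apply: mf; rewrite scalerDr addrA.
have cl : curve (fun h : R^o => z + (h : R) *: v).
  apply: (curveD sE); first exact: (curve_cst sE).
  by apply: (curve_scale sE) => //; exact: (curve_cst sE).
pose g := fun a b : R => f (z + b *: v + a *: w).
have pg : plane_smooth g.
  exact: (smooth_comp_plane cl (curve_cst sE mw) (curve_cst sE mw)).
(* the partial derivative along w varies continuously along z + hv *)
have dc := differential_curve cl (curve_cst sE mw).
move=> q sq e e0.
have e3 : 0 < e / 3 by rewrite divr_gt0.
have D1 : \forall h \near (0:R),
    q (f (z + h *: v) - f z - h *: lcs_derive f z v) <= e / 3 * `|h|.
  by have [_ _ /(_ q sq _ e3)] := smooth_has_deriv mz mv.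
have D2 : \forall h \near (0 : R),
    q (lcs_derive f (z + h *: v) w - lcs_derive f z w) <= e / 3.
  have := has_deriv_continuous sF ((curve_deriv sF dc).1 0) sq e3.
  by apply: filterS => h; rewrite scale0r addr0.
have [M [M0 HM]] := ray_taylor sF 1 0 2 1 pg sq.
apply: filter_app2 D1 D2; near=> h => H1 H2.
have h1 : `|h| <= 1 by near: h; exact: (@nbhs0_le R R^o).
have hM : `|h| <= e / 3 / (M + 1).
  by near: h; apply: (@nbhs0_le R R^o); rewrite divr_gt0// ltr_wpDl.
have := HM 0 h h; rewrite normr0 => /(_ ler01 h1 h1).
rewrite !big_ord_recl big_ord0/= addr0 expr0 divr1 scale1r add0r mulr1 mulr0 addr0.
rewrite /bump/= expr1 divr1.
have -> : cderive (ray g 1 0 0 h) 0 = lcs_derive f (z + h *: v) w.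
  rewrite [RHS]lcs_derive_line.
  apply: (f_equal (fun c : R^o -> F => cderive c 0)); apply/funext => t.
  have e1 : 0 + (t : R) * 1 = t by rewrite mulr1 add0r.
  have e2 : h + (t : R) * 0 = h by rewrite mulr0 addr0.
  by rewrite /ray e1 e2.
have -> : ray g 1 0 0 h 0 = f (z + h *: v).
  have e1 : 0 + (0 : R) * 1 = 0 by rewrite mulr1 add0r.
  have e2 : h + (0 : R) * 0 = h by rewrite mulr0 addr0.
  by rewrite /ray e1 e2 /g (scale0r w) addr0.
have mh : lcs_mem (z + h *: v).
  by have := mzv h 0; rewrite scale0r addr0.
rewrite /g; set G := f (z + h *: v + h *: w); set G1 := f (z + h *: v) in H1 *.
set dw := lcs_derive f (z + h *: v) w in H2 *.
have mG : lcs_mem G by exact: mf.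
have mG1 : lcs_mem G1 by exact: mf.
have mdw' : lcs_mem dw by exact: differential_mem.
have mz' := mf _ mz.
have mhd a x : lcs_mem x -> lcs_mem (a *: x : F) by exact: (lmemZ sF).
have -> : f (z + h *: (v + w)) = G by rewrite scalerDr addrA.
move=> H3.
have -> : G - f z - h *: (lcs_derive f z v + lcs_derive f z w) =
  (G - (G1 + h *: dw)) + (G1 - f z - h *: lcs_derive f z v) +
    h *: (dw - lcs_derive f z w).
  by lmodule R.
have m1 : lcs_mem (G - (G1 + h *: dw)).
  by apply: (lmemB sF) => //; apply: (lmemD sF) => //; exact: mhd.
have m2 : lcs_mem (G1 - f z - h *: lcs_derive f z v).
  by apply: (lmemB sF); [exact: (lmemB sF)|exact: mhd].
have m3 : lcs_mem (dw - lcs_derive f z w) by exact: (lmemB sF).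
apply: le_trans (lsnD sF sq (lmemD sF m1 m2) (mhd _ _ m3)) _.
apply: le_trans (lerD (lsnD sF sq m1 m2) (lexx _)) _.
rewrite (lsnZ sF _ sq)//.
have -> : e * `|h| = e / 3 * `|h| + e / 3 * `|h| + `|h| * (e / 3) by field.
apply: lerD; last by rewrite ler_wpM2l.
apply: lerD => //; apply: le_trans H3 _; rewrite expr2 mulrA ler_wpM2r//.
apply: (@le_trans _ _ ((M + 1) * `|h|)); first by rewrite ler_wpM2r// lerDl.
by rewrite mulrC -ler_pdivlMr// ltr_wpDl.
Unshelve. all: by end_near. Qed.

End Single.

Fixpoint all_mem s : Prop := if s is v :: s' then lcs_mem v /\ all_mem s' else True.

Lemma all_mem_rcons s v : all_mem s -> lcs_mem v -> all_mem (rcons s v).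
Proof. by elim: s => //= w s IH [mw /IH]; split=> //; auto. Qed.

Lemma lcs_derive_eq_mem f g z v : (forall x, lcs_mem x -> f x = g x) ->
  lcs_mem z -> lcs_mem v -> lcs_derive f z v = lcs_derive g z v.
Proof.
move=> fg mz mv; apply: lcs_derive_near; near=> h.
by apply: fg; apply: (lmemD sE) => //; exact: (lmemZ sE).
Unshelve. all: by end_near. Qed.

Lemma lcs_diffn_eq_mem f g z s : (forall x, lcs_mem x -> f x = g x) ->
  lcs_mem z -> all_mem s -> lcs_diffn f z s = lcs_diffn g z s.
Proof.
move=> fg; elim: s z => [|v s IH] z mz /=; first by move=> _; exact: fg.
by move=> [mv ms]; apply: lcs_derive_eq_mem => // x mx; exact: IH.
Qed.

Lemma convenient_smooth_eq f g : (forall x, lcs_mem x -> f x = g x) ->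
  convenient_smooth f -> convenient_smooth g.
Proof.
move=> fg /convenient_smoothP[mf cf]; apply/convenient_smoothP; split.
  by move=> z mz; rewrite -fg//; exact: mf.
move=> c cc; apply: (Cinfty_eq_on openT) (cf c cc) => t _ /=; apply: fg.
exact: curve_mem.
Qed.

Lemma convenient_smoothD f g : convenient_smooth f -> convenient_smooth g ->
  convenient_smooth (fun z => f z + g z).
Proof.
move=> /convenient_smoothP[mf cf] /convenient_smoothP[mg cg].
apply/convenient_smoothP; split=> [z mz|c cc].
  by apply: (lmemD sF); [exact: mf|exact: mg].
by apply: (curveD sF); [exact: cf|exact: cg].
Qed.

(** All iterated differentials of a smooth map are smooth in the base point, so
    that the limits in their definition exist. *)
Lemma lcs_diffn_smooth f s : convenient_smooth f -> all_mem s ->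
  convenient_smooth (fun z => lcs_diffn f z s).
Proof.
move=> sf; elim: s => // v s IH [mv /IH sf'].
exact: (differential_smooth sf' mv).
Qed.

Lemma lcs_diffn_mem f z s : convenient_smooth f -> lcs_mem z -> all_mem s ->
  lcs_mem (lcs_diffn f z s).
Proof. by move=> sf mz ms; have [+ _] := lcs_diffn_smooth sf ms; exact. Qed.

Lemma lcs_diffn_has_deriv f z v s : convenient_smooth f -> lcs_mem z -> lcs_mem v ->
  all_mem s -> has_deriv (fun x => lcs_diffn f x s) z v (lcs_diffn f z (v :: s)).
Proof. by move=> sf mz mv ms; apply: smooth_has_deriv => //; exact: lcs_diffn_smooth. Qed.

Lemma lcs_diffnD f g z s : convenient_smooth f -> convenient_smooth g ->
  lcs_mem z -> all_mem s ->
  lcs_diffn (fun x => f x + g x) z s = lcs_diffn f z s + lcs_diffn g z s.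
Proof.
move=> sf sg; elim: s z => //= v s IH z mz [mv ms].
rewrite (lcs_derive_eq_mem (g := fun x => lcs_diffn f x s + lcs_diffn g x s))//.
  by apply: (has_deriv_derive sF); apply: (has_derivD sF); exact: lcs_diffn_has_deriv.
by move=> x mx; exact: IH.
Qed.

Lemma lcs_diffn_rcons f z s w :
  lcs_diffn f z (rcons s w) = lcs_diffn (fun x => lcs_derive f x w) z s.
Proof.
elim: s z => //= v s IH z; congr lcs_derive; apply/funext => x; exact: IH.
Qed.

Lemma lcs_diffn_rconsD f z s v w : convenient_smooth f -> lcs_mem z ->
  all_mem s -> lcs_mem v -> lcs_mem w ->
  lcs_diffn f z (rcons s (v + w)) = lcs_diffn f z (rcons s v) + lcs_diffn f z (rcons s w).
Proof.
move=> sf mz ms mv mw; rewrite !lcs_diffn_rcons.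
rewrite -lcs_diffnD//; do ?exact: differential_smooth.
by apply: lcs_diffn_eq_mem => // x mx; exact: differentialD.
Qed.

End ConvenientCalculus.

Section LinearComposition.
Variables (R : realType) (E F G : lcs R).
Variables (sE : separated_lcs E) (sF : separated_lcs F) (sG : separated_lcs G).
Variables (L : F -> G) (cL : continuous_linear L).

Lemma convenient_smooth_clin (f : E -> F) : convenient_smooth f ->
  convenient_smooth (fun z => L (f z)).
Proof.
move=> /(convenient_smoothP sE sF)[mf cf]; apply/(convenient_smoothP sE sG).
split=> [z mz|c cc]; first by apply: (clin_mem cL); exact: mf.
exact: (Cinfty_clin sF openT sG cL (cf c cc)).
Qed.

Lemma lcs_diffn_clin (f : E -> F) z s : convenient_smooth f -> lcs_mem z ->
  all_mem s -> lcs_diffn (fun x => L (f x)) z s = L (lcs_diffn f z s).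
Proof.
move=> sf; elim: s z => //= v s IH z mz [mv ms].
rewrite (lcs_derive_eq_mem sE (g := fun x => L (lcs_diffn f x s)))//.
  apply: (has_deriv_derive sG); apply: (has_deriv_clin sF cL).
  exact: (lcs_diffn_has_deriv sE sF).
by move=> x mx; exact: IH.
Qed.

End LinearComposition.

Section DifferentialAlongOperator.
Variables (R : realType) (E F : lcs R).
Variables (sE : separated_lcs E) (sF : separated_lcs F).

(** Weaker than continuity for linear maps, and all that composition with a smooth
    map requires. *)
Record smooth_linear (T : E -> E) : Prop := SmoothLinear {
  slin_mem : forall x, lcs_mem x -> lcs_mem (T x);
  slinP : forall (a : R) x y, lcs_mem x -> lcs_mem y ->
    T (a *: x + y) = a *: T x + T y;
  slin_curve : forall c : R^o -> E, curve c -> curve (T \o c) }.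

Variables (T : E -> E) (lT : smooth_linear T) (f : E -> F).
Hypothesis sf : convenient_smooth f.

Lemma differential_along_smooth : convenient_smooth (fun z => lcs_derive f z (T z)).
Proof.
apply/(convenient_smoothP sE sF); split=> [z mz|c cc].
  by apply: (differential_mem sE sF) => //; exact: (slin_mem lT).
by apply: (differential_curve sE sF) => //; exact: (slin_curve lT).
Qed.

(** The lists obtained from s by applying t to one entry and moving it to the
    end. The last entry is the innermost direction of differentiation, where the
    image under T of the base point appears too. *)
Fixpoint slots (U : Type) (t : U -> U) (s : seq U) : seq (seq U) :=
  if s is v :: s' then rcons s' (t v) :: map (cons v) (slots t s') else [::].

Lemma all_mem_slots s : all_mem s -> forall r, List.In r (slots T s) -> all_mem r.
Proof.
elim: s => //= v s IH [mv ms] r [<-|].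
  by apply: all_mem_rcons => //; exact: (slin_mem lT).
by rewrite /map => /List.in_map_iff[r' [<- /(IH ms)]].
Qed.

(** The product rule for the two occurrences of x: as T is linear and the last slot
    enters additively, along x = z + hv the function splits into its values with
    last slots T z and h T v. *)
Lemma lcs_diffn_slot_has_deriv z v s : lcs_mem z -> lcs_mem v -> all_mem s ->
  has_deriv (fun x => lcs_diffn f x (rcons s (T x))) z v
    (lcs_diffn f z (v :: rcons s (T z)) + lcs_diffn f z (rcons s (T v))).
Proof.
move=> mz mv ms; have sS := separated_lcs_norm R^o.
have mTz := slin_mem lT mz; have mTv := slin_mem lT mv.
apply/has_deriv_line.
have msz := all_mem_rcons ms mTz; have msv := all_mem_rcons ms mTv.
have D1 := (has_deriv_line _ _ _ _).2 (lcs_diffn_has_deriv sE sF sf mz mv msz).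
have D2 := (has_deriv_line _ _ _ _).2 (lcs_diffn_has_deriv sE sF sf mz mv msv).
have D3 := has_deriv_scale sF (has_deriv_affine 0 1 0) D2.
have := has_derivD sF D1 D3; rewrite scale1r mulr0 addr0 !scale0r !addr0.
apply: has_deriv_near; near=> h.
have -> : (0 : R^o) + h *: (1 : R^o) = h by rewrite add0r /GRing.scale/= mulr1.
have mzh : lcs_mem (z + h *: v) by apply: (lmemD sE) => //; exact: (lmemZ sE).
rewrite add0r mul1r [z + _]addrC in mzh *; rewrite (slinP lT)//.
rewrite [h *: T v + _]addrC (lcs_diffn_rconsD sE sF)//; last exact: (lmemZ sE).
congr (_ + _); rewrite !lcs_diffn_rcons.
rewrite -(lcs_diffn_clin sE sF sF (scale_continuous_linear sF h))//; last first.
  exact: (differential_smooth sE sF).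
by apply: (lcs_diffn_eq_mem sE) => // x mx; rewrite (differentialZ sE sF).
Unshelve. all: by end_near. Qed.

Lemma has_deriv_In_sum (V : lmodType R) (I : Type) (r : seq I) (h : I -> V -> F)
    (l : I -> F) (z v : V) :
  (forall i, List.In i r -> has_deriv (h i) z v (l i)) ->
  has_deriv (fun x => \sum_(i <- r) h i x) z v (\sum_(i <- r) l i).
Proof.
elim: r => [_|i r IH hl].
  under eq_fun do rewrite big_nil.
  by rewrite big_nil; apply: (has_deriv_cst sF); exact: (lmem0 sF).
under eq_fun do rewrite big_cons.
rewrite big_cons; apply: (has_derivD sF); first by apply: hl; left.
by apply: IH => j jr; apply: hl; right.
Qed.

(** Leibniz's rule for z |-> df(z)(Tz): each differentiation either increases the
    order of the differential or, as T is linear, replaces T z by the image under T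
    of the direction. *)
Lemma lcs_diffn_along z s : lcs_mem z -> all_mem s ->
  lcs_diffn (fun x => lcs_derive f x (T x)) z s =
  lcs_diffn f z (rcons s (T z)) + \sum_(r <- slots T s) lcs_diffn f z r.
Proof.
elim: s z => [|v s IH] z mz /=; first by rewrite big_nil addr0.
move=> [mv ms]; rewrite (lcs_derive_eq_mem sE (g := fun x =>
   lcs_diffn f x (rcons s (T x)) + \sum_(r <- slots T s) lcs_diffn f x r))//; last first.
  by move=> x mx; exact: IH.
rewrite big_cons big_map addrA; apply: (has_deriv_derive sF).
apply: (has_derivD sF); first exact: lcs_diffn_slot_has_deriv.
apply: has_deriv_In_sum => r /(all_mem_slots ms) mr.
exact: (lcs_diffn_has_deriv sE sF).
Qed.

End DifferentialAlongOperator.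

(** * Several variables: Schwarz's theorem and multi-indices *)

Section SeveralVariables.
Variables (R : realType) (n : nat).
Local Notation Rn := 'rV[R]_n.
Implicit Types (E F : lcs R) (U K : set Rn).

Definition dirn (i : 'I_n) : Rn := delta_mx 0 i.

Lemma lsmooth_onP E (sE : separated_lcs E) U (f : Rn -> E) : open U ->
  lsmooth_on U f <-> Cinfty dirn U f.
Proof.
move=> oU; split=> [[mf df]|fi].
  apply: (Ck_coind (P := fun f => lsmooth_on U f)) => // {mf df}f [mf df].
  split=> [x Ux|i].
    split; first exact: mf.
    apply/(lcs_continuousP sE); first exact: (near_mem oU mf Ux).
    by have [] := df [::] x Ux.
  exists (lpartial i f); split=> [x Ux|].
    have [_ /(_ i)[l fl]] := df [::] x Ux.
    have {}fl : has_deriv f x (dirn i) l.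
      by apply/(has_derivP sE) => //; exact: (near_line_mem oU _ mf Ux).
    by rewrite /lpartial (has_deriv_derive sE fl).
  split=> [x Ux|s x Ux].
    have [_ /(_ i)[l fl]] := df [::] x Ux.
    have {}fl : has_deriv f x (dirn i) l.
      by apply/(has_derivP sE) => //; exact: (near_line_mem oU _ mf Ux).
    by rewrite /lpartial (has_deriv_derive sE fl); case: fl.
  by have := df (rcons s i) x Ux; rewrite foldr_rcons.
split=> [x Ux|s x Ux]; first exact: (Ck_mem (fi 0%N)).
have si := Cinfty_derivs sE oU s fi.
have ms y : U y -> lcs_mem (foldr (@lpartial R n E) f s y) by exact: (Ck_mem (si 0%N)).
split.
  apply/(lcs_continuousP sE); first exact: (near_mem oU ms Ux).
  exact: (Ck_cont (si 0%N)).
move=> i; have [/(_ x Ux) D _] := Cinfty_deriv sE oU i si.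
exists (lderive dirn i (foldr (lderive dirn (E:=E)) f s) x).
by apply/(has_derivP sE) => //; exact: (near_line_mem oU _ ms Ux).
Qed.

Section Normed.
Variable W : normedModType R.
Local Notation LW := (lcs_norm W).
Let sW := separated_lcs_norm W.

Lemma lcs_continuous_normP (f : Rn -> W) x :
  @lcs_continuous R Rn LW f x <-> {for x, continuous f}.
Proof.
have FF : Filter (nbhs x) := @nbhs_filter Rn x.
split=> [fc|fc q -> e e0].
  apply/(@cvgrPdist_le _ _ _ (nbhs x) _ f (f x)) => e e0.
  by apply: filterS (fc _ erefl e e0) => t; rewrite distrC.
have H := (@cvgrPdist_le _ _ _ (nbhs x) _ f (f x)).1 fc e e0.
by apply: filterS (H FF) => t; rewrite distrC.
Qed.

(** Partial derivatives of functions with values in a normed space are limits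
    for the norm, which is the only seminorm of the associated space. *)
Lemma partials_lpartials U (f : Rn -> W) s x : open U -> Cinfty (E := LW) dirn U f ->
  U x -> foldr (@partial R n W) f s x = foldr (lderive dirn (E := LW)) f s x.
Proof.
move=> oU fi; elim: s x => //= i s IH x Ux.
have [/(_ x Ux) D _] := Cinfty_deriv sW oU i (Cinfty_derivs sW oU s fi).
have {}D : has_deriv (E := LW) (foldr (@partial R n W) f s) x (dirn i)
    (lderive dirn i (foldr (lderive dirn (E := LW)) f s) x).
  by apply: (has_deriv_eq_on oU _ Ux D) => y Uy; rewrite IH.
by move/has_deriv_normP : D => D; exact: derive_val.
Qed.

Lemma smooth_onP U (f : Rn -> W) : open U ->
  smooth_on U f <-> Cinfty (E := LW) dirn U f.
Proof.
move=> oU; split=> [sf|fi s x Ux].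
  apply: (Ck_coind (E := LW) (P := fun f : Rn -> W => smooth_on U f)) => // {sf}f sf.
  split=> [x Ux|i].
    by split=> //; apply/lcs_continuous_normP; have [] := sf [::] x Ux.
  exists (partial i f); split=> [x Ux|s x Ux].
    apply/has_deriv_normP; apply: DeriveDef => //.
    by have [_] := sf [::] x Ux; exact.
  by have := sf (rcons s i) x Ux; rewrite foldr_rcons.
have si := Cinfty_derivs sW oU s fi.
have E1 y : U y -> foldr (@partial R n W) f s y = foldr (lderive dirn (E := LW)) f s y.
  exact: partials_lpartials.
split=> [|i].
  apply/lcs_continuous_normP.
  apply: (lcs_continuous_near (E := LW) (f := foldr (lderive dirn (E := LW)) f s)).
    by apply: filterS (open_nbhs_nbhs (conj oU Ux)) => y /E1 ->.
  exact: (Ck_cont (si 0%N)).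
have [/(_ x Ux) D _] := Cinfty_deriv sW oU i si.
have {}D : has_deriv (E := LW) (foldr (@partial R n W) f s) x (dirn i)
    (lderive dirn i (foldr (lderive dirn (E := LW)) f s) x).
  by apply: (has_deriv_eq_on oU _ Ux D) => y Uy; rewrite E1.
by move/has_deriv_normP : D => [].
Qed.

End Normed.

Section Schwarz.
Variables (E : lcs R) (sE : separated_lcs E) (U : set Rn) (oU : open U).

Lemma has_deriv_line_at (f : Rn -> E) (y v : Rn) (s : R) l :
  has_deriv f (y + s *: v) v l ->
  has_deriv (fun r : R^o => f (y + (r : R) *: v)) s (1 : R^o) l.
Proof.
have E1 (h : R) : ((s : R^o) + h *: (1 : R^o) : R) = s + h.
  by rewrite /GRing.scale/= mulr1.
move=> [ml mf fl]; split=> //.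
  by apply: filterS mf => h; rewrite E1 scalerDl addrA.
by move=> q sq e e0; apply: filterS (fl q sq e e0) => h; rewrite E1 scalerDl addrA.
Qed.

(** By the mean value inequality in the direction w, and then in the direction v.
    The second difference is symmetric in v and w, whence Schwarz's theorem. *)
Lemma mixed_difference (f g B : Rn -> E) (v w x : Rn) (q : E -> R) (e : R) :
  (forall y, U y -> has_deriv f y v (g y)) ->
  (forall y, U y -> has_deriv g y w (B y)) ->
  (forall y, U y -> lcs_mem (B y)) ->
  lcs_continuous B x -> U x -> lcs_seminorm q -> 0 < e ->
  \forall h \near (0 : R), 0 < h ->
    q (f (x + h *: v + h *: w) - f (x + h *: v) - f (x + h *: w) + f x
       - (h * h) *: B x) <= e * (h * h).
Proof.
move=> fg gB mB Bc Ux sq e0.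
have : \forall y \near x, U y /\ q (B y - B x) <= e.
  by near=> y; split; near: y; [exact: open_nbhs_nbhs|exact: Bc].
move=> /nbhs_ballP[d /= d0 dP].
pose N := 1 + `|v| + `|w|.
have N0 : 0 < N by rewrite /N -addrA ltr_pwDl// addr_ge0.
near=> h => h0.
have hd : h < d / N.
  by apply: le_lt_trans (ler_norm _) _; near: h; apply: (@nbhs0_lt R R^o); rewrite divr_gt0.
have near2 (s t : R) : 0 <= s <= h -> 0 <= t <= h ->
    U (x + s *: v + t *: w) /\ q (B (x + s *: v + t *: w) - B x) <= e.
  move=> /andP[s0 sh] /andP[t0 th]; apply: dP; rewrite -ball_normE/= -addrA opprD addNKr normrN.
  apply: le_lt_trans (ler_normD _ _) _; rewrite !normrZ !ger0_norm//.
  apply: (@le_lt_trans _ _ (h * N)); last by rewrite -ltr_pdivlMr.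
  rewrite /N !mulrDr mulr1 -addrA ler_wpDl//; first exact: ltW.
  by rewrite lerD// ler_wpM2r.
have mx := mB _ Ux.
have U1 (s : R) : 0 <= s <= h -> U (x + s *: v).
  move=> sh; have [] := near2 s 0 sh; rewrite ?lexx ?(ltW h0)//.
  by rewrite scale0r addr0.
have h00 : 0 <= h <= h by rewrite lexx ltW.
(* first along w, for the derivative along v *)
have step1 (s : R) : 0 <= s <= h ->
    q (g (x + s *: v + h *: w) - g (x + s *: v) - h *: B x) <= e * h.
  move=> sh.
  have := @mean_value_le R E sE q sq
    (fun t : R^o => g (x + s *: v + (t : R) *: w) + (- (t : R)) *: B x)
    (fun t : R^o => B (x + s *: v + (t : R) *: w) + (-1) *: B x) e 0 h (ltW h0).
  have -> : g (x + s *: v + h *: w) + (- h) *: B x -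
     (g (x + s *: v + 0 *: w) + (- 0) *: B x) =
     g (x + s *: v + h *: w) - g (x + s *: v) - h *: B x.
    by rewrite oppr0 !scale0r !addr0; lmodule R.
  rewrite subr0; apply=> t th; last by rewrite scaleN1r; have [] := near2 s t sh th.
  apply: (has_derivD sE); first by apply: has_deriv_line_at; apply: gB; have [] := near2 s t sh th.
  have := has_deriv_scale sE (has_deriv_affine 0 (-1) t) (@has_deriv_cst R E sE R^o (B x) t (1 : R^o) mx).
  rewrite scaler0 addr0; apply: has_deriv_near; near=> k.
  by rewrite add0r mulN1r.
have := @mean_value_le R E sE q sq
  (fun s : R^o => f (x + h *: w + (s : R) *: v) + ((-1) *: f (x + (s : R) *: v)
     + (- h * (s : R)) *: B x))
  (fun s : R^o => g (x + h *: w + (s : R) *: v) + ((-1) *: g (x + (s : R) *: v)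
     + (- h) *: B x)) (e * h) 0 h (ltW h0).
have -> : f (x + h *: w + h *: v) + (-1 *: f (x + h *: v) + (- h * h) *: B x) -
   (f (x + h *: w + 0 *: v) + (-1 *: f (x + 0 *: v) + (- h * 0) *: B x)) =
  f (x + h *: v + h *: w) - f (x + h *: v) - f (x + h *: w) + f x
       - (h * h) *: B x.
  have -> : x + h *: w + h *: v = x + h *: v + h *: w by rewrite addrAC.
  by rewrite mulr0 !scale0r !addr0; lmodule R.
rewrite subr0 -mulrA; apply=> s sh; last first.
  have -> : g (x + h *: w + s *: v) + (-1 *: g (x + s *: v) + - h *: B x) =
    g (x + s *: v + h *: w) - g (x + s *: v) - h *: B x.
    have -> : x + h *: w + s *: v = x + s *: v + h *: w by rewrite addrAC.
    by lmodule R.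
  exact: step1.
apply: (has_derivD sE).
  apply: has_deriv_line_at; apply: fg; rewrite addrAC.
  by have [] := near2 s h sh h00.
apply: (has_derivD sE).
  have := has_deriv_scale sE (@has_deriv_cst R _ (separated_lcs_norm R^o) R^o (-1) s (1 : R^o) I)
    (has_deriv_line_at (fg _ (U1 s sh))).
  by rewrite scale0r add0r.
have := has_deriv_scale sE (has_deriv_affine 0 (- h) s) (@has_deriv_cst R E sE R^o (B x) s (1 : R^o) mx).
rewrite scaler0 addr0; apply: has_deriv_near; near=> k.
by rewrite add0r.
Unshelve. all: by end_near. Qed.

Lemma lderive_comm (f : Rn -> E) i j x : Cinfty dirn U f -> U x ->
  lderive dirn i (lderive dirn j f) x = lderive dirn j (lderive dirn i f) x.
Proof.
move=> fi Ux.
have [Di Ci] := Cinfty_deriv sE oU i fi; have [Dj Cj] := Cinfty_deriv sE oU j fi.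
have [Dij Cij] := Cinfty_deriv sE oU i Cj; have [Dji Cji] := Cinfty_deriv sE oU j Ci.
have mij := Ck_mem (Cij 0%N); have mji := Ck_mem (Cji 0%N).
apply/eqP; rewrite -subr_eq0; apply/eqP; apply: (lsn_eq0 sE).
  by apply: (lmemB sE); [exact: mij|exact: mji].
move=> q sq e e0; have e2 : 0 < e / 2 by rewrite divr_gt0.
have H1 := mixed_difference Dj Dij mij (Ck_cont (Cij 0%N) Ux) Ux sq e2.
have H2 := mixed_difference Di Dji mji (Ck_cont (Cji 0%N) Ux) Ux sq e2.
have ma := mij _ Ux; have mb := mji _ Ux.
move: (lderive dirn i (lderive dirn j f) x) (lderive dirn j (lderive dirn i f) x)
  H1 H2 ma mb => a b H1 H2 ma mb.
have mf := Ck_mem (fi 0%N).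
have : \forall h \near (0 : R), 0 < h -> q (a - b) <= e.
  apply: filter_app2 H1 H2; near=> h => H1 H2 h0.
  move: H1 H2 => /(_ h0) H1 /(_ h0) H2.
  have hh : 0 < h * h by rewrite mulr_gt0.
  rewrite -(ler_pM2r hh) -[X in q _ * X](gtr0_norm hh) mulrC -(lsnZ sE _ sq); last first.
    exact: (lmemB sE).
  have mi : lcs_mem (f (x + h *: dirn i)).
    by apply: mf; near: h; exact: near_line.
  have mj : lcs_mem (f (x + h *: dirn j)).
    by apply: mf; near: h; exact: near_line.
  have mm : lcs_mem (f (x + h *: dirn i + h *: dirn j)).
    apply: mf; have -> : x + h *: dirn i + h *: dirn j = x + h *: (dirn i + dirn j).
      by rewrite scalerDr addrA.
    by near: h; exact: near_line.
  have mx := mf _ Ux.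
  have E1 : x + h *: dirn j + h *: dirn i = x + h *: dirn i + h *: dirn j.
    by rewrite addrAC.
  rewrite E1 in H1.
  move: (f (x + h *: dirn i)) (f (x + h *: dirn j)) (f (x + h *: dirn i + h *: dirn j))
    (f x) mi mj mm mx H1 H2 => fi' fj' fm' fx' mi mj mm mx H1 H2.
  have mA : lcs_mem (fm' - fj' - fi' + fx' - (h * h) *: a).
    by apply: (lmemB sE); [apply: (lmemD sE) => //; apply: (lmemB sE) => //; exact: (lmemB sE)|exact: (lmemZ sE)].
  have mB : lcs_mem (fm' - fi' - fj' + fx' - (h * h) *: b).
    by apply: (lmemB sE); [apply: (lmemD sE) => //; apply: (lmemB sE) => //; exact: (lmemB sE)|exact: (lmemZ sE)].
  have -> : (h * h) *: (a - b) = (fm' - fi' - fj' + fx' - (h * h) *: b) -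
      (fm' - fj' - fi' + fx' - (h * h) *: a) by lmodule R.
  by apply: le_trans (lsnB sE sq mB mA) _; lra.
move=> [d /= d0 dP]; have d2 : 0 < d / 2 by rewrite divr_gt0.
apply: (dP (d / 2)) => //=; rewrite sub0r normrN gtr0_norm//.
by rewrite ltr_pdivrMr// ltr_pMr// ltr1n.
Unshelve. all: by end_near. Qed.

(** Any entry can be moved to the front, as differentiations commute. *)
Lemma lderives_perm (f : Rn -> E) (s t : seq 'I_n) x : Cinfty dirn U f -> U x ->
  perm_eq s t ->
  foldr (@lderive R Rn 'I_n dirn E) f s x = foldr (@lderive R Rn 'I_n dirn E) f t x.
Proof.
move=> fi.
have bubble i (s1 s2 : seq 'I_n) y : U y ->
    foldr (@lderive R Rn 'I_n dirn E) f (s1 ++ i :: s2) y =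
    foldr (@lderive R Rn 'I_n dirn E) f (i :: s1 ++ s2) y.
  elim: s1 y => //= j s1 IH y Uy.
  rewrite (lderive_eq_on dirn oU _ IH Uy)/=; apply: lderive_comm => //.
  exact: (Cinfty_derivs sE oU).
elim: s t x => [|i s IH] t x Ux.
  by rewrite perm_sym => /perm_nilP ->.
move=> st; have it : i \in t by rewrite -(perm_mem st) mem_head.
case/splitPr: it st => t1 t2; rewrite perm_sym -cat1s perm_catCA/= perm_cons perm_sym => st.
rewrite bubble//=; apply: (lderive_eq_on dirn oU _ _ Ux) => y Uy.
exact: IH.
Qed.

End Schwarz.

(** Iterated partial derivatives indexed by a multi-index [a] amount to the
    list of directions [mseq a]; conversely, by Schwarz's theorem, each list
    of directions can be replaced by the multi-index counting them. *)
Definition mseq (a : {ffun 'I_n -> nat}) : seq 'I_n :=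
  flatten [seq nseq (a i) i | i <- enum 'I_n].

Definition mcount (s : seq 'I_n) : {ffun 'I_n -> nat} :=
  [ffun i => count_mem i s].

Lemma mpow_foldr (A : Type) (D : 'I_n -> A -> A) a f :
  mpow D a f = foldr D f (mseq a).
Proof.
rewrite /mpow /mseq; elim: (enum 'I_n) => //= i s ->.
by rewrite foldr_cat; elim: (a i) => //= k ->.
Qed.

Lemma size_mseq a : size (mseq a) = mlen a.
Proof.
rewrite /mseq /mlen size_flatten /shape -map_comp sumnE big_map.
by rewrite -big_enum/=; apply: eq_bigr => i _; rewrite /= size_nseq.
Qed.

Lemma mseq_mcount s : perm_eq s (mseq (mcount s)).
Proof.
apply/allP => i _ /=; apply/eqP; rewrite /mseq count_flatten -map_comp sumnE big_map.
rewrite big_enum_cond/= (bigD1 i)//= count_nseq/= eqxx mul1n ffunE big1 ?addn0//.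
by move=> j ji; rewrite count_nseq/= (negPf ji) mul0n.
Qed.

Lemma mlen_mcount s : mlen (mcount s) = size s.
Proof. by rewrite -size_mseq -(perm_size (mseq_mcount s)). Qed.

End SeveralVariables.

(** * Seminorms of derivatives and Leibniz's formula *)

Section SeminormsOfDerivatives.
Variables (R : realType) (n : nat).
Local Notation Rn := 'rV[R]_n.
Local Notation LR := (lcs_norm R^o).
Let sR := separated_lcs_norm R^o.
Implicit Types (E F : lcs R) (U K : set Rn) (s : seq 'I_n).

Definition ders E (f : Rn -> E) s : Rn -> E := foldr (lderive (@dirn R n) (E := E)) f s.

(** There are finitely many lists of bounded length; the induction avoids
    enumerating them. *)
Lemma lists_uniform (P : seq 'I_n -> R -> Prop) (m : nat) :
  (forall s C C', C <= C' -> P s C -> P s C') -> (forall s, exists C, P s C) ->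
  exists C, 0 <= C /\ forall s, (size s <= m)%N -> P s C.
Proof.
elim: m P => [|m IH] P mono ex.
  have [C PC] := ex [::]; exists (Num.max 0 C); rewrite le_max lexx; split=> // s.
  by rewrite leqn0 => /nilP ->; apply: mono PC; rewrite le_max lexx orbT.
have [C0 PC0] := ex [::].
have {}IH i : exists C, 0 <= C /\ forall s, (size s <= m)%N -> P (i :: s) C.
  by apply: (IH (fun s => P (i :: s))) => // s C C'; exact: mono.
have [C CP] := choice IH.
exists (Num.max 0 C0 + \sum_i C i).
have C0s : 0 <= \sum_i C i by apply: sumr_ge0 => i _; case: (CP i).
split; first by rewrite addr_ge0// le_max lexx.
case=> [_|i s]; first by apply: mono PC0; rewrite ler_wpDr// le_max lexx orbT.
rewrite /= ltnS => sm; apply: mono ((CP i).2 s sm).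
rewrite ler_wpDl ?le_max ?lexx// (bigD1 i)//= lerDl.
by apply: sumr_ge0 => j _; case: (CP j).
Qed.

Lemma sup_le_nneg (A : set R) (C : R) : 0 <= C -> (forall r, A r -> r <= C) -> sup A <= C.
Proof.
move=> C0 AC; have [->|A0] := eqVneq A set0; first by rewrite sup0.
by apply: ge_sup => //; exact/set0P.
Qed.

Lemma sup_nneg_ge0 (A : set R) : has_ubound A -> (forall r, A r -> 0 <= r) -> 0 <= sup A.
Proof.
move=> uA A0; have [->|/set0P[r Ar]] := eqVneq A set0; first by rewrite sup0.
by apply: le_trans (A0 r Ar) _; exact: ub_le_sup.
Qed.

(** The seminorms of the space of smooth E-valued functions; those of scalar
    functions and the mixed ones below are instances. *)
Definition snK E K m (q : E -> R) (f : Rn -> E) : R :=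
  sup [set r | exists x a, [/\ K x, (mlen a <= m)%N &
    r = q (mpow (@lpartial R n E) a f x)]].

Lemma mpow_ders E a (f : Rn -> E) : mpow (@lpartial R n E) a f = ders f (mseq a).
Proof. exact: mpow_foldr. Qed.

Lemma snK_le E K m (q : E -> R) (f : Rn -> E) (C : R) : 0 <= C ->
  (forall x s, K x -> (size s <= m)%N -> q (ders f s x) <= C) -> snK K m q f <= C.
Proof.
move=> C0 h; apply: sup_le_nneg => // r [x [a [Kx am ->]]].
by rewrite mpow_ders; apply: h => //; rewrite size_mseq.
Qed.

Section Smooth.
Variables (E : lcs R) (sE : separated_lcs E) (U : set Rn) (oU : open U).
Variables (q : E -> R) (sq : lcs_seminorm q).
Implicit Types (f g : Rn -> E).

Lemma ders_smooth f s : Cinfty (@dirn R n) U f -> Cinfty (@dirn R n) U (ders f s).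
Proof. exact: (Cinfty_derivs sE oU). Qed.

Lemma ders_mem f s x : Cinfty (@dirn R n) U f -> U x -> lcs_mem (ders f s x).
Proof. by move=> fi; exact: (Ck_mem (ders_smooth s fi 0%N)). Qed.

Lemma ders_bounded f K m : Cinfty (@dirn R n) U f -> compact K -> K `<=` U ->
  exists C, 0 <= C /\ forall s, (size s <= m)%N -> forall x, K x -> q (ders f s x) <= C.
Proof.
move=> fi cK KU; apply: lists_uniform => [s C C' CC' h x /h|s].
  by move=> h'; exact: le_trans CC'.
apply: compact_locally_bounded cK _ => x Kx; exists (q (ders f s x) + 1).
have si := ders_smooth s fi.
apply: filter_app2 (Ck_cont (si 0%N) (KU _ Kx) sq ltr01)
  (near_mem oU (fun y => Ck_mem (si 0%N)) (KU _ Kx)).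
near=> y => h my; have mx := Ck_mem (si 0%N) (KU _ Kx).
rewrite -(subrK (ders f s x) (ders f s y)).
apply: le_trans (lsnD sE sq (lmemB sE my mx) mx) _.
by rewrite addrC lerD2l.
Unshelve. all: by end_near. Qed.

Lemma snK_has_ubound f K m : Cinfty (@dirn R n) U f -> compact K -> K `<=` U ->
  has_ubound [set r | exists x a, [/\ K x, (mlen a <= m)%N &
    r = q (mpow (@lpartial R n E) a f x)]].
Proof.
move=> fi cK KU; have [C [C0 HC]] := ders_bounded m fi cK KU.
exists C => r [x [a [Kx am ->]]]; rewrite mpow_ders.
by apply: HC => //; rewrite size_mseq.
Qed.

Lemma snK_ub f K m s x : Cinfty (@dirn R n) U f -> compact K -> K `<=` U ->
  K x -> (size s <= m)%N -> q (ders f s x) <= snK K m q f.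
Proof.
move=> fi cK KU Kx sm; rewrite /ders.
rewrite (lderives_perm sE oU fi (KU _ Kx) (mseq_mcount s)).
apply: (ub_le_sup (snK_has_ubound m fi cK KU)).
by exists x, (mcount s); rewrite mpow_foldr mlen_mcount.
Qed.

Lemma snK_ge0 f K m : Cinfty (@dirn R n) U f -> compact K -> K `<=` U ->
  0 <= snK K m q f.
Proof.
move=> fi cK KU; apply: sup_nneg_ge0; first exact: snK_has_ubound.
move=> r [x [a [Kx am ->]]]; rewrite mpow_ders.
by apply: (lsn_ge0 sE sq); apply: ders_mem => //; exact: KU.
Qed.

Lemma dersD f g s x : Cinfty (@dirn R n) U f -> Cinfty (@dirn R n) U g -> U x ->
  ders (fun y => f y + g y) s x = ders f s x + ders g s x.
Proof.
move=> fi gi; elim: s x => //= i s IH x Ux; apply: (has_deriv_derive sE).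
apply: (has_deriv_eq_on oU (f := fun y => ders f s y + ders g s y)) => //.
  by move=> y Uy; rewrite -IH.
apply: (has_derivD sE).
  by have [+ _] := Cinfty_deriv sE oU i (ders_smooth s fi); exact.
by have [+ _] := Cinfty_deriv sE oU i (ders_smooth s gi); exact.
Qed.

Lemma dersZ (a : R) f s x : Cinfty (@dirn R n) U f -> U x ->
  ders (fun y => a *: f y) s x = a *: ders f s x.
Proof.
move=> fi Ux; exact: (lderive_clin sE oU sE s (scale_continuous_linear sE a) fi Ux).
Qed.

Lemma ders_sum (J : Type) (r : seq J) (P : pred J) (f : J -> Rn -> E) s x :
  (forall j, P j -> Cinfty (@dirn R n) U (f j)) -> U x ->
  ders (fun y => \sum_(j <- r | P j) f j y) s x = \sum_(j <- r | P j) ders (f j) s x.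
Proof.
move=> fi Ux; elim: r => [|j r IH].
  have i0 := @Cinfty_cst _ _ _ (@dirn R n) E sE U 0 (lmem0 sE).
  rewrite big_nil -[RHS](scale0r (ders (fun=> 0) s x)) -(dersZ _ _ i0)//.
  by congr (ders _ s x); apply/funext => y; rewrite big_nil scale0r.
rewrite big_cons; case: ifP => Pj; last first.
  by rewrite -IH; congr (ders _ s x); apply/funext => y; rewrite big_cons Pj.
rewrite -IH -dersD//; [|exact: fi|exact: (Cinfty_sum sE oU)].
by congr (ders _ s x); apply/funext => y; rewrite big_cons Pj.
Qed.

Lemma snKD f g K m : Cinfty (@dirn R n) U f -> Cinfty (@dirn R n) U g ->
  compact K -> K `<=` U ->
  snK K m q (fun y => f y + g y) <= snK K m q f + snK K m q g.
Proof.
move=> fi gi cK KU; apply: snK_le; first by rewrite addr_ge0// snK_ge0.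
move=> x s Kx sm; have Ux := KU _ Kx; rewrite dersD//.
apply: le_trans (lsnD sE sq (ders_mem s fi Ux) (ders_mem s gi Ux)) _.
by rewrite lerD// snK_ub.
Qed.

Lemma snKZ (a : R) f K m : Cinfty (@dirn R n) U f -> compact K -> K `<=` U ->
  snK K m q (fun y => a *: f y) = `|a| * snK K m q f.
Proof.
move=> fi cK KU.
have H b g : Cinfty (@dirn R n) U g -> snK K m q (fun y => b *: g y) <= `|b| * snK K m q g.
  move=> gi; apply: snK_le; first by rewrite mulr_ge0// snK_ge0.
  move=> x s Kx sm; have Ux := KU _ Kx; rewrite dersZ// (lsnZ sE _ sq); last exact: ders_mem.
  by rewrite ler_wpM2l// snK_ub.
apply/eqP; rewrite eq_le H//=; have [->|a0] := eqVneq a 0.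
  rewrite normr0 mul0r snK_ge0//.
  exact: (CinftyZ sE oU).
rewrite -ler_pdivlMl ?normr_gt0// -normfV.
apply: le_trans (H a^-1 _ (CinftyZ sE oU a fi)).
have -> // : (fun y => a^-1 *: (a *: f y)) = f.
by apply/funext => y; rewrite scalerA mulVf// scale1r.
Qed.

End Smooth.

Lemma ders_clin E F (sE : separated_lcs E) (sF : separated_lcs F) U (L : E -> F) f s x :
  open U -> continuous_linear L -> Cinfty (@dirn R n) U f -> U x ->
  ders (L \o f) s x = L (ders f s x).
Proof. by move=> oU cL fi Ux; exact: (lderive_clin sE oU sF s cL fi Ux). Qed.

Lemma ders_eq_on E U (f g : Rn -> E) s x : open U -> (forall x, U x -> f x = g x) ->
  U x -> ders f s x = ders g s x.
Proof. by move=> oU fg Ux; exact: (lderives_eq_on _ oU s fg Ux). Qed.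

Lemma snK_eq_on E U K m (q : E -> R) (f g : Rn -> E) : open U -> K `<=` U ->
  (forall x, U x -> f x = g x) -> snK K m q f = snK K m q g.
Proof.
move=> oU KU fg; congr sup; apply/seteqP; split=> r [x [a [Kx am ->]]];
  exists x, a; split=> //; rewrite !mpow_ders; congr q; apply: ders_eq_on oU _ (KU _ Kx) => y Uy;
  by rewrite fg.
Qed.

Section Leibniz.

(** The terms of Leibniz's formula for an iterated derivative of the product of a
    scalar function r with a vector-valued one: pairs of a derivative of r and of
    the list of the directions that remain for the second factor. Explicit lists
    make the coefficients of the formula available, independently of the second
    factor and of the space of its values. *)
Fixpoint leibniz (r : Rn -> R) (s : seq 'I_n) : seq ((Rn -> R) * seq 'I_n) :=
  if s is i :: s' then
    [seq (lderive (@dirn R n) (E := LR) i p.1, p.2) | p <- leibniz r s'] ++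
    [seq (p.1, i :: p.2) | p <- leibniz r s']
  else [:: (r, [::])].

Lemma leibniz_size r s p : List.In p (leibniz r s) -> (size p.2 <= size s)%N.
Proof.
elim: s p => /= [p [<-//|//]|i s IH p].
rewrite /cat => /List.in_app_iff[]; rewrite /map => /List.in_map_iff[p' [<- /IH]] //=.
exact: leqW.
Qed.

Variables (U : set Rn) (oU : open U) (r : Rn -> R).
Hypothesis rs : Cinfty (E := LR) (@dirn R n) U r.

Lemma leibniz_smooth s p : List.In p (leibniz r s) -> Cinfty (E := LR) (@dirn R n) U p.1.
Proof.
elim: s p => /= [p [<-//|//]|i s IH p].
rewrite /cat => /List.in_app_iff[]; rewrite /map => /List.in_map_iff[p' [<- /IH]] //= pi.
exact: (Cinfty_deriv sR oU i pi).2.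
Qed.

Lemma ders_scale E (sE : separated_lcs E) V (u : Rn -> E) s x : open V -> V `<=` U ->
  Cinfty (@dirn R n) V u -> V x ->
  ders (fun y => r y *: u y) s x = \sum_(p <- leibniz r s) p.1 x *: ders u p.2 x.
Proof.
move=> oV VU ui; elim: s x => [|i s IH] x Vx; first by rewrite /= big_seq1.
have rsV : Cinfty (E := LR) (@dirn R n) V r by move=> k; exact: Ck_subset (rs k).
rewrite /= big_cat/= !big_map -big_split/=.
apply: (has_deriv_derive sE).
apply: (has_deriv_eq_on oV (f := fun y => \sum_(p <- leibniz r s) p.1 y *: ders u p.2 y)) => //.
  by move=> y Vy; rewrite -IH.
apply: (has_deriv_In_sum sE) => p ps.
have [/(_ x (VU _ Vx)) Dp _] := Cinfty_deriv sR oU i (leibniz_smooth ps).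
have [/(_ x Vx) Du _] := Cinfty_deriv sE oV i (ders_smooth sE oV p.2 ui).
exact: (has_deriv_scale sE Dp Du).
Qed.

Lemma leibniz_bounded K m : compact K -> K `<=` U -> exists C, 0 <= C /\
  forall s, (size s <= m)%N -> forall x, K x -> \sum_(p <- leibniz r s) `|p.1 x| <= C.
Proof.
move=> cK KU; apply: lists_uniform => [s C C' CC' h x /h h'|s]; first exact: le_trans CC'.
have : forall p, List.In p (leibniz r s) -> Cinfty (E := LR) (@dirn R n) U p.1.
  exact: leibniz_smooth.
elim: (leibniz r s) => [|p l IH] H.
  by exists 0 => x _; rewrite big_nil.
have [|C HC] := IH; first by move=> p' h; apply: H; right.
have pi : Cinfty (E := LR) (@dirn R n) U p.1 by apply: H; left.
have [M [_ HM]] := ders_bounded sR oU (q := Num.norm) erefl 0%N pi cK KU.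
exists (M + C) => x Kx; rewrite big_cons lerD//; last exact: HC.
exact: (HM [::]).
Qed.

Lemma ders_scale_le E (sE : separated_lcs E) V (u : Rn -> E) K m (C M : R) (q : E -> R) s x :
  open V -> V `<=` U -> Cinfty (@dirn R n) V u -> lcs_seminorm q -> V x -> K x ->
  (forall s x, (size s <= m)%N -> K x -> \sum_(p <- leibniz r s) `|p.1 x| <= C) ->
  (forall s', (size s' <= m)%N -> q (ders u s' x) <= M) -> 0 <= M ->
  (size s <= m)%N -> q (ders (fun y => r y *: u y) s x) <= C * M.
Proof.
move=> oV VU ui sq Vx Kx HC HM M0 sm; rewrite (ders_scale sE s oV)//.
apply: (lsn_sum_le sE sq).
  by move=> p _; apply: (lmemZ sE); exact: (ders_mem sE oV).
apply: le_trans (ler_wpM2r M0 (HC s x sm Kx)); rewrite mulr_suml.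
have : forall p, List.In p (leibniz r s) -> (size p.2 <= m)%N.
  by move=> p /leibniz_size h; exact: leq_trans h sm.
elim: (leibniz r s) => [|p l IH] H; first by rewrite !big_nil.
rewrite !big_cons lerD//; last by apply: IH => p' h; apply: H; right.
rewrite (lsnZ sE _ sq); last exact: (ders_mem sE oV).
by rewrite ler_wpM2l// HM// H//; left.
Qed.

End Leibniz.

End SeminormsOfDerivatives.

(** * The spaces of smooth functions and of test functions *)

Section FunctionSpaces.
Variables (R : realType) (n : nat).
Local Notation Rn := 'rV[R]_n.
Local Notation C := (Rcomplex R).
Local Notation LC := (lcs_norm C).
Local Notation LR := (lcs_norm R^o).
Local Notation smooth := (Cinfty (@dirn R n)).
Let sC := separated_lcs_norm C.
Let sR := separated_lcs_norm R^o.
Implicit Types (U V K L Omega : set Rn).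

Lemma extend0_in (W : zmodType) U (f : Rn -> W) x : U x -> extend0 U f x = f x.
Proof. by move=> Ux; rewrite /extend0 patchT// inE. Qed.

Lemma extend0_out (W : zmodType) U (f : Rn -> W) x : ~ U x -> extend0 U f x = 0.
Proof. by move=> Ux; rewrite /extend0 patchN// notin_setE. Qed.

Lemma extend0P (W : lmodType R) U (a : R) (f g : Rn -> W) :
  extend0 U (a *: f + g) = a *: extend0 U f + extend0 U g.
Proof.
apply/funext => x; rewrite [RHS](_ : _ = a *: extend0 U f x + extend0 U g x)//.
have [Ux|Ux] := pselect (U x); first by rewrite !extend0_in.
by rewrite !extend0_out// scaler0 addr0.
Qed.

Section CinfE.
Variables (E : lcs R) (sE : separated_lcs E) (U : set Rn) (oU : open U).

Lemma CinfE_memP (f : Rn -> E) : @lcs_mem R (CinfE U E) f <->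
  (forall x, ~ U x -> f x = 0) /\ smooth U f.
Proof. by split=> -[f0 sf]; split=> //; apply/(lsmooth_onP sE). Qed.

Lemma smooth_add (f g : Rn -> E) : smooth U f -> smooth U g -> smooth U (f + g).
Proof. by move=> sf sg; exact: (CinftyD sE oU sf sg). Qed.

Lemma smooth_scale (a : R) (f : Rn -> E) : smooth U f -> smooth U (a *: f).
Proof. by move=> sf; exact: (CinftyZ sE oU a sf). Qed.

Lemma smooth_extend0 (f : Rn -> E) : smooth U f -> smooth U (extend0 U f).
Proof. by apply: (Cinfty_eq_on oU) => x Ux; rewrite extend0_in. Qed.

Lemma CinfE_extend0 (f : Rn -> E) : smooth U f -> @lcs_mem R (CinfE U E) (extend0 U f).
Proof.
move=> sf; apply/CinfE_memP; split; last exact: smooth_extend0.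
by move=> x; exact: extend0_out.
Qed.

Lemma separated_CinfE : separated_lcs (CinfE U E).
Proof.
split.
- apply/CinfE_memP; split=> //.
  exact: (@Cinfty_cst _ _ _ (@dirn R n) E sE U 0 (lmem0 sE)).
- move=> a f g /CinfE_memP[f0 sf] /CinfE_memP[g0 sg]; apply/CinfE_memP; split.
    by move=> x Ux; rewrite !fctE f0// g0// scaler0 addr0.
  by apply: smooth_add => //; exact: smooth_scale.
- move=> p f g [K [m [q [cK KU sq ->]]]] /CinfE_memP[_ sf] /CinfE_memP[_ sg].
  exact: (snKD sE oU sq).
- move=> p a f [K [m [q [cK KU sq ->]]]] /CinfE_memP[_ sf].
  exact: (snKZ sE oU sq).
- move=> f /CinfE_memP[f0 sf] h; apply/funext => x.
  have [Ux|Ux] := pselect (U x); last exact: f0.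
  apply: (lsep sE); first exact: (Ck_mem (sf 0%N)).
  move=> q sq; apply/eqP; rewrite eq_le (lsn_ge0 sE sq (Ck_mem (sf 0%N) Ux)) andbT.
  have KU : [set x] `<=` U by move=> _ ->.
  have cK : compact [set x] by exact: compact_set1.
  have <- : snK [set x] 0 q f = 0.
    by apply: (h (snK [set x] 0 q)); exists [set x], 0%N, q; split.
  exact: (@snK_ub _ _ _ sE U oU q sq f [set x] 0 [::] x).
Qed.

End CinfE.

(** On smooth functions, the derivatives in the definitions of the seminorms of
    scalar functions are those of the vector-valued calculus. *)
Lemma seminorm_KE U K m (f : Rn -> C) : open U -> K `<=` U -> smooth (E := LC) U f ->
  seminorm_K K m f = snK (E := LC) K m Num.norm f.
Proof.
move=> oU KU sf; congr sup; apply/seteqP; split=> r [x [a [Kx am ->]]]; exists x, a; split=> //.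
  by rewrite /mpartial !mpow_foldr (partials_lpartials _ oU sf (KU _ Kx)).
by rewrite /mpartial !mpow_foldr (partials_lpartials _ oU sf (KU _ Kx)).
Qed.

Lemma Cinf_memP U (f : Rn -> C) : open U -> @lcs_mem R (Cinf U) f <->
  (forall x, ~ U x -> f x = 0) /\ smooth (E := LC) U f.
Proof. by move=> oU; split=> -[f0 sf]; split=> //; apply/smooth_onP. Qed.

Lemma separated_Cinf U : open U -> separated_lcs (Cinf U).
Proof.
move=> oU; have S := separated_CinfE sC oU; split.
- apply/(Cinf_memP _ oU); apply/(CinfE_memP sC oU); exact: (lmem0 S).
- move=> a f g /(Cinf_memP _ oU)/(CinfE_memP sC oU) mf /(Cinf_memP _ oU)/(CinfE_memP sC oU) mg.
  by apply/(Cinf_memP _ oU)/(CinfE_memP sC oU); exact: (lmemP S).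
- move=> p f g [K [m [cK KU ->]]] /(Cinf_memP _ oU)[_ sf] /(Cinf_memP _ oU)[_ sg].
  rewrite !(seminorm_KE _ oU KU)//; last exact: (smooth_add sC oU).
  exact: (snKD sC oU).
- move=> p a f [K [m [cK KU ->]]] /(Cinf_memP _ oU)[_ sf].
  rewrite !(seminorm_KE _ oU KU)//; last exact: (smooth_scale sC oU).
  exact: (snKZ sC oU).
- move=> f /(Cinf_memP _ oU) mf h; apply: (lsep S); first exact/(CinfE_memP sC oU).
  move=> p [K [m [q [cK KU -> ->]]]].
  by rewrite -[LHS]/(snK (E := LC) K m Num.norm f) -(seminorm_KE _ oU KU mf.2);
    apply: h; exists K, m; split.
Qed.

Lemma supp_out (f : Rn -> C) x : ~ supp f x -> f x = 0.
Proof.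
move=> sx; apply/eqP; apply: contrapT => /negP fx; apply: sx.
exact: subset_closure.
Qed.

Lemma supp_sub (f : Rn -> C) L : closed L -> (forall x, ~ L x -> f x = 0) -> supp f `<=` L.
Proof.
move=> cL fL; rewrite (closure_id L).1//; apply: closure_subset => x /= /eqP fx.
by apply: contrapT => /fL.
Qed.

Lemma closed_supp (f : Rn -> C) : closed (supp f).
Proof. exact: closed_closure. Qed.

Lemma Rn_compact_closed L : compact L -> closed L.
Proof. by apply: compact_closed; exact: norm_hausdorff. Qed.

Lemma testL_memP L (f : Rn -> C) : closed L -> @lcs_mem R (testL L) f <->
  (forall x, ~ L x -> f x = 0) /\ smooth (E := LC) setT f.
Proof.
move=> cL; split=> [[sf fL]|[fL sf]].
  split; last exact/(smooth_onP _ openT).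
  by move=> x Lx; apply: supp_out => /fL.
by split; [exact/(smooth_onP _ openT)|exact: supp_sub].
Qed.

Lemma separated_testL L : compact L -> separated_lcs (testL L).
Proof.
move=> cL; have clL := Rn_compact_closed cL; split.
- apply/(testL_memP _ clL); split=> //.
  exact: (@Cinfty_cst _ _ _ (@dirn R n) LC sC setT 0 (lmem0 sC)).
- move=> a f g /(testL_memP _ clL)[f0 sf] /(testL_memP _ clL)[g0 sg].
  apply/(testL_memP _ clL); split.
    by move=> x Lx; rewrite !fctE f0// g0// scaler0 addr0.
  by apply: (smooth_add sC openT) => //; exact: (smooth_scale sC openT).
- move=> p f g [m ->] /(testL_memP _ clL)[_ sf] /(testL_memP _ clL)[_ sg].
  rewrite !(seminorm_KE _ openT (@subsetT _ _))//; last exact: (smooth_add sC openT).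
  exact: (snKD sC openT).
- move=> p a f [m ->] /(testL_memP _ clL)[_ sf].
  rewrite !(seminorm_KE _ openT (@subsetT _ _))//; last exact: (smooth_scale sC openT).
  exact: (snKZ sC openT).
- move=> f /(testL_memP _ clL)[f0 sf] h; apply/funext => x.
  have [Lx|Lx] := pselect (L x); last exact: f0.
  apply/eqP; rewrite -normr_eq0 eq_le normr_ge0 andbT.
  have := h (seminorm_K L 0) (ex_intro _ 0%N erefl).
  rewrite (seminorm_KE _ openT (@subsetT _ _) sf) => <-.
  exact: (@snK_ub _ _ LC sC setT openT Num.norm erefl f L 0 [::] x).
Qed.

Lemma test_fun_testL Omega (f : Rn -> C) : test_fun Omega f ->
  @lcs_mem R (testL (supp f)) f.
Proof. by case=> sf cf fO; split. Qed.

Lemma testL_test_fun Omega L (f : Rn -> C) : compact L -> L `<=` Omega ->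
  @lcs_mem R (testL L) f -> test_fun Omega f.
Proof.
move=> cL LO [sf fL]; split=> //; last exact: (subset_trans fL LO).
exact: (subclosed_compact (@closed_supp f) cL fL).
Qed.

Lemma test_funP Omega (f : Rn -> C) : test_fun Omega f <->
  exists L, [/\ compact L, L `<=` Omega & @lcs_mem R (testL L) f].
Proof.
split=> [h|[L [cL LO]]]; last exact: testL_test_fun.
by exists (supp f); have [_ ? ?] := h; split=> //; exact: (test_fun_testL h).
Qed.

Lemma testL_subset L L' (f : Rn -> C) : L `<=` L' ->
  @lcs_mem R (testL L) f -> @lcs_mem R (testL L') f.
Proof. by move=> LL' [sf fL]; split=> //; exact: (subset_trans fL LL'). Qed.

(** Evaluations are continuous on every space of test functions with fixed
    support, and hence on their inductive limit; this makes the latter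
    Hausdorff. *)
Lemma test_eval_seminorm Omega (y : Rn) :
  @lcs_seminorm R (test Omega) (fun f : Rn -> C => `|f y|).
Proof.
split=> [f g _ _|r f _|K cK KO].
- by rewrite fctE; exact: ler_normD.
- by rewrite fctE normrZ.
- exists 1, 0%N => f /(testL_memP _ (Rn_compact_closed cK))[f0 sf]; rewrite mul1r.
  rewrite (seminorm_KE _ openT (@subsetT _ _) sf).
  have [Ky|Ky] := pselect (K y).
    exact: (@snK_ub _ _ LC sC setT openT Num.norm erefl f K 0 [::] y).
  rewrite f0// normr0; exact: (snK_ge0 sC openT).
Qed.

Lemma separated_test Omega : separated_lcs (@test R n Omega).
Proof.
split.
- apply/test_funP; exists set0; split=> //; first exact: compact0.
  exact: (lmem0 (separated_testL (@compact0 _))).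
- move=> a f g /test_funP[K [cK KO mf]] /test_funP[L [cL LO mg]].
  apply/test_funP; exists (K `|` L); split.
  + exact: compactU.
  + by move=> x [/KO|/LO].
  + apply: (lmemP (separated_testL (compactU cK cL))).
      exact: testL_subset (@subsetUl _ _ _) mf.
    exact: testL_subset (@subsetUr _ _ _) mg.
- by move=> q f g [qD _ _]; exact: qD.
- by move=> q a f [_ qZ _]; exact: qZ.
- move=> f mf h; apply/funext => y; apply/normr0_eq0.
  exact: (h _ (test_eval_seminorm Omega y)).
Qed.

Lemma test_eval_linear Omega (y : Rn) :
  continuous_linear (E := @test R n Omega) (F := LC) (fun f => f y).
Proof.
split=> // q ->; exists (fun f : Rn -> C => `|f y|), 1; split=> //.
  exact: test_eval_seminorm.
by move=> f _; rewrite mul1r.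
Qed.

Lemma testL_eval_linear L (y : Rn) : compact L ->
  continuous_linear (E := testL L) (F := LC) (fun f => f y).
Proof.
move=> cL; split=> // q ->; exists (seminorm_K L 0), 1; split=> //; first by exists 0%N.
move=> f /(testL_memP _ (Rn_compact_closed cL))[f0 sf]; rewrite mul1r.
rewrite (seminorm_KE _ openT (@subsetT _ _) sf).
have [Ly|Ly] := pselect (L y).
  exact: (@snK_ub _ _ LC sC setT openT Num.norm erefl f L 0 [::] y).
rewrite f0// normr0; exact: (snK_ge0 sC openT).
Qed.

Lemma testL_test_linear Omega L : compact L -> L `<=` Omega ->
  continuous_linear (E := testL L) (F := @test R n Omega) id.
Proof.
move=> cL LO; split=> // [f|q [_ _ /(_ L cL LO)[c [m qc]]]].
  exact: testL_test_fun.
exists (seminorm_K L m), `|c|; split=> //; first by exists m.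
move=> f mf; apply: le_trans (qc f mf) _; rewrite ler_wpM2r ?ler_norm//.
by apply: (lsn_ge0 (separated_testL cL)) => //; exists m.
Qed.

Lemma restrict_linear U V : open U -> open V -> V `<=` U ->
  continuous_linear (E := @Cinf R n U) (F := @Cinf R n V) (extend0 V).
Proof.
move=> oU oV VU; split.
- move=> f /(Cinf_memP _ oU)[_ sf]; apply/(Cinf_memP _ oV).
  apply/(CinfE_memP sC oV); apply: (CinfE_extend0 sC oV) => k; exact: Ck_subset (sf k).
- by move=> a f g _ _; exact: extend0P.
- move=> q [K [m [cK KV ->]]]; exists (seminorm_K K m), 1; split=> //.
    by exists K, m; split=> //; exact: (subset_trans KV VU).
  move=> f /(Cinf_memP _ oU)[_ sf]; rewrite mul1r.
  have sfV : smooth (E := LC) V f by move=> k; exact: Ck_subset (sf k).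
  rewrite !(seminorm_KE _ oV KV)//; last exact: (smooth_extend0 oV).
  rewrite (@snK_eq_on _ _ LC V K m Num.norm (extend0 V f) f oV KV)// => x Vx.
  exact: extend0_in.
Qed.

Lemma CinfE_restrict (E : lcs R) (sE : separated_lcs E) U V (f : Rn -> E) :
  open U -> open V -> V `<=` U ->
  @lcs_mem R (CinfE U E) f -> @lcs_mem R (CinfE V E) (extend0 V f).
Proof.
move=> oU oV VU /(CinfE_memP sE oU)[_ sf]; apply: (CinfE_extend0 sE oV) => k.
exact: Ck_subset (sf k).
Qed.

End FunctionSpaces.

(** * Directional derivatives and Lie derivatives *)

Section DirectionalDerivatives.
Variables (R : realType) (n : nat).
Local Notation Rn := 'rV[R]_n.
Local Notation C := (Rcomplex R).
Local Notation LC := (lcs_norm C).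
Local Notation LR := (lcs_norm R^o).
Local Notation smooth := (Cinfty (@dirn R n)).
Local Notation lder E := (lderive (@dirn R n) (E := E)).
Let sC := separated_lcs_norm C.
Let sR := separated_lcs_norm R^o.
Implicit Types (U V K L : set Rn).

Lemma coord_le_norm (x : Rn) i : `|x 0 i| <= `|x|.
Proof.
have /mapP[j Hj E] : `|x 0 i| \in [seq `|x y.1 y.2| | y : 'I_1 * 'I_n].
  by apply/mapP; exists (0, i) => //=; rewrite mem_enum.
by rewrite E [leRHS]/Num.norm /= mx_normrE; apply/bigmax_geP; right => /=; exists j.
Qed.

Lemma coord_linear i :
  continuous_linear (E := lcs_norm 'rV[R]_n) (F := LR) (fun x => x 0 i : R).
Proof.
split=> // [a x y _ _|q ->]; first by rewrite !mxE.
exists Num.norm, 1; split=> // x _; rewrite mul1r; exact: coord_le_norm.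
Qed.

Variables (Omega : set Rn) (X : Rn -> Rn).
Hypotheses (oO : open Omega) (sX : smooth_on Omega X).

Definition Xc i : Rn -> R := fun x => X x 0 i.

Lemma Xc_smooth i : smooth (E := LR) Omega (Xc i).
Proof.
exact: (Cinfty_clin (separated_lcs_norm _) oO sR (coord_linear i)
  ((smooth_onP X oO).1 sX)).
Qed.

Lemma divergence_smooth : smooth (E := LR) Omega (divergence X).
Proof.
have := @Cinfty_sum _ _ _ (@dirn R n) LR sR Omega oO _ (index_enum 'I_n) xpredT
  (fun i => lder LR i (Xc i)) (fun i _ => (Cinfty_deriv sR oO i (Xc_smooth i)).2).
apply: (Cinfty_eq_on oO) => x Ox; apply: eq_bigr => i _.
exact/esym/(partials_lpartials (W := R^o) [:: i] oO (Xc_smooth i) Ox).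
Qed.

Section Bounds.
Variables (r : Rn -> R) (rs : smooth (E := LR) Omega r).

Lemma snK_scale_bound K m : compact K -> K `<=` Omega -> exists c, 0 <= c /\
  forall (E : lcs R) (sE : separated_lcs E) U (u : Rn -> E) q, open U -> U `<=` Omega ->
    K `<=` U -> smooth U u -> lcs_seminorm q ->
    snK K m q (fun y => r y *: u y) <= c * snK K m q u.
Proof.
move=> cK KO; have [c [c0 HC]] := leibniz_bounded oO rs m cK KO.
exists c; split=> // E sE U u q oU UO KU ui sq.
have s0 := snK_ge0 sE oU sq m ui cK KU.
apply: snK_le; first exact: mulr_ge0.
move=> x s Kx sm.
apply: (ders_scale_le oO rs sE (V := U) (K := K) (m := m)) => //.
- exact: KU.
- by move=> s' x' s'm; apply: HC.
- by move=> s' s'm; exact: (snK_ub sE oU).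
Qed.

Lemma snK_lderive (E : lcs R) (sE : separated_lcs E) U K m i (u : Rn -> E) q :
  open U -> compact K -> K `<=` U -> smooth U u -> lcs_seminorm q ->
  snK K m q (lder E i u) <= snK K m.+1 q u.
Proof.
move=> oU cK KU ui sq; apply: snK_le; first exact: (snK_ge0 sE oU).
move=> x s Kx sm; have -> : ders (lder E i u) s x = ders u (rcons s i) x.
  by rewrite /ders foldr_rcons.
by apply: (snK_ub sE oU) => //; rewrite size_rcons.
Qed.

Lemma snK_scale_deriv_bound K m : compact K -> K `<=` Omega -> exists c, 0 <= c /\
  forall (E : lcs R) (sE : separated_lcs E) U (u : Rn -> E) q i, open U -> U `<=` Omega ->
    K `<=` U -> smooth U u -> lcs_seminorm q ->
    snK K m q (fun y => r y *: lder E i u y) <= c * snK K m.+1 q u.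
Proof.
move=> cK KO; have [c [c0 HC]] := snK_scale_bound m cK KO.
exists c; split=> // E sE U u q i oU UO KU ui sq.
apply: (le_trans (HC E sE U _ q oU UO KU (Cinfty_deriv sE oU i ui).2 sq)).
by rewrite ler_wpM2l// (snK_lderive sE _ _ oU).
Qed.

End Bounds.

Lemma smooth_sub (E : lcs R) U V (f : Rn -> E) : V `<=` U -> smooth U f -> smooth V f.
Proof. by move=> VU sf k; exact: Ck_subset (sf k). Qed.

Lemma dir_deriveE U (f : Rn -> C) x : open U -> smooth (E := LC) U f -> U x ->
  dir_derive X f x = \sum_i Xc i x *: lder LC i f x.
Proof.
move=> oU sf Ux; apply: eq_bigr => i _; congr (_ *: _).
exact: (partials_lpartials (W := C) [:: i] oU sf Ux).
Qed.

Lemma scale_deriv_smooth (E : lcs R) (sE : separated_lcs E) U (f : Rn -> E) i :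
  open U -> U `<=` Omega -> smooth U f ->
  smooth U (fun x => Xc i x *: lder E i f x).
Proof.
move=> oU UO sf; apply: (Cinfty_scale sE oU).
  exact: smooth_sub UO (Xc_smooth i).
exact: (Cinfty_deriv sE oU i sf).2.
Qed.

Lemma dir_derive_smooth U (f : Rn -> C) : open U -> U `<=` Omega ->
  smooth (E := LC) U f -> smooth (E := LC) U (dir_derive X f).
Proof.
move=> oU UO sf.
have := @Cinfty_sum _ _ _ (@dirn R n) LC sC U oU _ (index_enum 'I_n) xpredT
   (fun i x => Xc i x *: lder LC i f x) (fun i _ => scale_deriv_smooth sC i oU UO sf).
by apply: (Cinfty_eq_on oU) => x Ux; rewrite (dir_deriveE oU).
Qed.

(** The coefficients p.1 come from X alone. They are therefore the same for the
    derivation of scalar functions and for the transport term in DSK, which makes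
    the contributions of delta cancel later. *)
Lemma scale_deriv_ders (E : lcs R) (sE : separated_lcs E) U (f : Rn -> E) s x :
  open U -> U `<=` Omega -> smooth U f -> U x ->
  ders (fun y => \sum_i Xc i y *: lder E i f y) s x =
  \sum_i \sum_(p <- leibniz (Xc i) s) p.1 x *: ders f (rcons p.2 i) x.
Proof.
move=> oU UO sf Ux.
rewrite (ders_sum sE oU)// => [|i _]; last exact: scale_deriv_smooth.
apply: eq_bigr => i _.
rewrite (ders_scale oO (Xc_smooth i) sE s oU)//; last exact: (Cinfty_deriv sE oU i sf).2.
by apply: eq_bigr => p _; rewrite /ders foldr_rcons.
Qed.

Lemma dir_derive_ders U (f : Rn -> C) s x :
  open U -> U `<=` Omega -> smooth (E := LC) U f -> U x ->
  ders (E := LC) (dir_derive X f) s x =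
  \sum_i \sum_(p <- leibniz (Xc i) s) p.1 x *: ders (E := LC) f (rcons p.2 i) x.
Proof.
move=> oU UO sf Ux; rewrite -(scale_deriv_ders sC s oU)//.
by apply: (ders_eq_on _ oU) => // y Uy; rewrite (dir_deriveE oU).
Qed.

Lemma snK_sum_bound (E : lcs R) (sE : separated_lcs E) U K m q (f : 'I_n -> Rn -> E)
    (c : 'I_n -> R) (M : R) :
  open U -> compact K -> K `<=` U -> lcs_seminorm q -> (forall i, smooth U (f i)) ->
  (forall i, snK K m q (f i) <= c i * M) ->
  snK K m q (fun x => \sum_i f i x) <= (\sum_i c i) * M.
Proof.
move=> oU cK KU sq sf fM.
have s0 i : 0 <= c i * M by apply: le_trans (fM i); exact: (snK_ge0 sE oU).
rewrite mulr_suml; apply: snK_le; first exact: sumr_ge0.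
move=> x s Kx sm; rewrite (ders_sum sE oU)//; last exact: KU.
apply: (lsn_sum_le sE sq).
  by move=> i _; apply: (ders_mem sE oU) => //; exact: KU.
apply: ler_sum => i _; apply: le_trans (fM i); exact: (snK_ub sE oU).
Qed.

Lemma seminorm_K_dir_derive K m : compact K -> K `<=` Omega -> exists c, 0 <= c /\
  forall U (f : Rn -> C), open U -> U `<=` Omega -> K `<=` U -> smooth (E := LC) U f ->
    seminorm_K K m (dir_derive X f) <= c * seminorm_K K m.+1 f.
Proof.
move=> cK KO.
have [c cP] := choice (fun i => snK_scale_deriv_bound (Xc_smooth i) m cK KO).
exists (\sum_i c i); split; first by apply: sumr_ge0 => i _; case: (cP i).
move=> U f oU UO KU sf.
rewrite !(seminorm_KE _ oU KU)//; last exact: dir_derive_smooth.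
rewrite (@snK_eq_on _ _ LC U K m Num.norm _ (fun x => \sum_i Xc i x *: lder LC i f x) oU KU).
  apply: (snK_sum_bound sC oU) => // i; first exact: scale_deriv_smooth.
  by have [_ H] := cP i; exact: (H LC sC U f Num.norm i oU UO KU sf erefl).
by move=> x Ux; rewrite (dir_deriveE oU).
Qed.

Lemma seminorm_K_eq_on U K m (f g : Rn -> C) : open U -> K `<=` U ->
  smooth (E := LC) U f -> (forall x, U x -> f x = g x) ->
  seminorm_K K m f = seminorm_K K m g.
Proof.
move=> oU KU sf fg; have sg : smooth (E := LC) U g by exact: (Cinfty_eq_on (E := LC) oU fg sf).
rewrite (seminorm_KE _ oU KU sf) (seminorm_KE _ oU KU sg).
exact: (snK_eq_on (E := LC) _ _ oU).
Qed.

Lemma dir_derive_linear U : open U -> U `<=` Omega ->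
  continuous_linear (E := @Cinf R n U) (F := @Cinf R n U)
    (fun f => extend0 U (dir_derive X f)).
Proof.
move=> oU UO; split.
- move=> f /(Cinf_memP _ oU)[_ sf]; apply/(Cinf_memP _ oU).
  apply/(CinfE_memP sC oU); apply: (CinfE_extend0 sC oU); exact: dir_derive_smooth.
- move=> a f g /(Cinf_memP _ oU)[_ sf] /(Cinf_memP _ oU)[_ sg].
  rewrite -extend0P; apply/funext => x; rewrite /extend0 /patch.
  case: ifPn => // /set_mem Ux.
  rewrite (dir_deriveE oU (smooth_add sC oU (smooth_scale sC oU a sf) sg) Ux).
  rewrite [RHS](_ : _ = a *: dir_derive X f x + dir_derive X g x)//.
  rewrite !(dir_deriveE oU _ Ux)// scaler_sumr -big_split/=; apply: eq_bigr => i _.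
  have sf' := smooth_scale sC oU a sf.
  rewrite [X in _ *: X](dersD sC oU [:: i] sf' sg Ux) (dersZ sC oU a [:: i] sf Ux) /ders /=.
  by lmodule R.
- move=> q [K [m [cK KU ->]]].
  have [c [c0 HC]] := seminorm_K_dir_derive m cK (subset_trans KU UO).
  exists (seminorm_K K m.+1), c; split=> //; first by exists K, m.+1.
  move=> f /(Cinf_memP _ oU)[_ sf].
  rewrite -(seminorm_K_eq_on m oU KU (dir_derive_smooth oU UO sf)).
    exact: (HC U).
  by move=> x Ux; rewrite extend0_in.
Qed.

Lemma lderive_zero_off L (u : Rn -> C) i x : closed L -> (forall y, ~ L y -> u y = 0) -> ~ L x ->
  lder LC i u x = 0.
Proof.
move=> cL u0 Lx; have oL : open (~` L) by exact: closed_openC.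
rewrite (lderive_eq_on (E := LC) (@dirn R n) oL (g := fun=> 0) i u0 Lx).
exact: (has_deriv_derive sC (@has_deriv_cst R LC sC Rn 0 x (dirn R i) I)).
Qed.

(** Smoothness is local, and u vanishes on the complement of L, which is open
    and together with U covers everything. *)
Lemma smooth_zero_off U L (u : Rn -> C) : open U -> closed L -> L `<=` U ->
  smooth (E := LC) U u -> (forall x, ~ L x -> u x = 0) -> smooth (E := LC) setT u.
Proof.
move=> oU cL LU su u0; have oL : open (~` L) by exact: closed_openC.
apply/(smooth_onP _ openT) => s x _; have [Lx|Lx] := pselect (L x).
  exact: ((smooth_onP u oU).2 su s x (LU _ Lx)).
have s0 : smooth (E := LC) (~` L) u.
  have i0 := @Cinfty_cst _ _ _ (@dirn R n) LC sC (~` L) 0 (lmem0 sC).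
  by apply: (Cinfty_eq_on (E := LC) oL) i0 => y Ly; rewrite u0.
exact: ((smooth_onP u oL).2 s0 s x Lx).
Qed.

(** The Lie derivative along X of f regarded as an n-form. *)
Definition lie (f : Rn -> C) : Rn -> C :=
  fun y => dir_derive X f y + divergence X y *: f y.

Lemma lie_out (f : Rn -> C) L x : closed L -> (forall x, ~ L x -> f x = 0) ->
  ~ L x -> lie f x = 0.
Proof.
move=> cL f0 Lx; have oL : open (~` L) by exact: closed_openC.
have s0 : smooth (E := LC) (~` L) f.
  have i0 := @Cinfty_cst _ _ _ (@dirn R n) LC sC (~` L) 0 (lmem0 sC).
  by apply: (Cinfty_eq_on oL) i0 => y Ly; rewrite f0.
rewrite /lie f0// scaler0 addr0 (dir_deriveE oL s0 Lx) big1// => i _.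
by rewrite (lderive_zero_off i cL f0 Lx) scaler0.
Qed.

Lemma lie_smooth_on (f : Rn -> C) : smooth (E := LC) Omega f -> smooth (E := LC) Omega (lie f).
Proof.
move=> sf; apply: (CinftyD sC oO); first exact: dir_derive_smooth.
by apply: (Cinfty_scale sC oO) => //; exact: divergence_smooth.
Qed.

Lemma lie_testL L (f : Rn -> C) : compact L -> L `<=` Omega ->
  @lcs_mem R (testL L) f -> @lcs_mem R (testL L) (lie f).
Proof.
move=> cL LO; have clL := Rn_compact_closed cL.
move=> /(testL_memP _ clL)[f0 sf]; apply/(testL_memP _ clL).
have l0 x : ~ L x -> lie f x = 0 by exact: lie_out.
split=> //; apply: (smooth_zero_off oO clL LO) => //.
exact: lie_smooth_on (smooth_sub (@subsetT _ _) sf).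
Qed.

Lemma lieP (a : R) (f g : Rn -> C) : smooth (E := LC) setT f -> smooth (E := LC) setT g ->
  lie (a *: f + g) = a *: lie f + lie g.
Proof.
move=> sf sg; apply/funext => x.
have sf' := smooth_scale sC openT a sf.
rewrite [RHS](_ : _ = a *: lie f x + lie g x)// /lie.
rewrite (dir_deriveE openT (smooth_add sC openT sf' sg) I).
rewrite [(a *: f + g) x](_ : _ = a *: f x + g x)//.
rewrite !(dir_deriveE openT _ I)//.
have -> : \sum_i Xc i x *: lder LC i (a *: f + g) x =
  a *: (\sum_i Xc i x *: lder LC i f x) + \sum_i Xc i x *: lder LC i g x.
  rewrite scaler_sumr -big_split/=; apply: eq_bigr => i _.
  rewrite [X in _ *: X](dersD sC openT [:: i] sf' sg I) (dersZ sC openT a [:: i] sf I) /ders /=.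
  by lmodule R.
by lmodule R.
Qed.

Lemma seminorm_K_lie K m : compact K -> K `<=` Omega -> exists c, 0 <= c /\
  forall f : Rn -> C, smooth (E := LC) Omega f ->
    seminorm_K K m (lie f) <= c * seminorm_K K m.+1 f.
Proof.
move=> cK KO.
have [c1 [c10 H1]] := seminorm_K_dir_derive m cK KO.
have [c2 [c20 H2]] := snK_scale_bound divergence_smooth m cK KO.
exists (c1 + c2); split=> [|f sf]; first exact: addr_ge0.
have sd := dir_derive_smooth oO (@subset_refl _ _) sf.
have sv := Cinfty_scale sC oO divergence_smooth sf.
rewrite (seminorm_KE _ oO KO); last exact: lie_smooth_on.
apply: le_trans (snKD sC oO (q := Num.norm) erefl m sd sv cK KO) _.
rewrite mulrDl lerD//; first by rewrite -(seminorm_KE _ oO KO)//; exact: (H1 Omega).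
apply: le_trans (H2 LC sC Omega f Num.norm oO (@subset_refl _ _) KO sf erefl) _.
rewrite ler_wpM2l// (seminorm_KE _ oO KO)//.
apply: snK_le; first exact: (snK_ge0 sC oO).
by move=> x s Kx sm; apply: (snK_ub sC oO) => //; exact: leqW.
Qed.

Lemma lie_testL_linear L : compact L -> L `<=` Omega ->
  continuous_linear (E := testL L) (F := testL L) lie.
Proof.
move=> cL LO; have clL := Rn_compact_closed cL; split.
- by move=> f; exact: lie_testL.
- by move=> a f g /(testL_memP _ clL)[_ sf] /(testL_memP _ clL)[_ sg]; exact: lieP.
- move=> q [m ->]; have [c [c0 HC]] := seminorm_K_lie m cL LO.
  exists (seminorm_K L m.+1), c; split=> //; first by exists m.+1.
  move=> f /(testL_memP _ clL)[_ sf]; apply: HC; exact: smooth_sub (@subsetT _ _) sf.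
Qed.

(** The Lie derivative does not increase supports, and it is continuous on each
    space of test functions with fixed compact support. Its composite with a
    seminorm of the inductive limit is therefore again one. *)
Lemma lie_test_linear :
  continuous_linear (E := @test R n Omega) (F := @test R n Omega) lie.
Proof.
have mlie f : @test_fun R n Omega f -> test_fun Omega (lie f).
  move=> /test_funP[L [cL LO mf]]; apply/test_funP; exists L; split=> //.
  exact: lie_testL.
have slin (a : R) f g : @test_fun R n Omega f -> test_fun Omega g ->
    lie (a *: f + g) = a *: lie f + lie g.
  move=> [sf _ _] [sg _ _]; apply: lieP; exact/(smooth_onP _ openT).
split=> // q sq; have [qD qZ qK] := sq.
exists (q \o lie), 1; split=> // [|f _]; last by rewrite mul1r.
split=> [f g mf mg|a f mf|K cK KO] /=.
- have -> : lie (f + g) = lie f + lie g.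
    by have := slin 1 f g mf mg; rewrite !scale1r.
  by apply: qD; exact: mlie.
- have m0 : test_fun Omega (0 : Rn -> C) by exact: (lmem0 (separated_test Omega)).
  have lie0 : lie 0 = 0.
    have := slin 1 0 0 m0 m0; rewrite !scale1r addr0.
    by move/eqP; rewrite -subr_eq subrr => /eqP <-.
  have -> : lie (a *: f) = a *: lie f.
    by have := slin a f 0 mf m0; rewrite lie0 !addr0.
  by apply: qZ; exact: mlie.
- have [c [m Hc]] := qK K cK KO; have [c' [c'0 Hc']] := seminorm_K_lie m cK KO.
  exists (`|c| * c'), m.+1 => f mf.
  apply: le_trans (Hc _ (lie_testL cK KO mf)) _.
  have /(testL_memP _ (Rn_compact_closed cK))[_ sf] := mf.
  have sfO : smooth (E := LC) Omega f by exact: smooth_sub (@subsetT _ _) sf.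
  apply: (@le_trans _ _ (`|c| * seminorm_K K m (lie f))).
    rewrite ler_wpM2r ?ler_norm// (seminorm_KE _ oO KO); last exact: lie_smooth_on.
    by apply: (snK_ge0 sC oO) => //; exact: lie_smooth_on.
  by rewrite -mulrA ler_wpM2l// Hc'.
Qed.

End DirectionalDerivatives.

(** * The derivation of vector-valued test functions *)

Section TestFunctionValued.
Variables (R : realType) (n : nat).
Local Notation Rn := 'rV[R]_n.
Local Notation C := (Rcomplex R).
Local Notation LC := (lcs_norm C).
Local Notation LR := (lcs_norm R^o).
Local Notation smooth := (Cinfty (@dirn R n)).
Local Notation lder E := (lderive (@dirn R n) (E := E)).
Let sC := separated_lcs_norm C.
Let sR := separated_lcs_norm R^o.
Implicit Types (U V K L : set Rn).
Variables (Omega : set Rn) (X : Rn -> Rn).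
Hypotheses (oO : open Omega) (sX : smooth_on Omega X).

(* E is a space of test functions, on which evaluations and the Lie derivative
   are continuous *)
Section FunctionSpace.
Variables (mem : set (Rn -> C)) (sn : set ((Rn -> C) -> R)).
Let E : lcs R := @LCS R (Rn -> C) mem sn.
Hypothesis sE : separated_lcs E.
Hypothesis evE : forall y : Rn, continuous_linear (E := E) (F := LC) (fun f => f y).
Hypothesis lieE : continuous_linear (E := E) (F := E) (lie X).

Lemma partial_eval U (phi : Rn -> Rn -> C) i x y : open U ->
  smooth (E := E) U phi -> U x -> partial i (phi^~ y) x = lder E i phi x y.
Proof.
move=> oU sphi Ux.
have sy : smooth (E := LC) U (phi^~ y) := Cinfty_clin sE oU sC (evE y) sphi.
have := partials_lpartials (W := C) [:: i] oU sy Ux; rewrite /= => ->.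
exact: (lderive_clin sE oU sC [:: i] (evE y) sphi Ux).
Qed.

(** The sum of the transport term, a first-order operator in x with scalar
    coefficients, and of a continuous linear operator applied to the values. *)
Definition DSK_local (phi : Rn -> E) : Rn -> E :=
  fun x => (\sum_i Xc X i x *: lder E i phi x) + lie X (phi x).

(** Evaluation at y is linear and continuous, so that the pointwise partial
    derivatives in x are the values at y of those in the space of test
    functions. *)
Lemma DSK_localE U (phi : Rn -> Rn -> C) : open U -> smooth (E := E) U phi ->
  DSK U X phi = extend0 U (DSK_local phi).
Proof.
move=> oU sphi; apply/funext => x; have [Ux|Ux] := pselect (U x); last first.
  by rewrite /DSK !extend0_out.
rewrite /DSK !extend0_in//; apply/funext => y; rewrite -addrA.
rewrite [RHS](_ : _ = (\sum_i Xc X i x *: lder E i phi x : Rn -> C) y + lie X (phi x) y)//.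
congr (_ + _); rewrite fct_sumE; apply: eq_bigr => i _.
by rewrite (partial_eval _ _ oU).
Qed.

Lemma DSK_local_smooth U (phi : Rn -> E) : open U -> U `<=` Omega ->
  smooth U phi -> smooth U (DSK_local phi).
Proof.
move=> oU UO sphi; apply: (CinftyD sE oU).
  apply: (Cinfty_sum sE oU) => i _; exact: (scale_deriv_smooth oO sX sE i oU UO sphi).
exact: (Cinfty_clin sE oU sE lieE sphi).
Qed.

Lemma DSK_ders U (phi : Rn -> Rn -> C) s x : open U -> U `<=` Omega ->
  smooth (E := E) U phi -> U x ->
  ders (E := E) (DSK U X phi) s x =
  \sum_i \sum_(p <- leibniz (Xc X i) s) p.1 x *: ders (E := E) phi (rcons p.2 i) x
    + lie X (ders (E := E) phi s x).
Proof.
move=> oU UO sphi Ux; rewrite (DSK_localE oU sphi).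
rewrite (@ders_eq_on _ _ E U _ (DSK_local phi) s x oU)//; last first.
  by move=> z Uz; rewrite extend0_in.
rewrite (dersD sE oU); first last.
- exact: Ux.
- exact: (Cinfty_clin sE oU sE lieE sphi).
- by apply: (Cinfty_sum sE oU) => i _; exact: (scale_deriv_smooth oO sX sE i oU UO sphi).
congr (_ + _); first exact: (scale_deriv_ders oO sX sE s oU UO sphi Ux).
exact: (ders_clin sE sE s oU lieE sphi Ux).
Qed.

Lemma DSK_mem U (phi : Rn -> Rn -> C) : open U -> U `<=` Omega ->
  @lcs_mem R (CinfE U E) phi -> @lcs_mem R (CinfE U E) (DSK U X phi).
Proof.
move=> oU UO /(CinfE_memP sE oU)[_ sphi]; rewrite (DSK_localE oU sphi).
by apply: (CinfE_extend0 sE oU); exact: DSK_local_smooth.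
Qed.

Section SmoothLinear.
Variables (U : set Rn) (oU : open U) (UO : U `<=` Omega).

Lemma scale_deriv_linear i :
  continuous_linear (E := CinfE U E) (F := CinfE U E)
    (fun phi => extend0 U (fun x => Xc X i x *: lder E i phi x)).
Proof.
split.
- move=> phi /(CinfE_memP sE oU)[_ sphi]; apply: (CinfE_extend0 sE oU).
  exact: (scale_deriv_smooth oO sX sE i oU UO sphi).
- move=> a f g /(CinfE_memP sE oU)[_ sf] /(CinfE_memP sE oU)[_ sg].
  rewrite -extend0P; apply/funext => x.
  have [Ux|Ux] := pselect (U x); last by rewrite !extend0_out.
  rewrite !extend0_in//.
  rewrite [RHS](_ : _ = a *: (Xc X i x *: lder E i f x) + Xc X i x *: lder E i g x)//.
  have sf' := smooth_scale sE oU a sf.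
  have := dersD sE oU [:: i] sf' sg Ux; rewrite (dersZ sE oU a [:: i] sf Ux) /ders /=.
  rewrite -/(lderive (@dirn R n) i _ x) => D.
  rewrite [X in _ *: X](_ : _ = a *: lder E i f x + lder E i g x)//.
  by lmodule R.
- move=> p [K [m [q [cK KU sq ->]]]].
  have [c [c0 HC]] := snK_scale_deriv_bound oO (Xc_smooth oO sX i) m cK (subset_trans KU UO).
  exists (snK (E := E) K m.+1 q), c; split=> //; first by exists K, m.+1, q.
  move=> phi /(CinfE_memP sE oU)[_ sphi].
  apply: le_trans (HC E sE U phi q i oU UO KU sphi sq).
  rewrite -[X in X <= _]/(snK (E := E) K m q _).
  by rewrite (snK_eq_on (E := E) m q oU KU (g := fun x => Xc X i x *: lder E i phi x))// => x Ux;
    rewrite extend0_in.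
Qed.

Lemma pointwise_linear (M : E -> E) : continuous_linear M ->
  continuous_linear (E := CinfE U E) (F := CinfE U E)
    (fun phi => extend0 U (fun x => M (phi x))).
Proof.
move=> cM; split.
- move=> phi /(CinfE_memP sE oU)[_ sphi]; apply: (CinfE_extend0 sE oU).
  exact: (Cinfty_clin sE oU sE cM sphi).
- move=> a f g /(CinfE_memP sE oU)[_ sf] /(CinfE_memP sE oU)[_ sg].
  rewrite -extend0P; apply/funext => x.
  have [Ux|Ux] := pselect (U x); last by rewrite !extend0_out.
  rewrite !extend0_in//.
  exact: (clinP cM a (Ck_mem (sf 0%N) Ux) (Ck_mem (sg 0%N) Ux)).
- move=> p [K [m [q [cK KU sq ->]]]].
  have [q' [c [sq' c0 HC]]] := clin_bound cM sq.
  exists (snK (E := E) K m q'), c; split=> //; first by exists K, m, q'.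
  move=> phi /(CinfE_memP sE oU)[_ sphi].
  rewrite -[X in X <= _]/(snK (E := E) K m q _).
  rewrite (snK_eq_on (E := E) m q oU KU (g := M \o phi)); last first.
    by move=> x Ux; rewrite extend0_in.
  apply: snK_le; first by rewrite mulr_ge0// (snK_ge0 sE oU).
  move=> x s Kx sm; have Ux := KU _ Kx.
  rewrite (ders_clin sE sE s oU cM sphi Ux).
  apply: le_trans (HC _ (ders_mem sE oU s sphi Ux)) _.
  by rewrite ler_wpM2l// (snK_ub sE oU).
Qed.

(** A sum of continuous linear operators preserves smooth curves. *)
Lemma DSK_smooth_linear : smooth_linear (E := CinfE U E) (DSK U X).
Proof.
have sCE := separated_CinfE sE oU.
have DE phi : @lcs_mem R (CinfE U E) phi -> DSK U X phi =
    \sum_i extend0 U (fun x => Xc X i x *: lder E i phi x) +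
    extend0 U (fun x => lie X (phi x)).
  move=> /(CinfE_memP sE oU)[_ sphi]; rewrite (DSK_localE oU sphi).
  apply/funext => x.
  rewrite [RHS](_ : _ = (\sum_i extend0 U (fun x => Xc X i x *: lder E i phi x) : Rn -> (Rn -> C)) x
     + extend0 U (fun x => lie X (phi x)) x)// fct_sumE.
  have [Ux|Ux] := pselect (U x).
    by rewrite !extend0_in//; congr (_ + _); apply: eq_bigr => i _; rewrite extend0_in.
  by rewrite !extend0_out// addr0 big1// => i _; rewrite extend0_out.
split.
- by move=> phi; exact: DSK_mem.
- move=> a f g mf mg; rewrite !DE//; last exact: (lmemP sCE).
  rewrite (clinP (pointwise_linear lieE) a mf mg) /=.
  have -> : \sum_i extend0 U (fun x => Xc X i x *: lder E i (a *: f + g) x) =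
    a *: (\sum_i extend0 U (fun x => Xc X i x *: lder E i f x)) +
      \sum_i extend0 U (fun x => Xc X i x *: lder E i g x).
    rewrite scaler_sumr -big_split/=; apply: eq_bigr => i _.
    exact: (clinP (scale_deriv_linear i) a mf mg).
  have shuffle (A B D F : CinfE U E) :
      a *: A + B + (a *: D + F) = a *: (A + D) + (B + F) by lmodule R.
  exact: shuffle.
- move=> c cc.
  have := curveD sCE (@Cinfty_sum _ _ _ (@dir1 R) _ sCE setT openT _ (index_enum 'I_n) xpredT
     (fun i t => extend0 U (fun x => Xc X i x *: lder E i (c t) x))
     (fun i _ => Cinfty_clin sCE openT sCE (scale_deriv_linear i) cc))
     (Cinfty_clin sCE openT sCE (pointwise_linear lieE) cc).
  apply: (Cinfty_eq_on openT) => t _; rewrite /= DE//.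
  exact: (curve_mem (E := CinfE U E)).
Qed.

End SmoothLinear.

End FunctionSpace.

End TestFunctionValued.

(** * The two derivatives on the basic space *)

Section BasicSpace.
Variables (R : realType) (n : nat).
Local Notation Rn := 'rV[R]_n.
Local Notation C := (Rcomplex R).
Local Notation LC := (lcs_norm C).
Local Notation smooth := (Cinfty (@dirn R n)).
Local Notation lder E := (lderive (@dirn R n) (E := E)).
Let sC := separated_lcs_norm C.
Implicit Types (U V K L : set Rn) (F : Defs.family R n) (phi : Rn -> Rn -> C).
Variables (Omega : set Rn) (X : Rn -> Rn).
Hypotheses (oO : open Omega) (sX : smooth_on Omega X).
Local Notation D_Omega := (@test R n Omega).
Local Notation EU U := (CinfE U D_Omega).
Let sD := separated_test Omega.
Let evD := @test_eval_linear R n Omega.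
Let lieD := lie_test_linear oO sX.

Lemma DSK_test_smooth_linear U : open U -> U `<=` Omega ->
  smooth_linear (E := EU U) (DSK U X).
Proof. by move=> oU UO; exact: (DSK_smooth_linear oO sX sD evD lieD oU UO). Qed.

Lemma DSK_restrict U V phi : open U -> open V -> V `<=` U ->
  @lcs_mem R (EU U) phi -> DSK V X (extend0 V phi) = extend0 V (DSK U X phi).
Proof.
move=> oU oV VU mphi; have /(CinfE_memP sD oU)[_ sphi] := mphi.
have /(CinfE_memP sD oV)[_ sphiV] := CinfE_restrict sD oU oV VU mphi.
rewrite (DSK_localE X sD evD oU sphi) (DSK_localE X sD evD oV sphiV).
apply/funext => x; have [Vx|Vx] := pselect (V x); last by rewrite !extend0_out.
rewrite !extend0_in//; last exact: VU.
have ext y : V y -> extend0 V phi y = phi y by exact: extend0_in.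
have lderE i : lder D_Omega i (extend0 V phi) x = lder D_Omega i phi x.
  exact: (lderive_eq_on (E := D_Omega) (@dirn R n) oV i ext Vx).
have sumE : \sum_i Xc X i x *: lder D_Omega i (extend0 V phi) x =
    \sum_i Xc X i x *: lder D_Omega i phi x.
  by apply: eq_bigr => i _; rewrite lderE.
by rewrite /DSK_local sumE ext.
Qed.

Lemma dir_derive_eq_on U (f g : Rn -> C) x : open U -> smooth (E := LC) U f ->
  (forall x, U x -> f x = g x) -> U x -> dir_derive X f x = dir_derive X g x.
Proof.
move=> oU sf fg Ux; have sg : smooth (E := LC) U g := Cinfty_eq_on (E := LC) oU fg sf.
rewrite (dir_deriveE X oU sf Ux) (dir_deriveE X oU sg Ux); apply: eq_bigr => i _.
by rewrite (lderive_eq_on (E := LC) (@dirn R n) oU i fg Ux).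
Qed.

Section Family.
Variables (F : Defs.family R n) (bF : basic_space Omega F).

Lemma family_smooth U : open U -> U `<=` Omega ->
  convenient_smooth (E := EU U) (F := Cinf U) (F U).
Proof. by case: bF => h _; exact: (h U). Qed.

Lemma family_restrict U V phi : open U -> open V -> V `<=` U -> U `<=` Omega ->
  @lcs_mem R (EU U) phi -> extend0 V (F U phi) = F V (extend0 V phi).
Proof. by case: bF => _ h oU oV VU UO; exact: (h U V oU oV VU UO). Qed.

Lemma Dtilde_basic_space : basic_space Omega (Dtilde X F).
Proof.
split=> [U oU UO|U V oU oV VU UO phi mphi].
  exact: (convenient_smooth_clin (separated_CinfE sD oU) (separated_Cinf oU)
    (separated_Cinf oU) (dir_derive_linear oO sX oU UO) (family_smooth oU UO)).
rewrite /Dtilde -(family_restrict oU oV VU UO mphi).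
have [+ _] := family_smooth oU UO => /(_ _ mphi)/(Cinf_memP _ oU)[_ sFU].
apply/funext => x; have [Vx|Vx] := pselect (V x); last by rewrite !extend0_out.
rewrite !extend0_in//; last exact: VU.
apply: (dir_derive_eq_on oV (smooth_sub VU sFU) _ Vx) => y Vy.
by rewrite extend0_in.
Qed.

Lemma differential_restrict U V phi psi : open U -> open V -> V `<=` U ->
  U `<=` Omega -> @lcs_mem R (EU U) phi -> @lcs_mem R (EU U) psi ->
  extend0 V (diffn Omega F U phi [:: psi]) =
  diffn Omega F V (extend0 V phi) [:: extend0 V psi].
Proof.
move=> oU oV VU UO mphi mpsi; apply/esym; rewrite /diffn/=.
have sEU := separated_CinfE sD oU; have sEV := separated_CinfE sD oV.
have sFU := separated_Cinf oU; have sFV := separated_Cinf oV.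
have D := smooth_has_deriv sEU sFU (family_smooth oU UO) mphi mpsi.
apply: (has_deriv_derive sFV); apply/has_deriv_line.
have := (has_deriv_line (R := R) (F := Cinf V) _ _ _ _).2
  (has_deriv_clin sFU (restrict_linear oU oV VU) D).
apply: has_deriv_near; near=> h.
have m h' : @lcs_mem R (EU U) (phi + h' *: psi).
  by apply: (lmemD sEU) => //; exact: (lmemZ sEU).
rewrite /= (family_restrict oU oV VU UO (m _)); congr (F V _).
rewrite addrC extend0P addrC.
by [].
Unshelve. all: by end_near. Qed.

(** The differential along a linear map that preserves smooth curves is smooth,
    and differentiation commutes with the restrictions, which are continuous and
    linear. *)
Lemma Dhat_basic_space : basic_space Omega (Dhat Omega X F).
Proof.
have [smT rsT] := Dtilde_basic_space.
split=> [U oU UO|U V oU oV VU UO phi mphi].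
  have sEU := separated_CinfE sD oU; have sFU := separated_Cinf oU.
  have S1 := differential_along_smooth sEU sFU (DSK_test_smooth_linear oU UO)
    (family_smooth oU UO).
  have S2 := convenient_smooth_clin sEU sFU sFU (scale_continuous_linear sFU (-1)) S1.
  apply: (convenient_smooth_eq sEU sFU) (convenient_smoothD sEU sFU S2 (smT U oU UO)).
  by move=> phi mphi; rewrite /Dhat scaleN1r.
have mT := slin_mem (DSK_test_smooth_linear oU UO) mphi.
have := rsT U V oU oV VU UO phi mphi; rewrite /Dhat -/(Dtilde X F V (extend0 V phi)) => <-.
rewrite (DSK_restrict oU oV VU mphi) -(differential_restrict oU oV VU UO mphi mT).
by rewrite -scaleN1r extend0P scaleN1r.
Qed.

Section Differentials.
Variables (U : set Rn) (oU : open U) (UO : U `<=` Omega).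
Variables (phi : Rn -> Rn -> C) (s : seq (Rn -> Rn -> C)).
Hypotheses (mphi : @lcs_mem R (EU U) phi) (ms : all_mem (E := EU U) s).
Let sEU := separated_CinfE sD oU.
Let sFU := separated_Cinf oU.

Lemma diffn_mem r : all_mem (E := EU U) r ->
  @lcs_mem R (Cinf U) (diffn Omega F U phi r).
Proof. by move=> mr; exact: (lcs_diffn_mem sEU sFU (family_smooth oU UO)). Qed.

(** The derivation along X is linear and continuous, and so it commutes with
    differentials. *)
Lemma diffn_Dtilde : diffn Omega (Dtilde X F) U phi s =
  extend0 U (dir_derive X (diffn Omega F U phi s)).
Proof.
exact: (lcs_diffn_clin sEU sFU sFU (dir_derive_linear oO sX oU UO)
  (family_smooth oU UO) mphi ms).
Qed.

Lemma diffn_Dhat : diffn Omega (Dhat Omega X F) U phi s =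
  - (diffn Omega F U phi (rcons s (DSK U X phi)) +
     \sum_(r <- slots (DSK U X) s) diffn Omega F U phi r) +
  extend0 U (dir_derive X (diffn Omega F U phi s)).
Proof.
have lT := DSK_test_smooth_linear oU UO.
have sF := family_smooth oU UO.
have S1 := differential_along_smooth sEU sFU lT sF.
have cN := scale_continuous_linear sFU (-1).
have S2 := convenient_smooth_clin sEU sFU sFU cN S1.
have S3 := Dtilde_basic_space.1 U oU UO.
rewrite -diffn_Dtilde /diffn.
rewrite -[X in _ = - X + _](lcs_diffn_along sEU sFU lT sF mphi ms).
rewrite -scaleN1r -(lcs_diffn_clin sEU sFU sFU cN S1 mphi ms).
rewrite -(lcs_diffnD sEU sFU S2 S3 mphi ms).
apply: (lcs_diffn_eq_mem sEU (F := Cinf U) _ mphi ms) => psi mpsi.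
by rewrite /Dhat scaleN1r.
Qed.

(** The estimates of a derivative of order k of Dhat R reduce to those of
    derivatives of orders k and k + 1 of R, at arguments some of which are
    replaced by their images under DSK. *)
Lemma seminorm_Dhat_le K m : compact K -> K `<=` U ->
  seminorm_K K m (diffn Omega (Dhat Omega X F) U phi s) <=
  seminorm_K K m (diffn Omega F U phi (rcons s (DSK U X phi))) +
  \sum_(r <- slots (DSK U X) s) seminorm_K K m (diffn Omega F U phi r) +
  seminorm_K K m (diffn Omega (Dtilde X F) U phi s).
Proof.
move=> cK KU; have lT := DSK_test_smooth_linear oU UO.
have sq : @lcs_seminorm R (Cinf U) (seminorm_K K m) by exists K, m.
rewrite diffn_Dhat -diffn_Dtilde.
have m1 := diffn_mem (all_mem_rcons ms (slin_mem lT mphi)).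
have mslot := all_mem_slots lT ms.
have [m2 h2] : @lcs_mem R (Cinf U) (\sum_(r <- slots (DSK U X) s) diffn Omega F U phi r) /\
  seminorm_K K m (\sum_(r <- slots (DSK U X) s) diffn Omega F U phi r) <=
  \sum_(r <- slots (DSK U X) s) seminorm_K K m (diffn Omega F U phi r).
  elim: (slots (DSK U X) s) mslot => [|r l IH] mslot.
    by rewrite !big_nil; split; [exact: (lmem0 sFU)|rewrite (lsn0 sFU sq)].
  have [|ml hl] := IH; first by move=> r' h; apply: mslot; right.
  have mr := diffn_mem (mslot r (or_introl erefl)).
  rewrite !big_cons; split; first exact: (lmemD sFU mr ml).
  by apply: le_trans (lsnD sFU sq mr ml) _; rewrite lerD2l.
have m3 : @lcs_mem R (Cinf U) (diffn Omega (Dtilde X F) U phi s).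
  rewrite diffn_Dtilde; apply: (clin_mem (dir_derive_linear oO sX oU UO)).
  exact: diffn_mem.
have m12 := lmemD sFU m1 m2.
apply: le_trans (lsnD sFU sq (lmemN sFU m12) m3) _; rewrite lerD2r.
rewrite (lsnN sFU sq m12); apply: le_trans (lsnD sFU sq m1 m2) _.
by rewrite lerD2l.
Qed.

End Differentials.
End Family.

Lemma seminorm_Dtilde_le F (bF : basic_space Omega F) U K m : open U -> U `<=` Omega ->
  compact K -> K `<=` U -> exists c, 0 <= c /\
  forall phi s, @lcs_mem R (EU U) phi -> all_mem (E := EU U) s ->
  seminorm_K K m (diffn Omega (Dtilde X F) U phi s)
    <= c * seminorm_K K m.+1 (diffn Omega F U phi s).
Proof.
move=> oU UO cK KU.
have [c [c0 HC]] := seminorm_K_dir_derive oO sX m cK (subset_trans KU UO).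
exists c; split=> // phi s mphi ms; rewrite (diffn_Dtilde bF oU UO mphi ms).
have /(Cinf_memP _ oU)[_ sf] := diffn_mem bF oU UO mphi ms.
rewrite -(seminorm_K_eq_on m oU KU (dir_derive_smooth oO sX oU UO sf)).
  exact: (HC U).
by move=> x Ux; rewrite extend0_in.
Qed.

Lemma CinfE_testL_test U L phi : open U -> compact L -> L `<=` Omega ->
  @lcs_mem R (CinfE U (testL L)) phi -> @lcs_mem R (EU U) phi.
Proof.
move=> oU cL LO /(CinfE_memP (separated_testL cL) oU)[phi0 sphi].
apply/(CinfE_memP sD oU); split=> //.
exact: (Cinfty_clin (separated_testL cL) oU sD (testL_test_linear cL LO) sphi).
Qed.

End BasicSpace.

(** * The iterated integral of compactly supported functions *)

Section CompactlySupportedIntegral.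
Variable R : realType.
Local Notation LR := (lcs_norm R^o).
Let sR := separated_lcs_norm R^o.
Local Notation mu := (@lebesgue_measure R).

Section Line.
Variables (A : R) (A0 : 0 < A).

Lemma Rintegral_support (G : R -> R) : (forall t, A < `|t| -> G t = 0) ->
  \int[mu]_t G t = \int[mu]_(t in `[- A, A]) G t.
Proof.
move=> G0; rewrite [RHS]Rintegral_mkcond; congr (Rintegral _ _ _).
apply/funext => t; rewrite patchE; case: ifPn => // /negP tA.
by apply: G0; rewrite ltNge; apply/negP => h; apply: tA; rewrite inE/= in_itv/= -ler_norml.
Qed.

Lemma integrable_segment (G : R -> R) : continuous G ->
  mu.-integrable `[- A, A] (EFin \o G).
Proof.
move=> cG; apply: continuous_compact_integrable; first exact: segment_compact.
exact: continuous_subspaceT.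
Qed.

Lemma Rintegral_linear (a : R) (G H : R -> R) : continuous G -> continuous H ->
  (forall t, A < `|t| -> G t = 0) -> (forall t, A < `|t| -> H t = 0) ->
  \int[mu]_t (a * G t + H t) = a * \int[mu]_t G t + \int[mu]_t H t.
Proof.
move=> cG cH G0 H0; rewrite !Rintegral_support//; last first.
  by move=> t tA; rewrite G0// H0// mulr0 addr0.
have mA : measurable (`[- A, A]%classic : set (measurableTypeR R)) by exact: measurable_itv.
have caG : continuous (fun t => a * G t).
  by move=> t; apply: cvgM; [exact: cvg_cst|exact: cG].
rewrite RintegralD//; [|exact: integrable_segment|exact: integrable_segment].
by rewrite RintegralZl//; exact: integrable_segment.
Qed.

Lemma Rintegral_bound (G : R -> R) (M : R) : continuous G ->
  (forall t, A < `|t| -> G t = 0) -> (forall t, `|G t| <= M) ->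
  `|\int[mu]_t G t| <= M * (2 * A).
Proof.
move=> cG G0 GM; rewrite Rintegral_support//.
have mA : measurable (`[- A, A]%classic : set (measurableTypeR R)) by exact: measurable_itv.
apply: le_trans (le_normr_Rintegral mA (integrable_segment cG)) _.
apply: (@le_trans _ _ (\int[mu]_(t in `[- A, A]) (cst M t))).
  apply: le_Rintegral => //.
  - apply: integrable_segment => t; apply: cvg_norm; exact: cG.
  - by apply: integrable_segment => t; exact: cvg_cst.
have muA : mu `[- A, A]%classic = (2 * A)%:E.
  rewrite lebesgue_measure_itv/= lte_fin.
  have -> : - A < A by rewrite (lt_trans _ A0)// oppr_lt0.
  by rewrite -EFinD/= opprK -mulr2n mulr_natl.
by rewrite Rintegral_cst//= muA.
Qed.

Lemma Rintegral_derivative (G G' : R -> R) :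
  (forall t, has_deriv (E := LR) G (t : R^o) (1 : R^o) (G' t)) -> continuous G' ->
  (forall t, A < `|t| -> G t = 0) -> (forall t, A < `|t| -> G' t = 0) ->
  \int[mu]_t G' t = 0.
Proof.
move=> GG' cG' G0 G'0; pose B := A + 1.
have AB : A < B by rewrite ltrDl.
have B0 : 0 < B by exact: lt_trans AB.
have D (t : R) : is_derive t 1 G (G' t) by move: (GG' t) => /has_deriv_normP.
have cG (t : R) : {for t, continuous G}.
  by apply/differentiable_continuous/derivable1_diffP; case: (D t).
have -> : \int[mu]_t G' t = \int[mu]_(t in `[- B, B]) G' t.
  rewrite [RHS]Rintegral_mkcond; congr (Rintegral _ _ _).
  apply/funext => t; rewrite patchE; case: ifPn => // /negP tA.
  apply: G'0; rewrite ltNge; apply/negP => h; apply: tA.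
  by rewrite inE/= in_itv/= -ler_norml (le_trans h)// ltW.
rewrite /Rintegral (@continuous_FTC2 R G' G); last 4 first.
- by rewrite (lt_trans _ B0)// oppr_lt0.
- exact: continuous_subspaceT.
- split=> [t _| |]; first by case: (D t).
    by apply: cvg_at_right_filter; exact: cG.
  by apply: cvg_at_left_filter; exact: cG.
- by move=> t _; rewrite derive1E; exact: derive_val.
by rewrite !G0 ?normrN ?gtr0_norm//= subr0.
Qed.

End Line.

Definition rcons_row m (t : R) (y : 'rV[R]_m) : 'rV[R]_m.+1 :=
  row_mx (t%:M : 'rV_1) y.

Lemma rcons_row0 m t (y : 'rV[R]_m) : rcons_row t y 0 ord0 = t.
Proof.
have -> : (ord0 : 'I_m.+1) = lshift m (ord0 : 'I_1) by exact: val_inj.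
apply: etrans (row_mxEl (t%:M : 'rV_1) y 0 ord0) _.
by rewrite mxE eqxx mulr1n.
Qed.

Lemma rcons_rowS m t (y : 'rV[R]_m) j : rcons_row t y 0 (lift ord0 j) = y 0 j.
Proof.
have -> : (lift ord0 j : 'I_m.+1) = rshift 1 j by exact: val_inj.
exact: (row_mxEr (t%:M : 'rV_1) y 0 j).
Qed.

Lemma add_dirnE m (x : 'rV[R]_m) (s : R) i j :
  (x + s *: dirn R i) 0 j = x 0 j + s * (j == i)%:R.
Proof. by rewrite mxE; congr (_ + _); rewrite !mxE eqxx. Qed.

Lemma row_eqP m (x y : 'rV[R]_m.+1) : x 0 ord0 = y 0 ord0 ->
  (forall j, x 0 (lift ord0 j) = y 0 (lift ord0 j)) -> x = y.
Proof.
move=> h0 hS; apply/rowP => i; case: (unliftP ord0 i) => [j ->|->]; [exact: hS|exact: h0].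
Qed.

(** Uniformly continuous functions supported in a cube. With the cube and the
    uniformity expressed by coordinates, slices are again of this kind, with the
    same constants, as required by inductions on the dimension. *)
Definition box_supported n (A : R) (f : 'rV[R]_n -> R) :=
  forall (x : 'rV[R]_n) i, A < `|x 0 i| -> f x = 0.
Definition box_uniform n (f : 'rV[R]_n -> R) := forall e, 0 < e -> exists d, 0 < d /\
  forall x y : 'rV[R]_n, (forall i, `|x 0 i - y 0 i| < d) -> `|f x - f y| <= e.
Definition box_continuous n A (f : 'rV[R]_n -> R) := box_supported A f /\ box_uniform f.

Lemma box_continuous_slice m A (f : 'rV[R]_m.+1 -> R) t : box_continuous A f ->
  box_continuous A (fun y => f (rcons_row t y)).
Proof.
move=> [f0 fu]; split=> [x i xA|e e0].
  by apply: (f0 _ (lift ord0 i)); rewrite rcons_rowS.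
have [d [d0 dP]] := fu e e0; exists d; split=> // x y xy; apply: dP => i.
case: (unliftP ord0 i) => [j ->|->]; first by rewrite !rcons_rowS.
by rewrite !rcons_row0 subrr normr0.
Qed.

Lemma box_continuous_linear n A a (f g : 'rV[R]_n -> R) : box_continuous A f ->
  box_continuous A g -> box_continuous A (fun x => a * f x + g x).
Proof.
move=> [f0 fu] [g0 gu]; split=> [x i xA|e e0].
  by rewrite (f0 x i)// (g0 x i)// mulr0 addr0.
have e2 : 0 < e / 2 by rewrite divr_gt0.
have a1 : 0 < `|a| + 1 by rewrite ltr_wpDl.
have [d [d0 dP]] := fu (e / 2 / (`|a| + 1)) (divr_gt0 e2 a1).
have [d' [d'0 d'P]] := gu (e / 2) e2.
exists (Num.min d d'); split=> [|x y xy]; first by rewrite lt_min d0.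
have xy1 i : `|x 0 i - y 0 i| < d by move: (xy i); rewrite lt_min => /andP[].
have xy2 i : `|x 0 i - y 0 i| < d' by move: (xy i); rewrite lt_min => /andP[].
have -> : a * f x + g x - (a * f y + g y) = a * (f x - f y) + (g x - g y) by ring.
apply: le_trans (ler_normD _ _) _; rewrite normrM.
have h2 := d'P x y xy2; have := dP x y xy1; rewrite ler_pdivlMr// => h1.
have : `|a| * `|f x - f y| <= `|f x - f y| * (`|a| + 1).
  by rewrite mulrC ler_wpM2l// lerDl.
lra.
Qed.

Definition slice_integral m (f : 'rV[R]_m.+1 -> R) (t : R) : R :=
  integral_rV (fun y => f (rcons_row t y)).

Lemma integral_rVS m (f : 'rV[R]_m.+1 -> R) :
  integral_rV f = \int[mu]_t slice_integral f t.
Proof. by []. Qed.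

Definition integral_linear n := forall (A : R) a (f g : 'rV[R]_n -> R), 0 < A ->
  box_continuous A f -> box_continuous A g ->
  integral_rV (fun x => a * f x + g x) = a * integral_rV f + integral_rV g.
Definition integral_bound n := forall (A M : R) (f : 'rV[R]_n -> R), 0 < A -> 0 <= M ->
  box_continuous A f -> (forall x, `|f x| <= M) ->
  `|integral_rV f| <= M * (2 * A) ^+ n.

Section Slices.
Variables (m : nat) (linm : integral_linear m) (bm : integral_bound m).
Variables (A : R) (A0 : 0 < A).

Lemma slice_integral_bound (f : 'rV[R]_m.+1 -> R) M t : 0 <= M -> box_continuous A f ->
  (forall y, `|f (rcons_row t y)| <= M) ->
  `|slice_integral f t| <= M * (2 * A) ^+ m.
Proof. by move=> M0 fA fM; apply: bm => //; exact: box_continuous_slice. Qed.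

Lemma slice_integral_support (f : 'rV[R]_m.+1 -> R) t : box_continuous A f ->
  A < `|t| -> slice_integral f t = 0.
Proof.
move=> fA tA; apply/normr0_eq0/eqP; rewrite eq_le normr_ge0 andbT.
rewrite -(mul0r ((2 * A) ^+ m)); apply: slice_integral_bound => // y.
by have [f0 _] := fA; rewrite (f0 _ ord0) ?normr0// rcons_row0.
Qed.

Lemma slice_integral_sub (f : 'rV[R]_m.+1 -> R) M s t : 0 <= M -> box_continuous A f ->
  (forall y, `|f (rcons_row s y) - f (rcons_row t y)| <= M) ->
  `|slice_integral f s - slice_integral f t| <= M * (2 * A) ^+ m.
Proof.
move=> M0 fA fM; have fs := box_continuous_slice s fA; have ft := box_continuous_slice t fA.
have -> : slice_integral f s - slice_integral f t =
    integral_rV (fun y => (-1) * f (rcons_row t y) + f (rcons_row s y)).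
  by rewrite (linm (-1) A0 ft fs) mulN1r addrC.
apply: bm => //; first exact: box_continuous_linear.
by move=> y; rewrite mulN1r addrC.
Qed.

Lemma slice_integral_continuous (f : 'rV[R]_m.+1 -> R) : box_continuous A f ->
  continuous (slice_integral f).
Proof.
move=> fA t; apply/(@cvgrPdist_le R R^o R (nbhs t)) => e e0.
have p0 : 0 < (2 * A) ^+ m by rewrite exprn_gt0// mulr_gt0.
have [d [d0 dP]] := fA.2 (e / (2 * A) ^+ m) (divr_gt0 e0 p0).
exists d => //= s /= ts.
have -> : e = e / (2 * A) ^+ m * (2 * A) ^+ m by rewrite divfK// gt_eqF.
apply: slice_integral_sub => //; first by rewrite divr_ge0 ?ltW.
move=> y; apply: dP => i; case: (unliftP ord0 i) => [j ->|->].
  by rewrite !rcons_rowS subrr normr0.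
by rewrite !rcons_row0.
Qed.

End Slices.

(** Linearity and the bound are proved together: both are needed in dimension m
    to see that the integral over slices depends continuously on the slice. *)
Lemma integral_rV_linear_bound n : integral_linear n /\ integral_bound n.
Proof.
elim: n => [|m [linm bm]]; split.
- by [].
- by move=> A M f A0 M0 fA fM; rewrite /= expr0 mulr1.
- move=> A a f g A0 fA gA; rewrite !integral_rVS.
  rewrite -(@Rintegral_linear A); try exact: (slice_integral_continuous linm bm A0).
  + congr (Rintegral _ _ _); apply/funext => t.
    exact: (linm A a _ _ A0 (box_continuous_slice t fA) (box_continuous_slice t gA)).
  + by move=> t; exact: slice_integral_support.
  + by move=> t; exact: slice_integral_support.
- move=> A M f A0 M0 fA fM; rewrite integral_rVS.
  have -> : M * (2 * A) ^+ m.+1 = (M * (2 * A) ^+ m) * (2 * A) by rewrite exprS; ring.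
  apply: Rintegral_bound => //.
  + exact: (slice_integral_continuous linm bm A0).
  + by move=> t; exact: slice_integral_support.
  + by move=> t; exact: slice_integral_bound.
Qed.

Lemma integral_rV_linear n A a (f g : 'rV[R]_n -> R) : 0 < A ->
  box_continuous A f -> box_continuous A g ->
  integral_rV (fun x => a * f x + g x) = a * integral_rV f + integral_rV g.
Proof. exact: (integral_rV_linear_bound n).1. Qed.

Lemma integral_rV_bound n A M (f : 'rV[R]_n -> R) : 0 < A -> 0 <= M ->
  box_continuous A f -> (forall x, `|f x| <= M) ->
  `|integral_rV f| <= M * (2 * A) ^+ n.
Proof. exact: (integral_rV_linear_bound n).2. Qed.

(** Differentiation under the integral sign: by uniform continuity of the
    derivative, the remainder of the difference quotient is small uniformly in the
    slice, by the mean value inequality. *)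
Lemma slice_integral_deriv m A (u g : 'rV[R]_m.+1 -> R) : 0 < A ->
  box_continuous A u -> box_continuous A g ->
  (forall x, has_deriv (E := LR) u x (dirn R ord0) (g x)) ->
  forall t, has_deriv (E := LR) (slice_integral u) (t : R^o) (1 : R^o) (slice_integral g t).
Proof.
move=> A0 uA gA ug t.
have [linm bm] := integral_rV_linear_bound m.
split=> //; first by near=> h.
move=> q -> e e0.
have p0 : 0 < (2 * A) ^+ m by rewrite exprn_gt0// mulr_gt0.
have [d [d0 dP]] := gA.2 (e / (2 * A) ^+ m) (divr_gt0 e0 p0).
near=> h.
have hd : `|h| < d by near: h; exact: (@nbhs0_lt R R^o).
have -> : (t : R^o) + h *: (1 : R^o) = t + h by rewrite /GRing.scale/= mulr1.
have u1 := box_continuous_slice (t + h) uA; have u0 := box_continuous_slice t uA.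
have g0 := box_continuous_slice t gA.
have u10 := box_continuous_linear (-1) u0 u1.
have -> : slice_integral u (t + h) - slice_integral u t - h *: (slice_integral g t : R^o) =
  integral_rV (fun y => (- h) * g (rcons_row t y) +
     ((-1) * u (rcons_row t y) + u (rcons_row (t + h) y))).
  rewrite (linm A (- h) _ _ A0 g0 u10) (linm A (-1) _ _ A0 u0 u1).
  rewrite -/(slice_integral g t) -/(slice_integral u t) -/(slice_integral u (t + h)).
  by rewrite /GRing.scale/=; ring.
have -> : e * `|h| = e / (2 * A) ^+ m * `|h| * (2 * A) ^+ m.
  by rewrite mulrAC divfK// gt_eqF.
apply: bm => //.
- by rewrite mulr_ge0// divr_ge0 ?ltW.
- exact: box_continuous_linear.
move=> y.
have line (s : R) : rcons_row (t + s) y = rcons_row t y + s *: dirn R ord0.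
  apply: row_eqP => [|j]; rewrite add_dirnE; first by rewrite !rcons_row0 eqxx mulr1.
  by rewrite !rcons_rowS mulr0 addr0.
pose c (s : R^o) : LR := u (rcons_row t y + s *: dirn R ord0) + (- (s : R)) * g (rcons_row t y).
pose c' (s : R^o) : LR := g (rcons_row t y + s *: dirn R ord0) - g (rcons_row t y).
have cc' s : has_deriv c s (1 : R^o) (c' s).
  apply: (has_derivD sR).
    by apply: has_deriv_line_at; exact: ug.
  have := has_deriv_scale sR (has_deriv_affine 0 (-1) s)
    (@has_deriv_cst R LR sR R^o (g (rcons_row t y)) s (1 : R^o) I).
  rewrite scaler0 addr0 scaleN1r; apply: has_deriv_near; near=> k.
  by rewrite /GRing.scale/= add0r mulN1r.
have := @mean_value R LR sR Num.norm erefl c c' (e / (2 * A) ^+ m) 0 h cc'.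
have -> : - h * g (rcons_row t y) + (-1 * u (rcons_row t y) + u (rcons_row (t + h) y)) =
    c h - c 0.
  by rewrite /c line scale0r addr0 oppr0 mul0r addr0 mulN1r; ring.
rewrite subr0; apply=> s; rewrite subr0 => sh.
apply: dP => i; rewrite -line; case: (unliftP ord0 i) => [j ->|->].
  by rewrite !rcons_rowS subrr normr0.
by rewrite !rcons_row0 addrAC subrr add0r (le_lt_trans sh).
Unshelve. all: by end_near. Qed.

(** For the first variable, differentiate under the integral over the others and
    apply the fundamental theorem of calculus; for another one, the integral over
    each slice already vanishes. *)
Lemma integral_rV_partial n A (u g : 'rV[R]_n -> R) i : 0 < A ->
  box_continuous A u -> box_continuous A g ->
  (forall x, has_deriv (E := LR) u x (dirn R i) (g x)) -> integral_rV g = 0.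
Proof.
elim: n u g i => [|m IH] u g i A0 uA gA; first by case: i.
case: (unliftP ord0 i) => [j ->|->] ug.
  have [linm bm] := integral_rV_linear_bound m.
  rewrite integral_rVS.
  have -> : slice_integral g = fun=> 0.
    apply/funext => t; apply: (IH (fun y => u (rcons_row t y)) _ j A0).
    - exact: box_continuous_slice.
    - exact: box_continuous_slice.
    move=> y; apply/has_deriv_line.
    have := (has_deriv_line _ _ _ _).2 (ug (rcons_row t y)).
    apply: has_deriv_near; near=> h; apply: (f_equal u); apply: row_eqP => [|k].
      by rewrite add_dirnE !rcons_row0 mulr0 addr0.
    by rewrite add_dirnE !rcons_rowS add_dirnE (inj_eq lift_inj).
  by rewrite /Rintegral integral0.
have [linm bm] := integral_rV_linear_bound m.
rewrite integral_rVS; apply: (Rintegral_derivative A0 (G := slice_integral u)).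
- by move=> t; exact: (slice_integral_deriv A0).
- exact: (slice_integral_continuous linm bm A0).
- by move=> t; exact: slice_integral_support.
- by move=> t; exact: slice_integral_support.
Unshelve. all: by end_near. Qed.

End CompactlySupportedIntegral.

(** * The pairing with test functions and integration by parts *)

Section Pairing.
Variables (R : realType) (n : nat).
Local Notation Rn := 'rV[R]_n.
Local Notation C := (Rcomplex R).
Local Notation LC := (lcs_norm C).
Local Notation LR := (lcs_norm R^o).
Local Notation smooth := (Cinfty (@dirn R n)).
Local Notation lder E := (lderive (@dirn R n) (E := E)).
Let sC := separated_lcs_norm C.
Let sR := separated_lcs_norm R^o.
Implicit Types (U K L : set Rn) (f g u v psi : Rn -> C).

Lemma complex_norm_re (z : C) : `|complex.Re z| <= `|z|.
Proof.
case: z => a b; rewrite [X in _ <= X]/Num.norm/= -sqrtr_sqr ler_wsqrtr//.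
by rewrite lerDl sqr_ge0.
Qed.

Lemma complex_norm_im (z : C) : `|complex.Im z| <= `|z|.
Proof.
case: z => a b; rewrite [X in _ <= X]/Num.norm/= -sqrtr_sqr ler_wsqrtr//.
by rewrite lerDr sqr_ge0.
Qed.

Lemma complex_norm_le (z : C) : `|z| <= `|complex.Re z| + `|complex.Im z|.
Proof.
case: z => a b; rewrite [X in X <= _]/Num.norm/=.
rewrite -[X in _ <= X]ger0_norm ?addr_ge0// -sqrtr_sqr ler_wsqrtr//.
rewrite sqrrD !real_normK ?num_real// addrAC lerDl.
by rewrite mulrn_wge0// mulr_ge0.
Qed.

Lemma re_linear : continuous_linear (E := LC) (F := LR) (@complex.Re R).
Proof.
split=> // [a [x1 x2] [y1 y2]//|q ->].
exists Num.norm, 1; split=> // z _; rewrite mul1r; exact: complex_norm_re.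
Qed.

Lemma im_linear : continuous_linear (E := LC) (F := LR) (@complex.Im R).
Proof.
split=> // [a [x1 x2] [y1 y2]//|q ->].
exists Num.norm, 1; split=> // z _; rewrite mul1r; exact: complex_norm_im.
Qed.

Definition times_i (z : C) : C := Complex (- complex.Im z) (complex.Re z).

Lemma times_i_linear : continuous_linear (E := LC) (F := LC) times_i.
Proof.
split=> // [a [x1 x2] [y1 y2] _ _|q ->].
  by rewrite /times_i/= opprD -mulrN.
exists Num.norm, 1; split=> // -[a b] _; rewrite mul1r.
by rewrite /Num.norm/= sqrrN addrC.
Qed.

(** Products of complex numbers as real linear combinations, to which the rules
    for products with real scalars apply. *)
Lemma complex_mulE (z w : C) :
  z * w = complex.Re z *: w + complex.Im z *: times_i w :> C.
Proof.
case: z => a b; case: w => c d; rewrite /times_i/=.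
apply/eqP; rewrite eq_complex/=; apply/andP; split; apply/eqP; ring.
Qed.

(** The factor 2 comes from splitting z into its real and imaginary parts. *)
Lemma complex_norm_mul (z w : C) : `|z * w : C| <= 2 * `|z| * `|w|.
Proof.
rewrite complex_mulE; apply: le_trans (ler_normD _ _) _; rewrite !normrZ.
have wi : `|times_i w| = `|w|.
  by case: w => a b; rewrite /times_i /Num.norm/= sqrrN addrC.
rewrite wi -mulrDl ler_wpM2r//.
have := complex_norm_re z; have := complex_norm_im z; lra.
Qed.

Lemma has_deriv_mulC (T : lmodType R) (f g : T -> C) (x v : T) (l m : C) :
  has_deriv (E := LC) f x v l -> has_deriv (E := LC) g x v m ->
  has_deriv (E := LC) (fun y => f y * g y) x v (l * g x + f x * m).
Proof.
move=> fl gm.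
have D1 := has_deriv_scale sC (has_deriv_clin sC re_linear fl) gm.
have D2 := has_deriv_scale sC (has_deriv_clin sC im_linear fl)
  (has_deriv_clin sC times_i_linear gm).
have := has_derivD sC D1 D2; rewrite addrACA -!complex_mulE.
by apply: has_deriv_near; near=> h; rewrite complex_mulE.
Unshelve. all: by end_near. Qed.

Lemma smooth_mulC U f g : open U -> smooth (E := LC) U f -> smooth (E := LC) U g ->
  smooth (E := LC) U (fun x => f x * g x).
Proof.
move=> oU sf sg.
have S1 := Cinfty_scale sC oU (Cinfty_clin sC oU sR re_linear sf) sg.
have S2 := Cinfty_scale sC oU (Cinfty_clin sC oU sR im_linear sf)
  (Cinfty_clin sC oU sC times_i_linear sg).
have := CinftyD sC oU S1 S2; apply: (Cinfty_eq_on (E := LC) oU) => x _.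
by rewrite complex_mulE.
Qed.

Section Support.
Variables (L : set Rn) (cL : compact L).
Let clL := Rn_compact_closed cL.

Lemma compact_box : exists A, 0 < A /\ forall x i, L x -> `|x 0 i| <= A.
Proof.
have [x Lx|M HM] := @compact_locally_bounded R Rn L (fun x => `|x|) cL.
  exists (`|x| + 1); have : \forall y \near x, `|y - x| < 1.
    by apply/nbhs_ballP; exists 1 => //= y; rewrite -ball_normE/= distrC.
  apply: filterS => y yx; rewrite -(subrK x y).
  by apply: le_trans (ler_normD _ _) _; rewrite addrC lerD2l ltW.
exists (Num.max M 1); split=> [|x i Lx]; first by rewrite lt_max ltr01 orbT.
by rewrite le_max (le_trans (coord_le_norm x i))// HM.
Qed.

(** A fixed cube around L makes the bounds of integrals explicit in L. *)
Definition box_size : R := xget 1 [set A | 0 < A /\ forall x i, L x -> `|x 0 i| <= A].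

Lemma box_sizeP : 0 < box_size /\ forall x i, L x -> `|x 0 i| <= box_size.
Proof.
rewrite /box_size; case: xgetP => // none.
by have [A HA] := compact_box; case: (none A).
Qed.

Lemma compact_uniform (r : Rn -> R) : (forall x, ~ L x -> r x = 0) ->
  (forall x, lcs_continuous (E := LR) r x) -> box_uniform r.
Proof.
move=> r0 cr e e0; have e2 : 0 < e / 2 by rewrite divr_gt0.
have /compact_near_coveringP cK := cL.
have := cK R (0 : R)^'+ (fun d x => forall y, `|x - y| < d -> `|r x - r y| <= e) _.
case=> [x Lx|d /= d0 dP].
  have /nbhs_ballP[d /= d0 dP] := cr x _ erefl _ e2.
  have d2 : 0 < d / 2 by rewrite divr_gt0.
  exists (ball x (d / 2), [set t | t < d / 2]).
    split; first exact: nbhsx_ballx.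
    exact: nbhs_right_lt.
  move=> [x' t] [/= xx' td] y x'y.
  have hx : `|x - x'| < d / 2 by move: xx'; rewrite -ball_normE.
  have dd : d / 2 < d by rewrite ltr_pdivrMr// ltr_pMr// ltr1n.
  have h1 : `|r x' - r x| <= e / 2.
    by apply: dP; rewrite -ball_normE/=; exact: lt_trans dd.
  have h2 : `|r y - r x| <= e / 2.
    apply: dP; rewrite -ball_normE/= -(subrKA x').
    apply: le_lt_trans (ler_normD _ _) _.
    have -> : d = d / 2 + d / 2 by rewrite -splitr.
    by apply: ltrD => //; exact: lt_trans td.
  rewrite -(subrKA (r x)); apply: le_trans (ler_normD _ _) _.
  by rewrite (distrC (r x)); lra.
have d2 : 0 < d / 2 by rewrite divr_gt0.
have HL x : L x -> forall y, `|x - y| < d / 2 -> `|r x - r y| <= e.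
  apply: dP => //=; rewrite sub0r normrN gtr0_norm//.
  by rewrite ltr_pdivrMr// ltr_pMr// ltr1n.
exists (d / 2); split=> // x y xy.
have xy' : `|x - y| < d / 2.
  rewrite /Num.norm/= mx_normrE; apply/bigmax_ltP; split=> // -[i j] _ /=.
  by rewrite ord1 !mxE; exact: xy.
have [Lx|Lx] := pselect (L x); first exact: HL.
have [Ly|Ly] := pselect (L y); first by rewrite distrC; apply: HL; rewrite // distrC.
by rewrite !r0// subrr normr0 ltW.
Qed.

Lemma box_continuous_smooth (r : Rn -> R) : (forall x, ~ L x -> r x = 0) ->
  smooth (E := LR) setT r -> box_continuous box_size r.
Proof.
move=> r0 sr; split=> [x i xA|].
  apply: r0 => Lx; have := box_sizeP.2 x i Lx.
  by rewrite leNgt xA.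
by apply: compact_uniform => // x; exact: (Ck_cont (sr 0%N)).
Qed.

Definition supported_smooth u := (forall x, ~ L x -> u x = 0) /\ smooth (E := LC) setT u.

Lemma supported_re u : supported_smooth u -> box_continuous box_size (fun x => complex.Re (u x)).
Proof.
move=> [u0 su]; apply: box_continuous_smooth; first by move=> x /u0 ->.
exact: (Cinfty_clin sC openT sR re_linear su).
Qed.

Lemma supported_im u : supported_smooth u -> box_continuous box_size (fun x => complex.Im (u x)).
Proof.
move=> [u0 su]; apply: box_continuous_smooth; first by move=> x /u0 ->.
exact: (Cinfty_clin sC openT sR im_linear su).
Qed.

Lemma integral_rVC_linear (a : R) u v : supported_smooth u -> supported_smooth v ->
  integral_rVC (fun x => a *: u x + v x) = a *: integral_rVC u + integral_rVC v.
Proof.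
move=> su sv; have [A0 _] := box_sizeP.
have re x : complex.Re (a *: u x + v x) = a * complex.Re (u x) + complex.Re (v x).
  exact: (clinP re_linear).
have im x : complex.Im (a *: u x + v x) = a * complex.Im (u x) + complex.Im (v x).
  exact: (clinP im_linear).
rewrite /integral_rVC; under [X in integral_rV X]eq_fun do rewrite re.
under [X in Complex _ (integral_rV X)]eq_fun do rewrite im.
rewrite (integral_rV_linear a A0 (supported_re su) (supported_re sv)).
by rewrite (integral_rV_linear a A0 (supported_im su) (supported_im sv)).
Qed.

Lemma supported_smooth0 : supported_smooth (fun=> 0).
Proof. by split=> //; exact: (@Cinfty_cst _ _ _ (@dirn R n) LC sC setT 0 (lmem0 sC)). Qed.

Lemma supported_smooth_linear (a : R) u v : supported_smooth u -> supported_smooth v ->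
  supported_smooth (fun x => a *: u x + v x).
Proof.
move=> [u0 su] [v0 sv]; split=> [x Lx|]; first by rewrite u0// v0// scaler0 addr0.
exact: (CinftyD sC openT (CinftyZ sC openT a su) sv).
Qed.

Lemma integral_rVC_sum (I : Type) (l : seq I) (a : I -> R) (u : I -> Rn -> C) :
  (forall i, supported_smooth (u i)) ->
  supported_smooth (fun x => \sum_(i <- l) a i *: u i x) /\
  integral_rVC (fun x => \sum_(i <- l) a i *: u i x) = \sum_(i <- l) a i *: integral_rVC (u i).
Proof.
move=> su; elim: l => [|i l [IH1 IH2]].
  under eq_fun do rewrite big_nil.
  rewrite big_nil; split; first exact: supported_smooth0.
  have := integral_rVC_linear (-1) supported_smooth0 supported_smooth0.
  under eq_fun do rewrite scaler0 addr0.
  by rewrite scaleN1r addNr.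
under eq_fun do rewrite big_cons.
rewrite big_cons -IH2; split; first exact: supported_smooth_linear.
exact: integral_rVC_linear.
Qed.

Lemma integral_rVC_bound u M : 0 <= M -> supported_smooth u ->
  (forall x, `|u x| <= M) -> `|integral_rVC u| <= 2 * M * (2 * box_size) ^+ n.
Proof.
move=> M0 su uM; have [A0 _] := box_sizeP.
apply: le_trans (complex_norm_le _) _; rewrite /integral_rVC/=.
have h1 := integral_rV_bound A0 M0 (supported_re su)
  (fun x => le_trans (complex_norm_re _) (uM x)).
have h2 := integral_rV_bound A0 M0 (supported_im su)
  (fun x => le_trans (complex_norm_im _) (uM x)).
by rewrite -mulrA mulr2n mulrDl mul1r; exact: lerD.
Qed.

Lemma supported_smooth_deriv u i : supported_smooth u -> supported_smooth (lder LC i u).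
Proof.
move=> [u0 su]; split; last exact: (Cinfty_deriv sC openT i su).2.
by move=> x Lx; exact: (lderive_zero_off i clL u0 Lx).
Qed.

Lemma integral_rVC_partial u i : supported_smooth u -> integral_rVC (lder LC i u) = 0.
Proof.
move=> su; have [A0 _] := box_sizeP; have sdu := supported_smooth_deriv i su.
have D x : has_deriv (E := LC) u x (dirn R i) (lder LC i u x).
  exact: (Cinfty_deriv sC openT i su.2).1.
rewrite /integral_rVC.
rewrite (integral_rV_partial A0 (supported_re su) (supported_re sdu) (i := i)); last first.
  by move=> x; exact: (has_deriv_clin sC re_linear (D x)).
rewrite (integral_rV_partial A0 (supported_im su) (supported_im sdu) (i := i))//.
by move=> x; exact: (has_deriv_clin sC im_linear (D x)).
Qed.

Section Duality.
Variables (Omega : set Rn) (X : Rn -> Rn).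
Hypotheses (oO : open Omega) (sX : smooth_on Omega X) (LO : L `<=` Omega).
Variables (f : Rn -> C) (sf : smooth (E := LC) Omega f).

Definition pair f psi : C := integral_rVC (fun y => f y * psi y).

Lemma pair_supported psi : @lcs_mem R (testL L) psi ->
  supported_smooth (fun y => f y * psi y).
Proof.
move=> /(testL_memP _ clL)[psi0 spsi].
have z x : ~ L x -> f x * psi x = 0 by move=> /psi0 ->; rewrite mulr0.
split=> //; apply: (smooth_zero_off oO clL LO) => //.
by apply: smooth_mulC => //; exact: (smooth_sub (@subsetT _ _) spsi).
Qed.

Lemma pair_sum (I : Type) (l : seq I) (a : I -> R) (psi : I -> Rn -> C) :
  (forall i, @lcs_mem R (testL L) (psi i)) ->
  pair f (\sum_(i <- l) a i *: psi i) = \sum_(i <- l) a i *: pair f (psi i).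
Proof.
move=> mpsi; rewrite -(integral_rVC_sum l a (fun i => pair_supported (mpsi i))).2.
congr integral_rVC; apply/funext => y; rewrite fct_sumE mulr_sumr.
apply: eq_bigr => i _; rewrite [(a i *: psi i) y](_ : _ = a i *: psi i y)//.
by rewrite mulrC -scalerAl mulrC.
Qed.

Lemma pairD psi chi : @lcs_mem R (testL L) psi -> @lcs_mem R (testL L) chi ->
  pair f (psi + chi) = pair f psi + pair f chi.
Proof.
move=> mpsi mchi.
have := integral_rVC_linear 1 (pair_supported mpsi) (pair_supported mchi).
rewrite scale1r => <-; congr integral_rVC; apply/funext => y.
by rewrite scale1r -mulrDr.
Qed.

Lemma pair_bound psi (a b : R) : 0 <= a -> 0 <= b -> @lcs_mem R (testL L) psi ->
  (forall y, L y -> `|f y| <= a) -> (forall y, L y -> `|psi y| <= b) ->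
  `|pair f psi| <= 2 * (2 * a * b) * (2 * box_size) ^+ n.
Proof.
move=> a0 b0 mpsi fa psib; apply: integral_rVC_bound; first by rewrite !mulr_ge0.
  exact: pair_supported.
move=> y; have [Ly|Ly] := pselect (L y); last first.
  have /(testL_memP _ clL)[psi0 _] := mpsi.
  by rewrite psi0// mulr0 normr0 !mulr_ge0.
apply: le_trans (complex_norm_mul _ _) _; rewrite -!mulrA ler_wpM2l//.
by apply: ler_pM => //; [exact: fa|exact: psib].
Qed.

(** Integration by parts: the sum of the two integrands is the divergence of the
    compactly supported vector field f psi X. *)
Lemma pair_lie psi : @lcs_mem R (testL L) psi ->
  pair f (lie X psi) = - integral_rVC (fun y => dir_derive X f y * psi y).
Proof.
move=> mpsi; have /(testL_memP _ clL)[psi0 spsi] := mpsi.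
have spsiO : smooth (E := LC) Omega psi := smooth_sub (@subsetT _ _) spsi.
have mlie := lie_testL oO sX cL LO mpsi.
have s1 := pair_supported mlie.
have s2 : supported_smooth (fun y => dir_derive X f y * psi y).
  have z x : ~ L x -> dir_derive X f x * psi x = 0 by move=> /psi0 ->; rewrite mulr0.
  split=> //; apply: (smooth_zero_off oO clL LO) => //.
  by apply: smooth_mulC => //; exact: (dir_derive_smooth oO sX oO (@subset_refl _ _)).
have sfp := smooth_mulC oO sf spsiO.
pose u i : Rn -> C := fun y => Xc X i y *: (f y * psi y).
have su i : supported_smooth (u i).
  have z x : ~ L x -> u i x = 0 by rewrite /u => /psi0 ->; rewrite mulr0 scaler0.
  split=> //; apply: (smooth_zero_off oO clL LO) => //.
  exact: (Cinfty_scale sC oO (Xc_smooth oO sX i) sfp).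
have := integral_rVC_linear 1 s1 s2.
rewrite scale1r => /esym; rewrite -/(pair f (lie X psi)) => E.
apply/eqP; rewrite -subr_eq0 opprK E; apply/eqP.
have := (integral_rVC_sum (index_enum 'I_n) (fun=> 1)
  (fun i => supported_smooth_deriv i (su i))).2.
rewrite [X in _ = X -> _]big1 => [<-|i _]; last by rewrite integral_rVC_partial// scaler0.
congr integral_rVC; apply/funext => y.
have [Oy|Oy] := pselect (Omega y); last first.
  have Ly : ~ L y by move=> /LO.
  rewrite s1.1// s2.1// scaler0 addr0 big1// => i _.
  by rewrite (supported_smooth_deriv i (su i)).1// scaler0.
rewrite scale1r /lie.
have -> : divergence X y = \sum_i (lder LR i (Xc X i) y : R).
  apply: eq_bigr => i _.
  exact: (partials_lpartials (W := R^o) [:: i] oO (Xc_smooth oO sX i) Oy).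
rewrite (dir_deriveE X oO sf Oy) (dir_deriveE X oO spsiO Oy).
have D i : lder LC i (u i) y = (lder LR i (Xc X i) y : R) *: (f y * psi y) +
    Xc X i y *: (lder LC i f y * psi y + f y * lder LC i psi y).
  apply: (has_deriv_derive sC); apply: (has_deriv_scale sC).
    exact: (Cinfty_deriv sR oO i (Xc_smooth oO sX i)).1.
  apply: has_deriv_mulC; first exact: (Cinfty_deriv sC oO i sf).1.
  exact: (Cinfty_deriv sC oO i spsiO).1.
under [RHS]eq_bigr do rewrite scale1r D.
rewrite scaler_suml mulrDr !mulr_sumr mulr_suml -!big_split/=; apply: eq_bigr => i _.
rewrite scalerDr -!scalerAl ![f y * (_ *: _)]mulrC -!scalerAl ![_ * f y]mulrC.
by rewrite -[LHS]addrA [LHS]addrC -[LHS]addrA.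
Qed.

End Duality.
End Support.
End Pairing.

(** * Estimates for the derivation of vector-valued test functions *)

Section BoundedSets.
Variables (R : realType) (E F : lcs R).

Lemma lcs_boundedU (A B : set E) : lcs_bounded A -> lcs_bounded B -> lcs_bounded (A `|` B).
Proof.
move=> [mA bA] [mB bB]; split=> [f [/mA|/mB]//|q sq].
have [a ha] := bA q sq; have [b hb] := bB q sq.
exists (Num.max a b) => f [/ha|/hb] h; rewrite le_max h//; exact: orbT.
Qed.

Lemma lcs_bounded_image (L : E -> F) (B : set E) : continuous_linear L ->
  lcs_bounded B -> lcs_bounded (L @` B).
Proof.
move=> cL [mB bB]; split=> [_ [f Bf <-]|q sq]; first exact: (clin_mem cL (mB _ Bf)).
have [p [c [sp c0 H]]] := clin_bound cL sq; have [b hb] := bB p sp.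
exists (c * b) => _ [f Bf <-].
by apply: le_trans (H f (mB _ Bf)) _; rewrite ler_wpM2l// hb.
Qed.

End BoundedSets.

Section Gauges.
Variables (R : realType) (n : nat).
Local Notation Rn := 'rV[R]_n.
Local Notation C := (Rcomplex R).
Local Notation LC := (lcs_norm C).
Local Notation smooth := (Cinfty (@dirn R n)).
Let sC := separated_lcs_norm C.
Implicit Types (B : set (Rn -> C)) (phi : Rn -> Rn -> C) (s : seq 'I_n) (f : Rn -> C).
Variables (Omega : set Rn) (X : Rn -> Rn).
Hypotheses (oO : open Omega) (sX : smooth_on Omega X).
Variables (U K L : set Rn).
Hypotheses (oU : open U) (UO : U `<=` Omega).
Hypotheses (cK : compact K) (KU : K `<=` U) (cL : compact L) (LO : L `<=` Omega).
Local Notation TL := (@testL R n L).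
Local Notation EL := (@CinfE R n U TL).
Let clL := Rn_compact_closed cL.
Let sT : separated_lcs TL := separated_testL cL.
Let KO : K `<=` Omega := subset_trans KU UO.

Lemma CinfE_testL_smooth phi : @lcs_mem R EL phi -> smooth (E := TL) U phi.
Proof. by move=> /(CinfE_memP sT oU)[]. Qed.

Lemma CinfE_testL_val phi x : @lcs_mem R EL phi -> @lcs_mem R TL (phi x).
Proof.
move=> /(CinfE_memP sT oU)[phi0 sphi]; have [Ux|Ux] := pselect (U x).
  exact: (Ck_mem (sphi 0%N) Ux).
by rewrite phi0//; exact: (lmem0 sT).
Qed.

Lemma ders_testL_mem phi s x : @lcs_mem R EL phi -> U x ->
  @lcs_mem R TL (ders (E := TL) phi s x).
Proof. by move=> /CinfE_testL_smooth sphi Ux; exact: (ders_mem sT oU s sphi Ux). Qed.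

Lemma ders_eval_linear t y : L y ->
  continuous_linear (E := TL) (F := LC) (fun psi => ders (E := LC) psi t y).
Proof.
move=> Ly; split=> // [a f g /(testL_memP _ clL)[_ sf] /(testL_memP _ clL)[_ sg]|q ->].
  have sf' := smooth_scale sC openT a sf.
  by rewrite [LHS](dersD sC openT t sf' sg I) (dersZ sC openT a t sf I).
exists (seminorm_K L (size t)), 1; split=> //; first by exists (size t).
move=> f /(testL_memP _ clL)[_ sf]; rewrite mul1r (seminorm_KE _ openT (@subsetT _ _) sf).
exact: (snK_ub sC openT (q := Num.norm) erefl sf cL (@subsetT _ _) Ly).
Qed.

Lemma mixed_ders phi a b x y : @lcs_mem R EL phi -> U x -> L y ->
  mpartial a (fun x' => mpartial b (phi x') y) x =
  ders (E := LC) (ders (E := TL) phi (mseq a) x) (mseq b) y.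
Proof.
move=> mphi Ux Ly; have sphi := CinfE_testL_smooth mphi.
pose ev (psi : TL) : LC := ders (E := LC) psi (mseq b) y.
have -> : (fun x' => mpartial b (phi x') y) = (ev \o phi).
  apply/funext => x'; rewrite /mpartial mpow_foldr.
  have /(testL_memP _ clL)[_ sx'] := CinfE_testL_val x' mphi.
  exact: (partials_lpartials (W := C) _ openT sx' I).
have cev : continuous_linear ev := ders_eval_linear (mseq b) Ly.
have sev : smooth (E := LC) U (ev \o phi) := Cinfty_clin sT oU sC cev sphi.
rewrite /mpartial mpow_foldr (partials_lpartials (W := C) _ oU sev Ux).
exact: (lderive_clin sT oU sC (mseq a) cev sphi Ux).
Qed.

Lemma testL_seminorm l : @lcs_seminorm R TL (seminorm_K L l).
Proof. by exists l. Qed.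

(** The mixed derivatives are values of derivatives in y of derivatives in x, as
    the former are linear and continuous on the space of test functions. So the
    seminorm is one of those of smooth functions with values in that space, and
    the general estimates apply. *)
Lemma seminorm_KLE phi c l : @lcs_mem R EL phi ->
  seminorm_KL K c L l phi = snK (E := TL) K c (seminorm_K L l) phi.
Proof.
move=> mphi; have sphi := CinfE_testL_smooth mphi; have sq := testL_seminorm l.
have val_ub psi t y : @lcs_mem R TL psi -> L y -> (size t <= l)%N ->
    `|ders (E := LC) psi t y| <= seminorm_K L l psi.
  move=> /(testL_memP _ clL)[_ spsi] Ly tl.
  rewrite (seminorm_KE _ openT (@subsetT _ _) spsi).
  exact: (snK_ub sC openT (q := Num.norm) erefl spsi cL (@subsetT _ _) Ly).
have ub r : (exists x a y b, [/\ K x, (mlen a <= c)%N, L y, (mlen b <= l)%N &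
    r = `|mpartial a (fun x' => mpartial b (phi x') y) x|]) ->
    0 <= r <= snK (E := TL) K c (seminorm_K L l) phi.
  move=> [x [a [y [b [Kx ac Ly bl ->]]]]]; rewrite normr_ge0/= (mixed_ders a b mphi (KU Kx) Ly).
  apply: le_trans (val_ub _ _ _ (ders_testL_mem _ mphi (KU Kx)) Ly _) _.
    by rewrite size_mseq.
  by apply: (snK_ub sT oU sq sphi cK KU Kx); rewrite size_mseq.
have hub : has_ubound [set r | exists x a y b, [/\ K x, (mlen a <= c)%N, L y, (mlen b <= l)%N &
    r = `|mpartial a (fun x' => mpartial b (phi x') y) x|]].
  by exists (snK (E := TL) K c (seminorm_K L l) phi) => r /ub/andP[].
have KL0 : 0 <= seminorm_KL K c L l phi.
  by apply: sup_nneg_ge0 hub _ => r /ub/andP[].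
apply/eqP; rewrite eq_le; apply/andP; split.
  apply: sup_le_nneg; first exact: (snK_ge0 sT oU sq c sphi cK KU).
  by move=> r /ub/andP[].
apply: snK_le => // x s Kx sc; have Ux := KU Kx.
have mpsi := ders_testL_mem s mphi Ux; have /(testL_memP _ clL)[_ spsi] := mpsi.
rewrite (seminorm_KE _ openT (@subsetT _ _) spsi); apply: snK_le => // y t Ly tl.
have tE : ders (E := LC) (ders (E := TL) phi s x) t y =
    ders (E := LC) (ders (E := TL) phi s x) (mseq (mcount t)) y.
  exact: (lderives_perm sC openT spsi I (mseq_mcount t)).
have sE : ders (E := TL) phi s x = ders (E := TL) phi (mseq (mcount s)) x.
  exact: (lderives_perm sT oU sphi Ux (mseq_mcount s)).
rewrite tE sE; apply: (ub_le_sup hub); exists x, (mcount s), y, (mcount t).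
by rewrite !mlen_mcount (mixed_ders _ _ mphi Ux Ly).
Qed.

Lemma seminorm_KL_ge0 phi c l : @lcs_mem R EL phi -> 0 <= seminorm_KL K c L l phi.
Proof.
move=> mphi; rewrite seminorm_KLE//.
exact: (snK_ge0 sT oU (testL_seminorm l) c (CinfE_testL_smooth mphi) cK KU).
Qed.

Lemma seminorm_KL_ders phi c l s x : @lcs_mem R EL phi -> K x -> (size s <= c)%N ->
  seminorm_K L l (ders (E := TL) phi s x) <= seminorm_KL K c L l phi.
Proof.
move=> mphi Kx sc; rewrite seminorm_KLE//.
exact: (snK_ub sT oU (testL_seminorm l) (CinfE_testL_smooth mphi) cK KU Kx sc).
Qed.

Lemma testL_seminorm_mono psi l l' : (l <= l')%N -> @lcs_mem R TL psi ->
  seminorm_K L l psi <= seminorm_K L l' psi.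
Proof.
move=> ll' /(testL_memP _ clL)[_ spsi].
rewrite !(seminorm_KE _ openT (@subsetT _ _) spsi).
apply: snK_le; first exact: (snK_ge0 sC openT (q := Num.norm) erefl _ spsi cL (@subsetT _ _)).
move=> y t Ly tl; apply: (snK_ub sC openT (q := Num.norm) erefl spsi cL (@subsetT _ _) Ly).
exact: leq_trans ll'.
Qed.

Lemma seminorm_KL_mono phi c l c' l' : @lcs_mem R EL phi -> (c <= c')%N -> (l <= l')%N ->
  seminorm_KL K c L l phi <= seminorm_KL K c' L l' phi.
Proof.
move=> mphi cc' ll'; rewrite [X in X <= _]seminorm_KLE//.
apply: snK_le; first exact: seminorm_KL_ge0.
move=> x s Kx sc; apply: le_trans (testL_seminorm_mono ll' (ders_testL_mem s mphi (KU Kx))) _.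
by apply: seminorm_KL_ders => //; exact: leq_trans cc'.
Qed.

Lemma DSK_testL_mem phi : @lcs_mem R EL phi -> @lcs_mem R EL (DSK U X phi).
Proof.
exact: (DSK_mem oO sX sT (fun y => testL_eval_linear y cL) (lie_testL_linear oO sX cL LO) oU UO).
Qed.

Lemma DSK_testL_ders phi s x : @lcs_mem R EL phi -> U x ->
  ders (E := TL) (DSK U X phi) s x =
  \sum_i \sum_(p <- leibniz (Xc X i) s) p.1 x *: ders (E := TL) phi (rcons p.2 i) x
    + lie X (ders (E := TL) phi s x).
Proof.
move=> /CinfE_testL_smooth sphi Ux.
exact: (DSK_ders oO sX sT (fun y => testL_eval_linear y cL)
  (lie_testL_linear oO sX cL LO) s oU UO sphi Ux).
Qed.

(** The bound of the coefficients depends on X only, so that one constant serves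
    both the derivatives of phi and their pairings with functions. *)
Lemma leibniz_sum_bound c : exists a, 0 <= a /\
  forall (E : lcs R) (sE : separated_lcs E) (q : E -> R) (psi : seq 'I_n -> E) (M : R) s x,
    lcs_seminorm q -> K x -> (size s <= c)%N -> (forall t, lcs_mem (psi t)) -> 0 <= M ->
    (forall t, (size t <= c.+1)%N -> q (psi t) <= M) ->
    q (\sum_i \sum_(p <- leibniz (Xc X i) s) p.1 x *: psi (rcons p.2 i)) <= a * M.
Proof.
have [a aP] := choice (fun i => leibniz_bounded oO (Xc_smooth oO sX i) c cK KO).
exists (\sum_i a i); split; first by apply: sumr_ge0 => i _; case: (aP i).
move=> E sE q psi M s x sq Kx sc mpsi M0 psiM.
have mterm (p : (Rn -> R) * seq 'I_n) i : lcs_mem (p.1 x *: psi (rcons p.2 i)).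
  exact: (lmemZ sE).
apply: (lsn_sum_le sE sq) => [i _|]; first exact: (lmem_sum sE).
rewrite mulr_suml; apply: ler_sum => i _; apply: (lsn_sum_le sE sq) => // {mterm}.
apply: le_trans (ler_wpM2r M0 ((aP i).2 s sc x Kx)); rewrite mulr_suml.
have : forall p, List.In p (leibniz (Xc X i) s) -> (size p.2 <= c)%N.
  by move=> p /leibniz_size h; exact: leq_trans h sc.
elim: (leibniz (Xc X i) s) => [|p l IH] H; first by rewrite !big_nil.
rewrite !big_cons lerD//; last by apply: IH => p' h; apply: H; right.
rewrite (lsnZ sE _ sq)// ler_wpM2l// psiM// size_rcons ltnS; apply: H; by left.
Qed.

(** One more derivative in x, from the transport term, and one more in y, from the
    Lie derivative. *)
Lemma seminorm_KL_DSK c l : exists a, 0 <= a /\ forall phi, @lcs_mem R EL phi ->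
  seminorm_KL K c L l (DSK U X phi) <= a * seminorm_KL K c.+1 L l.+1 phi.
Proof.
have [a [a0 Ha]] := leibniz_sum_bound c; have [b [b0 Hb]] := seminorm_K_lie oO sX l cL LO.
exists (a + b); split=> [|phi mphi]; first exact: addr_ge0.
have sq := testL_seminorm l; have KL0 := seminorm_KL_ge0 c.+1 l.+1 mphi.
rewrite seminorm_KLE; last exact: DSK_testL_mem.
apply: snK_le; first by rewrite mulr_ge0// addr_ge0.
move=> x s Kx sc; have Ux := KU Kx; rewrite DSK_testL_ders//.
have mpsi t := ders_testL_mem t mphi Ux.
have m1 : @lcs_mem R TL (\sum_i \sum_(p <- leibniz (Xc X i) s)
    p.1 x *: ders (E := TL) phi (rcons p.2 i) x).
  by apply: (lmem_sum sT) => i _; apply: (lmem_sum sT) => p _; exact: (lmemZ sT).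
apply: le_trans (lsnD sT sq m1 (lie_testL oO sX cL LO (mpsi s))) _.
rewrite mulrDl lerD//.
  apply: (Ha TL sT _ (fun t => ders (E := TL) phi t x)) => // t tc.
  apply: le_trans (testL_seminorm_mono (leqnSn l) (mpsi t)) _.
  exact: seminorm_KL_ders.
have /(testL_memP _ clL)[_ spsi] := mpsi s.
apply: le_trans (Hb _ (smooth_sub (@subsetT _ _) spsi)) _.
by rewrite ler_wpM2l// seminorm_KL_ders// leqW.
Qed.

(** The common form of the two seminorms defined by pairings: e = 0 for those of
    phi itself, and e = 1 for those of the distance to delta. *)
Definition pairing_gauge (e : R) c B phi : R :=
  sup [set r | exists x a f, [/\ K x, (mlen a <= c)%N, B f &
    r = `|pairing f a phi x - e *: mpartial a f x|]].

Lemma seminorm_KBE c B phi : seminorm_KB K c B phi = pairing_gauge 0 c B phi.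
Proof.
congr sup; apply/seteqP; split=> r [x [a [f [Kx ac Bf ->]]]]; exists x, a, f; split=> //.
  by rewrite scale0r subr0.
by rewrite scale0r subr0.
Qed.

Lemma dist_delta_KBE c B phi : dist_delta_KB K c B phi = pairing_gauge 1 c B phi.
Proof.
congr sup; apply/seteqP; split=> r [x [a [f [Kx ac Bf ->]]]]; exists x, a, f; split=> //.
  by rewrite scale1r.
by rewrite scale1r.
Qed.

Local Notation bounded B := (@lcs_bounded R (@Cinf R n Omega) B).

Lemma bounded_smooth B f : bounded B -> B f -> smooth (E := LC) Omega f.
Proof. by move=> [mB _] /mB/(Cinf_memP _ oO)[]. Qed.

Lemma pairing_ders f a phi x : @lcs_mem R EL phi -> U x ->
  pairing f a phi x = pair f (ders (E := TL) phi (mseq a) x).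
Proof.
move=> /CinfE_testL_smooth sphi Ux; congr integral_rVC; apply/funext => y; congr (_ * _).
have cy := testL_eval_linear y cL.
have sy : smooth (E := LC) U (phi^~ y) := Cinfty_clin sT oU sC cy sphi.
rewrite /mpartial mpow_foldr (partials_lpartials (W := C) _ oU sy Ux).
exact: (lderive_clin sT oU sC (mseq a) cy sphi Ux).
Qed.

Lemma mpartial_ders f a x : smooth (E := LC) Omega f -> K x ->
  mpartial a f x = ders (E := LC) f (mseq a) x.
Proof.
move=> sf Kx; rewrite /mpartial mpow_foldr.
by rewrite (partials_lpartials (W := C) _ oO sf (KO Kx)).
Qed.

Section Gauge.
Variables (e : R) (B : set (Rn -> C)).
Hypothesis bB : bounded B.

Lemma pairing_gauge_has_ubound c phi : @lcs_mem R EL phi ->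
  has_ubound [set r | exists x a f, [/\ K x, (mlen a <= c)%N, B f &
    r = `|pairing f a phi x - e *: mpartial a f x|]].
Proof.
move=> mphi; have [_ bq] := bB.
have [a ha] := bq (seminorm_K L 0) (ex_intro _ L (ex_intro _ 0%N (And3 cL LO erefl))).
have [b hb] := bq (seminorm_K K c) (ex_intro _ K (ex_intro _ c (And3 cK KO erefl))).
pose M := snK (E := TL) K c (seminorm_K L 0) phi.
have sphi := CinfE_testL_smooth mphi; have sq := testL_seminorm 0.
have M0 : 0 <= M by exact: (snK_ge0 sT oU sq c sphi cK KU).
exists (2 * (2 * `|a| * M) * (2 * box_size L) ^+ n + `|e| * b) => r [x [i [f [Kx ic Bf ->]]]].
have sf := bounded_smooth bB Bf; have Ux := KU Kx.
rewrite (pairing_ders f i mphi Ux) (mpartial_ders i sf Kx).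
have mpsi := ders_testL_mem (mseq i) mphi Ux.
apply: le_trans (ler_normB _ _) _; apply: lerD.
  apply: (pair_bound cL oO LO sf) => // y Ly.
    apply: le_trans (ler_norm a); apply: le_trans (ha f Bf).
    rewrite (seminorm_KE _ oO LO sf).
    exact: (snK_ub sC oO (q := Num.norm) erefl (s := [::]) sf cL LO Ly).
  have /(testL_memP _ clL)[_ spsi] := mpsi.
  apply: (@le_trans _ _ (seminorm_K L 0 (ders (E := TL) phi (mseq i) x))).
    rewrite (seminorm_KE _ openT (@subsetT _ _) spsi).
    exact: (snK_ub sC openT (q := Num.norm) erefl (s := [::]) spsi cL (@subsetT _ _) Ly).
  by apply: (snK_ub sT oU sq sphi cK KU Kx); rewrite size_mseq.
rewrite normrZ ler_wpM2l//; apply: le_trans (hb f Bf).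
rewrite (seminorm_KE _ oO KO sf).
by apply: (snK_ub sC oO (q := Num.norm) erefl sf cK KO Kx); rewrite size_mseq.
Qed.

Lemma pairing_gauge_ge0 c phi : @lcs_mem R EL phi -> 0 <= pairing_gauge e c B phi.
Proof.
move=> mphi; apply: sup_nneg_ge0; first exact: pairing_gauge_has_ubound.
by move=> r [x [a [f [_ _ _ ->]]]].
Qed.

Lemma pairing_gauge_ub c phi f s x : @lcs_mem R EL phi -> K x -> B f -> (size s <= c)%N ->
  `|pair f (ders (E := TL) phi s x) - e *: ders (E := LC) f s x| <= pairing_gauge e c B phi.
Proof.
move=> mphi Kx Bf sc; have sf := bounded_smooth bB Bf; have Ux := KU Kx.
have sphi := CinfE_testL_smooth mphi.
have E1 : ders (E := LC) f s x = ders (E := LC) f (mseq (mcount s)) x.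
  exact: (lderives_perm sC oO sf (KO Kx) (mseq_mcount s)).
have E2 : ders (E := TL) phi s x = ders (E := TL) phi (mseq (mcount s)) x.
  exact: (lderives_perm sT oU sphi Ux (mseq_mcount s)).
rewrite E1 E2; apply: (ub_le_sup (pairing_gauge_has_ubound c mphi)).
exists x, (mcount s), f; split=> //; first by rewrite mlen_mcount.
by rewrite (pairing_ders f _ mphi Ux) (mpartial_ders _ sf Kx).
Qed.

Lemma pairing_gauge_le c phi M : @lcs_mem R EL phi -> 0 <= M ->
  (forall f s x, K x -> B f -> (size s <= c)%N ->
    `|pair f (ders (E := TL) phi s x) - e *: ders (E := LC) f s x| <= M) ->
  pairing_gauge e c B phi <= M.
Proof.
move=> mphi M0 H; apply: sup_le_nneg => // r [x [a [f [Kx ac Bf ->]]]].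
rewrite (pairing_ders f _ mphi (KU Kx)) (mpartial_ders _ (bounded_smooth bB Bf) Kx).
by apply: H => //; rewrite size_mseq.
Qed.

End Gauge.

Lemma pairing_gauge_mono e c c' A B phi : bounded A -> bounded B -> A `<=` B ->
  (c <= c')%N -> @lcs_mem R EL phi -> pairing_gauge e c A phi <= pairing_gauge e c' B phi.
Proof.
move=> bA bB AB cc' mphi; apply: (pairing_gauge_le bA mphi) => [|f s x Kx Af sc].
  exact: pairing_gauge_ge0.
by apply: (pairing_gauge_ub e bB mphi Kx (AB _ Af)); exact: leq_trans cc'.
Qed.

Definition DX_image B : set (Rn -> C) :=
  (fun f => extend0 Omega (dir_derive X f)) @` B.

Lemma DX_image_bounded B : bounded B -> bounded (DX_image B).
Proof. exact: (lcs_bounded_image (dir_derive_linear oO sX oO (@subset_refl _ _))). Qed.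

(** Integration by parts turns the pairing of f with the Lie derivative into minus
    that of D_X f, so that no derivative in y is lost and f only ranges over the
    larger bounded set. For phi = delta, the transport term gives the derivative
    of f along X, and the Lie derivative minus the same: multiples of delta may be
    subtracted for free, whence the arbitrary e. *)
Lemma seminorm_KB_DSK c : exists a, 0 <= a /\ forall e B phi, bounded B ->
  @lcs_mem R EL phi -> seminorm_KB K c B (DSK U X phi) <=
    a * pairing_gauge e c.+1 (B `|` DX_image B) phi.
Proof.
have [a [a0 Ha]] := leibniz_sum_bound c.
exists (a + 1); split=> [|e B phi bB mphi]; first exact: addr_ge0.
have bB' := lcs_boundedU bB (DX_image_bounded bB).
set M := pairing_gauge _ _ _ _; have M0 : 0 <= M by exact: pairing_gauge_ge0.
rewrite seminorm_KBE; apply: (pairing_gauge_le bB (DSK_testL_mem mphi)).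
  by rewrite mulr_ge0// addr_ge0.
move=> f s x Kx Bf sc; rewrite scale0r subr0.
have Ux := KU Kx; have Ox := KO Kx; have sf := bounded_smooth bB Bf.
have mpsi t := ders_testL_mem t mphi Ux.
rewrite (DSK_testL_ders s mphi Ux).
have m1 i : @lcs_mem R TL (\sum_(p <- leibniz (Xc X i) s)
    p.1 x *: ders (E := TL) phi (rcons p.2 i) x).
  by apply: (lmem_sum sT) => p _; exact: (lmemZ sT).
have mlie := lie_testL oO sX cL LO (mpsi s).
rewrite (pairD cL oO LO sf (lmem_sum sT (index_enum 'I_n) (P := xpredT) (fun i _ => m1 i)) mlie).
rewrite (pair_lie cL oO sX LO sf (mpsi s)).
set g := extend0 Omega (dir_derive X f).
have gE : integral_rVC (fun y => dir_derive X f y * ders (E := TL) phi s x y) =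
    pair g (ders (E := TL) phi s x).
  congr integral_rVC; apply/funext => y; have [Oy|Oy] := pselect (Omega y).
    by rewrite /g extend0_in.
  have /(testL_memP _ clL)[psi0 _] := mpsi s.
  by rewrite psi0 ?mulr0// => /LO.
have sumE : pair f (\sum_i \sum_(p <- leibniz (Xc X i) s)
      p.1 x *: ders (E := TL) phi (rcons p.2 i) x) =
    \sum_i \sum_(p <- leibniz (Xc X i) s) p.1 x *: pair f (ders (E := TL) phi (rcons p.2 i) x).
  have := pair_sum cL oO LO sf (index_enum 'I_n) (fun=> 1) m1.
  under eq_bigr do rewrite scale1r.
  move=> ->; apply: eq_bigr => i _; rewrite scale1r.
  by rewrite (pair_sum cL oO LO sf _ (fun p : (Rn -> R) * seq 'I_n => p.1 x)
    (psi := fun p => ders (E := TL) phi (rcons p.2 i) x))// => p; exact: mpsi.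
have dE : ders (E := LC) g s x = \sum_i \sum_(p <- leibniz (Xc X i) s)
     p.1 x *: ders (E := LC) f (rcons p.2 i) x.
  rewrite -(dir_derive_ders oO sX s oO (@subset_refl _ _) sf Ox).
  by apply: (ders_eq_on (E := LC) s oO) => // y Oy; rewrite /g extend0_in.
rewrite gE sumE.
pose psi t : LC := pair f (ders (E := TL) phi t x) - e *: ders (E := LC) f t x.
have -> : \sum_i \sum_(p <- leibniz (Xc X i) s) p.1 x *: pair f (ders (E := TL) phi (rcons p.2 i) x) -
    pair g (ders (E := TL) phi s x) =
    \sum_i \sum_(p <- leibniz (Xc X i) s) p.1 x *: psi (rcons p.2 i) -
    (pair g (ders (E := TL) phi s x) - e *: ders (E := LC) g s x).
  have -> : \sum_i \sum_(p <- leibniz (Xc X i) s) p.1 x *: psi (rcons p.2 i) =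
     \sum_i \sum_(p <- leibniz (Xc X i) s) p.1 x *: pair f (ders (E := TL) phi (rcons p.2 i) x)
     - e *: ders (E := LC) g s x.
    rewrite dE scaler_sumr -sumrB; apply: eq_bigr => i _.
    rewrite scaler_sumr -sumrB; apply: eq_bigr => p _.
    by rewrite scalerBr !scalerA [e * _]mulrC.
  by rewrite opprB addrA subrK.
apply: le_trans (ler_normB _ _) _; rewrite mulrDl mul1r; apply: lerD.
  apply: (Ha LC sC Num.norm psi) => // t tc.
  by apply: (pairing_gauge_ub e bB' mphi Kx _ tc); left.
apply: (pairing_gauge_ub e bB' mphi Kx); last exact: leqW.
by right; exists f.
Qed.

End Gauges.

(** * Polynomials with nonnegative coefficients *)

Section NonnegativePolynomials.
Variable R : realType.
Local Notation poly k := (mpoly.mpoly k R).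
Local Notation nneg := (@Num.Def.nneg_num_pred R).

Lemma nonneg_mpolyP k (p : poly k) :
  nonneg_mpoly p <-> p \is a mpoly.mpolyOver k nneg.
Proof. by split=> [h|/mpoly.mpolyOverP h e]; [apply/mpoly.mpolyOverP|exact: (h e)]. Qed.

Lemma nonneg_mpolyD k (p q : poly k) : nonneg_mpoly p -> nonneg_mpoly q -> nonneg_mpoly (p + q).
Proof. by move=> hp hq e; rewrite mpoly.mcoeffD addr_ge0. Qed.

Lemma nonneg_mpolyZ k (a : R) (p : poly k) : 0 <= a -> nonneg_mpoly p -> nonneg_mpoly (a *: p).
Proof. by move=> a0 hp e; rewrite mpoly.mcoeffZ mulr_ge0. Qed.

Lemma nonneg_mpolyX k m : nonneg_mpoly (mpoly.mpolyX R m : poly k).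
Proof. by move=> e; rewrite mpoly.mcoeffX ler0n. Qed.

Lemma nonneg_comp_mpoly k j (p : poly k) (t : k.-tuple (poly j)) : nonneg_mpoly p ->
  (forall i, nonneg_mpoly (tnth t i)) -> nonneg_mpoly (mpoly.comp_mpoly t p).
Proof.
move=> hp ht; apply/nonneg_mpolyP; rewrite mpoly.comp_mpolyE; apply: rpred_sum => m _.
apply: mpoly.mpolyOverZ; first exact: hp.
by apply: rpred_prod => i _; apply: rpredX; exact/nonneg_mpolyP.
Qed.

Lemma meval_mono k (p : poly k) v w : nonneg_mpoly p -> (forall i, 0 <= v i <= w i) ->
  mpoly.meval v p <= mpoly.meval w p.
Proof.
move=> hp vw; rewrite !mpoly.mevalE; apply: ler_sum => m _.
rewrite ler_wpM2l//; apply: ler_prod => i _; have /andP[v0 vwi] := vw i.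
by rewrite exprn_ge0//= lerXn2r// nnegrE// (le_trans v0).
Qed.

Lemma comp_mpolyA k j l (p : poly k) (t : k.-tuple (poly j)) (u : j.-tuple (poly l)) :
  mpoly.comp_mpoly u (mpoly.comp_mpoly t p) =
  mpoly.comp_mpoly [tuple mpoly.comp_mpoly u (tnth t i) | i < k] p.
Proof.
rewrite [mpoly.comp_mpoly t p]mpoly.comp_mpolyE [RHS]mpoly.comp_mpolyE raddf_sum/=.
apply: eq_bigr => m _; rewrite mpoly.comp_mpolyZ rmorph_prod/=; congr (_ *: _).
by apply: eq_bigr => i _; rewrite rmorphXn/= tnth_mktuple.
Qed.

Lemma comp_mpoly_tnth k j i (t : k.-tuple (poly j)) :
  mpoly.comp_mpoly t (mpoly.mpolyX R (mpoly.mnm1 i)) = tnth t i.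
Proof. by rewrite mpoly.comp_mpolyXU -tnth_nth. Qed.

Definition rescale k j (a : R) (sigma : 'I_k -> 'I_j) : k.-tuple (poly j) :=
  [tuple a *: mpoly.mpolyX R (mpoly.mnm1 (sigma i)) | i < k].

Lemma nonneg_rescale k j (a : R) (sigma : 'I_k -> 'I_j) (p : poly k) : 0 <= a ->
  nonneg_mpoly p -> nonneg_mpoly (mpoly.comp_mpoly (rescale a sigma) p).
Proof.
move=> a0 hp; apply: nonneg_comp_mpoly => // i; rewrite tnth_mktuple.
by apply: nonneg_mpolyZ => //; exact: nonneg_mpolyX.
Qed.

Lemma meval_rescale k j (a : R) (sigma : 'I_k -> 'I_j) (p : poly k) v w :
  nonneg_mpoly p -> (forall i, 0 <= v i <= a * w (sigma i)) ->
  mpoly.meval v p <= mpoly.meval w (mpoly.comp_mpoly (rescale a sigma) p).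
Proof.
move=> hp vw; rewrite mpoly.comp_mpoly_meval; apply: meval_mono => // i.
by rewrite tnth_mktuple mpoly.mevalZ mpoly.mevalXU.
Qed.

Lemma polyID k (p q : poly (k.+1 + k.+1)) : polyI p -> polyI q -> polyI (p + q).
Proof.
move=> [hp p0] [hq q0]; split; first exact: nonneg_mpolyD.
by rewrite mpoly.comp_mpolyD p0 q0 addr0.
Qed.

Lemma polyIZ k (a : R) (p : poly (k.+1 + k.+1)) : 0 <= a -> polyI p -> polyI (a *: p).
Proof.
move=> a0 [hp p0]; split; first exact: nonneg_mpolyZ.
by rewrite mpoly.comp_mpolyZ p0 scaler0.
Qed.

(** A renaming that respects the distinction of y- and z-variables. *)
Definition block_map k j (tau : 'I_k -> 'I_j) (i : 'I_(k + k)) : 'I_(j + j) :=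
  match fintype.split i with inl a => lshift j (tau a) | inr a => rshift j (tau a) end.

Lemma split_block_map k j (tau : 'I_k -> 'I_j) i :
  fintype.split (block_map tau i) =
  match fintype.split i with inl a => inl (tau a) | inr a => inr (tau a) end.
Proof.
rewrite /block_map; case: (fintype.split i) => a.
  exact: (unsplitK (inl (tau a))).
exact: (unsplitK (inr (tau a))).
Qed.

(** Setting the z-variables to zero commutes with such substitutions. *)
Lemma polyI_rescale k j (a : R) (tau : 'I_k.+1 -> 'I_j.+1) (p : poly (k.+1 + k.+1)) :
  0 <= a -> polyI p -> polyI (mpoly.comp_mpoly (rescale a (block_map tau)) p).
Proof.
move=> a0 [hp p0]; split; first exact: nonneg_rescale.
transitivity (mpoly.comp_mpoly (rescale a tau)
  (mpoly.comp_mpoly [tuple match fintype.split i with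
                             | inl j => mpoly.mpolyX R (mpoly.mnm1 j)
                             | inr _ => 0
                             end : poly k.+1 | i < k.+1 + k.+1] p)); last first.
  by rewrite p0 mpoly.comp_mpoly0.
rewrite !comp_mpolyA; congr (mpoly.comp_mpoly _ p); apply: eq_from_tnth => i.
rewrite !tnth_mktuple mpoly.comp_mpolyZ comp_mpoly_tnth tnth_mktuple split_block_map.
by case: (fintype.split i) => b; rewrite ?comp_mpoly_tnth ?tnth_mktuple// mpoly.comp_mpoly0 scaler0.
Qed.

End NonnegativePolynomials.

(** * Moderate and negligible estimates *)

Section Slots.

Lemma slots_map (A B : Type) (t : A -> A) (t' : B -> B) (h : A -> B) (P : pred A) (s : seq A) :
  (forall u, P u -> h (t u) = t' (h u)) -> all P s ->
  slots t' (map h s) = map (map h) (slots t s).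
Proof.
move=> ht; elim: s => //= u s IH /andP[Pu /IH ->].
by rewrite map_rcons ht// -!map_comp.
Qed.

Lemma all_slots (A : Type) (t : A -> A) (P : pred A) (s : seq A) :
  (forall u, P u -> P (t u)) -> all P s -> all (all P) (slots t s).
Proof.
move=> Pt; elim: s => //= u s IH /andP[Pu Ps]; rewrite all_rcons Pt// Ps/=.
rewrite all_map; apply: sub_all (IH Ps) => r /=; by rewrite Pu.
Qed.

End Slots.

Section Estimates.
Variables (R : realType) (n : nat).
Local Notation Rn := 'rV[R]_n.
Local Notation C := (Rcomplex R).
Variables (Omega : set Rn) (X : Rn -> Rn).
Hypotheses (oO : open Omega) (sX : smooth_on Omega X).
Variables (U K L : set Rn).
Hypotheses (oU : open U) (UO : U `<=` Omega).
Hypotheses (cK : compact K) (KU : K `<=` U) (cL : compact L) (LU : L `<=` U).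
Local Notation EL := (@CinfE R n U (@testL R n L)).
Local Notation ED := (@CinfE R n U (@test R n Omega)).
Local Notation functional k := (('I_k.+1 -> Rn -> Rn -> C) -> R).
Let LO : L `<=` Omega := subset_trans LU UO.
Implicit Types (F : Defs.family R n) (c l : nat) (B : set (Rn -> C)).

Definition all_testL k (phi : 'I_k.+1 -> Rn -> Rn -> C) := forall i, @lcs_mem R EL (phi i).

(** The arguments of the differentials to be estimated are entries of phi or their
    images under DSK. Describing them by an index and a mark separates the
    combinatorics from the functions. *)
Definition item k (phi : 'I_k.+1 -> Rn -> Rn -> C) (u : 'I_k.+1 * bool) : Rn -> Rn -> C :=
  if u.2 then DSK U X (phi u.1) else phi u.1.

(** Excludes the base point itself, which enters the estimates of negligible
    elements through its distance to delta and not through its pairings. Its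
    image under DSK may be an increment, as the image of delta is zero. *)
Definition increment k (u : 'I_k.+1 * bool) := (u.1 != ord0) || u.2.

Lemma item_mem k (phi : 'I_k.+1 -> Rn -> Rn -> C) u : all_testL phi ->
  @lcs_mem R EL (item phi u).
Proof.
move=> mphi; rewrite /item; case: u.2 => //.
exact: (DSK_testL_mem oO sX oU UO cL LO (mphi u.1)).
Qed.

(** What moderate and negligible estimates have in common. A functional A
    depends on a base point phi 0 and on increments phi 1, .., phi k; in the last
    condition, its arguments are replaced by items of another tuple, the base
    point being kept. *)
Record estimate_class (est : forall k, functional k -> Prop) : Prop := EstimateClass {
  est_le : forall k (A A' : functional k), (forall phi, all_testL phi -> A phi <= A' phi) ->
    est k A' -> est k A;
  estD : forall k (A A' : functional k), est k A -> est k A' ->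
    est k (fun phi => A phi + A' phi);
  estZ : forall k (a : R) (A : functional k), 0 <= a -> est k A -> est k (fun phi => a * A phi);
  est_item : forall j k (tau : 'I_j.+1 -> 'I_k.+1 * bool) (A : functional j),
    tau ord0 = (ord0, false) -> (forall i, i != ord0 -> increment (tau i)) ->
    est j A -> est k (fun phi => A (fun i => item phi (tau i))) }.

Section Derivations.
Variables (est : forall k, functional k -> Prop) (est_cl : estimate_class est).
Variables (F : Defs.family R n) (bF : basic_space Omega F).
Hypothesis estF : forall m k, est (fun phi : 'I_k.+1 -> _ => seminorm_K K m (diffn_at Omega F U phi)).

Definition directions k : seq ('I_k.+1 * bool) :=
  [seq (lift ord0 i, false) | i <- enum 'I_k].

Lemma map_directions k (phi : 'I_k.+1 -> Rn -> Rn -> C) :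
  [seq phi (lift ord0 i) | i <- enum 'I_k] = map (item phi) (directions k).
Proof. by rewrite /directions -[RHS]map_comp. Qed.

(** The list r fills the increments; its length is the order of differential to
    which the estimate of F applies. *)
Lemma est_word k m (r : seq ('I_k.+1 * bool)) : all (@increment k) r ->
  est (fun phi : 'I_k.+1 -> _ => seminorm_K K m (diffn Omega F U (phi ord0) (map (item phi) r))).
Proof.
move=> incr; pose d : 'I_k.+1 * bool := (ord0, false).
pose tau (i : 'I_(size r).+1) := nth d (d :: r) i.
have tau_incr i : i != ord0 -> increment (tau i).
  case: (unliftP ord0 i) => [j -> _|->]; last by rewrite eqxx.
  by rewrite /tau /=; exact: (all_nthP d incr _ (ltn_ord j)).
apply: (est_le est_cl) (est_item est_cl (erefl : tau ord0 = d) tau_incr (estF m (size r))).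
move=> phi _; rewrite /diffn_at.
have -> : [seq item phi (tau (lift ord0 i)) | i <- enum 'I_(size r)] = map (item phi) r.
  rewrite -[RHS](congr1 (map (item phi)) (mkseq_nth d r)) /mkseq -val_enum_ord -!map_comp.
  by apply: eq_map => i.
by [].
Qed.

Lemma est_words k m (l : seq (seq ('I_k.+1 * bool))) : all (all (@increment k)) l ->
  est (fun phi : 'I_k.+1 -> _ => \sum_(r <- l)
    seminorm_K K m (diffn Omega F U (phi ord0) (map (item phi) r))).
Proof.
elim: l => [_|r l IH /=/andP[ir /IH il]].
  apply: (est_le est_cl) (estZ est_cl (lexx 0) (estF m k)) => phi _.
  by rewrite big_nil mul0r.
apply: (est_le est_cl) (estD est_cl (est_word m ir) il) => phi _.
by rewrite big_cons.
Qed.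

Lemma testL_all_mem k (phi : 'I_k.+1 -> Rn -> Rn -> C) (s : seq 'I_k.+1) :
  all_testL phi -> all_mem (E := ED) (map phi s).
Proof.
move=> mphi; elim: s => //= i s IH; split=> //.
exact: (CinfE_testL_test oU cL LO (mphi i)).
Qed.

Lemma est_Dtilde m k : est (fun phi : 'I_k.+1 -> _ =>
  seminorm_K K m (diffn_at Omega (Dtilde X F) U phi)).
Proof.
have [a [a0 Ha]] := seminorm_Dtilde_le oO sX bF m oU UO cK KU.
apply: (est_le est_cl) (estZ est_cl a0 (estF m.+1 k)) => phi mphi.
apply: Ha; first exact: (CinfE_testL_test oU cL LO (mphi ord0)).
have := testL_all_mem (map (lift ord0) (enum 'I_k)) mphi.
by rewrite -map_comp.
Qed.

Lemma est_Dhat m k : est (fun phi : 'I_k.+1 -> _ =>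
  seminorm_K K m (diffn_at Omega (Dhat Omega X F) U phi)).
Proof.
pose t (u : 'I_k.+1 * bool) := (u.1, true).
have dir_incr : all (@increment k) (directions k).
  by rewrite all_map; apply/allP => i _.
have dir_plain : all (fun u => ~~ u.2) (directions k) by rewrite all_map; apply/allP => i _.
have i1 : all (@increment k) (rcons (directions k) (ord0, true)).
  by rewrite all_rcons dir_incr.
have i2 : all (all (@increment k)) (slots t (directions k)).
  by apply: all_slots dir_incr => u _; rewrite /increment orbT.
apply: (est_le est_cl) (estD est_cl (estD est_cl (est_word m i1) (est_words m i2))
  (est_Dtilde m k)) => phi mphi.
have m0 := CinfE_testL_test oU cL LO (mphi ord0).
have ms : all_mem (E := ED) [seq phi (lift ord0 i) | i <- enum 'I_k].
  by have := testL_all_mem (map (lift ord0) (enum 'I_k)) mphi; rewrite -map_comp.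
have := seminorm_Dhat_le oO sX bF oU UO m0 ms m cK KU.
have tE u : ~~ u.2 -> item phi (t u) = DSK U X (item phi u).
  by rewrite /item /t /=; case: u => i [].
rewrite {2 3}map_directions (slots_map tE dir_plain) big_map map_rcons /=.
by rewrite {1}[item phi (ord0, true)]/item.
Qed.

End Derivations.

Lemma seminorm_KL_item c l : exists a, 0 <= a /\ forall k (phi : 'I_k.+1 -> Rn -> Rn -> C) u,
  all_testL phi ->
  seminorm_KL K c L l (item phi u) <= a * seminorm_KL K c.+1 L l.+1 (phi u.1).
Proof.
have [a [a0 Ha]] := seminorm_KL_DSK oO sX oU UO cK KU cL LO c l.
exists (a + 1); split=> [|k phi u mphi]; first exact: addr_ge0.
have h0 := seminorm_KL_ge0 oU cK KU cL c.+1 l.+1 (mphi u.1).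
rewrite mulrDl mul1r /item; case: u.2.
  by apply: le_trans (Ha _ (mphi u.1)) _; rewrite lerDl.
apply: le_trans (seminorm_KL_mono oU cK KU cL (mphi u.1) (leqnSn c) (leqnSn l)) _.
by rewrite lerDr mulr_ge0.
Qed.

Definition moderate_estimate k (A : functional k) := exists c l (p : mpoly.mpoly k.+1 R),
  Defs.polyP p /\ forall phi, all_testL phi ->
    A phi <= mpoly.meval (fun i => seminorm_KL K c L l (phi i)) p.

Lemma moderate_estimate_class : estimate_class moderate_estimate.
Proof.
split.
- move=> k A A' AA' [c [l [p [hp H]]]]; exists c, l, p; split=> // phi mphi.
  exact: le_trans (AA' _ mphi) (H _ mphi).
- move=> k A A' [c [l [p [hp H]]]] [c' [l' [p' [hp' H']]]].
  exists (maxn c c'), (maxn l l'), (p + p'); split; first exact: nonneg_mpolyD.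
  move=> phi mphi; rewrite mpoly.mevalD; apply: lerD.
    apply: le_trans (H _ mphi) _; apply: meval_mono => // i.
    rewrite (seminorm_KL_ge0 oU cK KU cL _ _ (mphi i)).
    by rewrite (seminorm_KL_mono oU cK KU cL (mphi i)) ?leq_maxl.
  apply: le_trans (H' _ mphi) _; apply: meval_mono => // i.
  rewrite (seminorm_KL_ge0 oU cK KU cL _ _ (mphi i)).
  by rewrite (seminorm_KL_mono oU cK KU cL (mphi i)) ?leq_maxr.
- move=> k a A a0 [c [l [p [hp H]]]]; exists c, l, (a *: p).
  split; first exact: nonneg_mpolyZ.
  by move=> phi mphi; rewrite mpoly.mevalZ ler_wpM2l// H.
- move=> j k tau A tau0 tauS [c [l [p [hp H]]]].
  have [a [a0 Ha]] := seminorm_KL_item c l.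
  exists c.+1, l.+1, (mpoly.comp_mpoly (rescale a (fun i => (tau i).1)) p).
  split; first exact: nonneg_rescale.
  move=> phi mphi; have mitem i := item_mem (tau i) mphi.
  apply: le_trans (H _ mitem) _; apply: meval_rescale => // i.
  by rewrite (seminorm_KL_ge0 oU cK KU cL _ _ (mitem i)) Ha.
Qed.

Local Notation bounded B := (@lcs_bounded R (@Cinf R n Omega) B).

Definition weights k c l B (phi : 'I_k.+1 -> Rn -> Rn -> C) (i : 'I_(k.+1 + k.+1)) : R :=
  match fintype.split i with
  | inl j => seminorm_KL K c L l (phi j)
  | inr j => if j == ord0 then dist_delta_KB K c B (phi j) else seminorm_KB K c B (phi j)
  end.

Lemma distance_gauge k c B (phi : 'I_k.+1 -> Rn -> Rn -> C) j :
  (if j == ord0 then dist_delta_KB K c B (phi j) else seminorm_KB K c B (phi j)) =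
  pairing_gauge K (j == ord0)%:R c B (phi j).
Proof. by case: (j == ord0); rewrite ?dist_delta_KBE ?seminorm_KBE. Qed.

Lemma weights_ge0 k c l B (phi : 'I_k.+1 -> Rn -> Rn -> C) i : bounded B -> all_testL phi ->
  0 <= weights c l B phi i.
Proof.
move=> bB mphi; rewrite /weights; case: (fintype.split i) => j.
  exact: (seminorm_KL_ge0 oU cK KU cL).
by rewrite distance_gauge; exact: (pairing_gauge_ge0 oO oU UO cK KU cL LO).
Qed.

Lemma weights_mono k c l B c' l' B' (phi : 'I_k.+1 -> Rn -> Rn -> C) i :
  bounded B -> bounded B' -> B `<=` B' -> (c <= c')%N -> (l <= l')%N -> all_testL phi ->
  0 <= weights c l B phi i <= weights c' l' B' phi i.
Proof.
move=> bB bB' BB' cc' ll' mphi; rewrite weights_ge0//= /weights; case: (fintype.split i) => j.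
  exact: (seminorm_KL_mono oU cK KU cL).
by rewrite !distance_gauge; exact: (pairing_gauge_mono oO oU UO cK KU cL LO).
Qed.

(** An image under DSK is estimated by the distance to e delta of the entry that
    it comes from, where e = 1 for the base point and e = 0 for increments. *)
Lemma gauge_item c : exists a, 0 <= a /\ forall j k (tau : 'I_j.+1 -> 'I_k.+1 * bool) B
    (phi : 'I_k.+1 -> Rn -> Rn -> C) i,
  tau ord0 = (ord0, false) -> (forall i, i != ord0 -> increment (tau i)) ->
  bounded B -> all_testL phi ->
  pairing_gauge K (i == ord0)%:R c B (item phi (tau i)) <=
  a * pairing_gauge K ((tau i).1 == ord0)%:R c.+1 (B `|` DX_image Omega X B) (phi (tau i).1).
Proof.
have [a [a0 Ha]] := seminorm_KB_DSK oO sX oU UO cK KU cL LO c.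
exists (a + 1); split=> [|j k tau B phi i tau0 tauS bB mphi]; first exact: addr_ge0.
have bB' := lcs_boundedU bB (DX_image_bounded oO sX bB).
have h0 e u := pairing_gauge_ge0 oO oU UO cK KU cL LO e bB' c.+1 (mphi u).
have mono e u : pairing_gauge K e c B (phi u) <=
    (a + 1) * pairing_gauge K e c.+1 (B `|` DX_image Omega X B) (phi u).
  rewrite mulrDl mul1r; apply: (@le_trans _ _ (pairing_gauge K e c.+1 (B `|` DX_image Omega X B) (phi u))).
    by apply: (pairing_gauge_mono oO oU UO cK KU cL LO) => //; exact: subsetUl.
  by rewrite lerDr mulr_ge0.
have [->|i0] := eqVneq i ord0; first by rewrite tau0 eqxx /item/=; exact: mono.
have := tauS _ i0; case: (tau i) => u [] /=; rewrite /increment /item/=; last first.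
  by rewrite orbF => /negPf ->; exact: mono.
move=> _; rewrite -seminorm_KBE.
apply: le_trans (Ha (u == ord0)%:R B _ bB (mphi u)) _.
by rewrite mulrDl mul1r lerDl h0.
Qed.

Definition negligible_estimate k (A : functional k) :=
  exists c l (p : mpoly.mpoly (k.+1 + k.+1) R) B, [/\ polyI p, bounded B &
    forall phi, all_testL phi -> A phi <= mpoly.meval (weights c l B phi) p].

(** The y-variables are exchanged for y-variables and the z-variables for
    z-variables, so that the ideal is preserved. *)
Lemma negligible_estimate_class : estimate_class negligible_estimate.
Proof.
split.
- move=> k A A' AA' [c [l [p [B [hp bB H]]]]]; exists c, l, p, B; split=> // phi mphi.
  exact: le_trans (AA' _ mphi) (H _ mphi).
- move=> k A A' [c [l [p [B [hp bB H]]]]] [c' [l' [p' [B' [hp' bB' H']]]]].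
  have bU := lcs_boundedU bB bB'.
  exists (maxn c c'), (maxn l l'), (p + p'), (B `|` B'); split=> //; first exact: polyID.
  move=> phi mphi; rewrite mpoly.mevalD; apply: lerD.
    apply: le_trans (H _ mphi) _; apply: meval_mono; first exact: hp.1.
    by move=> i; apply: weights_mono; rewrite ?leq_maxl//; exact: subsetUl.
  apply: le_trans (H' _ mphi) _; apply: meval_mono; first exact: hp'.1.
  by move=> i; apply: weights_mono; rewrite ?leq_maxr//; exact: subsetUr.
- move=> k a A a0 [c [l [p [B [hp bB H]]]]]; exists c, l, (a *: p), B.
  split=> //; first exact: polyIZ.
  by move=> phi mphi; rewrite mpoly.mevalZ ler_wpM2l// H.
- move=> j k tau A tau0 tauS [c [l [p [B [hp bB H]]]]].
  have [a [a0 Ha]] := seminorm_KL_item c l; have [b [b0 Hb]] := gauge_item c.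
  have bB' := lcs_boundedU bB (DX_image_bounded oO sX bB).
  have ab0 : 0 <= a + b by exact: addr_ge0.
  exists c.+1, l.+1, (mpoly.comp_mpoly (rescale (a + b) (block_map (fun i => (tau i).1))) p),
    (B `|` DX_image Omega X B).
  split=> //; first exact: polyI_rescale.
  move=> phi mphi; have mitem i := item_mem (tau i) mphi.
  apply: le_trans (H _ mitem) _; apply: meval_rescale; first exact: hp.1.
  move=> i; rewrite weights_ge0//= [X in _ <= _ * X]/weights split_block_map /weights.
  case: (fintype.split i) => u.
    apply: le_trans (Ha _ phi (tau u) mphi) _; rewrite mulrDl lerDl mulr_ge0//.
    exact: (seminorm_KL_ge0 oU cK KU cL).
  rewrite (distance_gauge c B (fun i => item phi (tau i))) distance_gauge.
  apply: le_trans (Hb _ _ tau B phi u tau0 tauS bB mphi) _; rewrite mulrDl lerDr mulr_ge0//.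
  exact: (pairing_gauge_ge0 oO oU UO cK KU cL LO).
Qed.

End Estimates.

Lemma cptin_subset (R : realType) (n : nat) (K U : set 'rV[R]_n) : cptin K U ->
  compact K /\ K `<=` U.
Proof. by move=> [cK KU]; split=> //; exact: subset_trans KU (@interior_subset _ _). Qed.

Theorem theorem13 (R : realType) (n : nat) (Omega : set 'rV[R]_n)
    (X : 'rV[R]_n -> 'rV[R]_n) (Omega_open : open Omega)
    (X_smooth : smooth_on Omega X) :
  ((Dtilde X @` moderate_family Omega `<=` moderate_family Omega) /\
   (Dhat Omega X @` moderate_family Omega `<=` moderate_family Omega)) /\
  ((Dtilde X @` negligible_family Omega `<=` negligible_family Omega) /\
   (Dhat Omega X @` negligible_family Omega `<=` negligible_family Omega)).
Proof.
split; split=> _ [F [bF HF] <-].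
- split=> [|x Ox]; first exact: Dtilde_basic_space.
  have [U [oU UO Ux HU]] := HF x Ox; exists U; split=> // K L KU LU m k.
  have [cK KU'] := cptin_subset KU; have [cL LU'] := cptin_subset LU.
  exact: (est_Dtilde Omega_open X_smooth oU UO cK KU' cL LU'
    (moderate_estimate_class Omega_open X_smooth oU UO cK KU' cL LU') bF (HU K L KU LU)).
- split=> [|x Ox]; first exact: Dhat_basic_space.
  have [U [oU UO Ux HU]] := HF x Ox; exists U; split=> // K L KU LU m k.
  have [cK KU'] := cptin_subset KU; have [cL LU'] := cptin_subset LU.
  exact: (est_Dhat Omega_open X_smooth oU UO cK KU' cL LU'
    (moderate_estimate_class Omega_open X_smooth oU UO cK KU' cL LU') bF (HU K L KU LU)).
- split=> [|x Ox]; first exact: Dtilde_basic_space.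
  have [U [oU UO Ux HU]] := HF x Ox; exists U; split=> // K L KU LU m k.
  have [cK KU'] := cptin_subset KU; have [cL LU'] := cptin_subset LU.
  exact: (est_Dtilde Omega_open X_smooth oU UO cK KU' cL LU'
    (negligible_estimate_class Omega_open X_smooth oU UO cK KU' cL LU') bF (HU K L KU LU)).
- split=> [|x Ox]; first exact: Dhat_basic_space.
  have [U [oU UO Ux HU]] := HF x Ox; exists U; split=> // K L KU LU m k.
  have [cK KU'] := cptin_subset KU; have [cL LU'] := cptin_subset LU.
  exact: (est_Dhat Omega_open X_smooth oU UO cK KU' cL LU'
    (negligible_estimate_class Omega_open X_smooth oU UO cK KU' cL LU') bF (HU K L KU LU)).
Qed.
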